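(* Let $\Delta$ be a finite diagram of uniform ANRs and uniformly continuous maps. Then the homotopy limit and the homotopy colimit of $\Delta$ are uniform ANRs.
   Context: A uniform ANR is a metrizable uniform space $Y$ such that for every uniform embedding $i$ of $Y$ onto a closed subspace of a metrizable uniform space $Z$ there exists a uniformly continuous retraction onto $i(Y)$ of some uniform neighborhood of $i(Y)$ in $Z$ (a set containing an $\varepsilon$-neighborhood of $i(Y)$ for some $\varepsilon>0$). A finite diagram is a functor $D$ from a finite category $I$ whose nerve has only finitely many nondegenerate simplices (i.e. there are no cycles of non-identity morphisms) to the category of uniform spaces and uniformly continuous maps. For $n\ge 0$, an $n$-chain is a sequence $\sigma=(i_0\to i_1\to\dots\to i_n)$ of composable non-identity morphisms of $I$ (an object if $n=0$), with faces $d_k\sigma$ obtained by omitting $i_k$ and composing if necessary. $\Delta^n$ is the standard $n$-simplex and $\delta^k\colon\Delta^{n-1}\to\Delta^n$ is the inclusion of the face opposite to the $k$th vertex. The homotopy colimit of $D$ is the quotient of the uniform disjoint union $\bigsqcup_\sigma D(i_0)\times\Delta^n$ over all chains $\sigma$ by the equivalence relation generated, for all $n\ge1$, by $(x,\delta^k t)_\sigma\sim(x,t)_{d_k\sigma}$ for $k>0$ and $(x,\delta^0t)_\sigma\sim(D(i_0\to i_1)(x),t)_{d_0\sigma}$, endowed with the quotient uniformity (the finest pre-uniformity making the quotient map uniformly continuous). For a single map $f\colon X\to Y$ this is the mapping cylinder of $f$. The homotopy limit of $D$ is the subspace of the product $\prod_\sigma U(\Delta^n,D(i_n))$ over all chains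 $\sigma$ consisting of the families $(\varphi_\sigma)$ such that, for all $n\ge 1$, $\varphi_\sigma\circ\delta^k=\varphi_{d_k\sigma}$ for $k<n$ and $\varphi_\sigma\circ\delta^n=D(i_{n-1}\to i_n)\circ\varphi_{d_n\sigma}$. Here $U(K,Y)$ is the space of uniformly continuous maps $K\to Y$ with the uniformity of uniform convergence. For a single map $f\colon X\to Y$ this is the mapping cocylinder $\{(x,p)\in X\times U([0,1],Y)\mid f(x)=p(0)\}$, up to orientation of the interval. *)

(* Defs.v *)
From HB Require Import structures.
From mathcomp Require Import all_boot all_order all_algebra generic_quotient.
From mathcomp Require Import all_classical all_reals topology.
From Stdlib Require Import Relations.

Set Implicit Arguments.
Unset Strict Implicit.
Unset Printing Implicit Defensive.

Import Order.TTheory GRing.Theory Num.Theory.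
Import numFieldTopology.Exports.

Local Open Scope classical_set_scope.
Local Open Scope ring_scope.

(* A [uniformType] need not be Hausdorff: it is a pre-uniform space.
   Separation of a uniform ANR is part of its metrizability. *)

Section UniformANR.
Variable R : realType.

Definition is_metric (T : Type) (d : T -> T -> R) : Prop :=
  [/\ forall x y, d x y = 0 <-> x = y,
      forall x y, d x y = d y x &
      forall x y z, d x z <= d x y + d y z].

Definition metrizes (T : uniformType) (d : T -> T -> R) : Prop :=
  is_metric d /\
  @entourage T = entourage_ (fun x (e : R) => [set y | d x y < e]).

Definition uniform_embedding (Y Z : uniformType) (i : Y -> Z) : Prop :=
  [/\ injective i, unif_continuous i &
      forall E, entourage E ->
        exists2 F, entourage F & forall x y, F (i x, i y) -> E (x, y)].

Definition uniform_nbhd (Z : uniformType) (d : Z -> Z -> R) (A N : set Z) :=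
  exists2 e : R, 0 < e & forall a z, A a -> d a z < e -> N z.

Definition uniform_retraction (Z : uniformType) (A N : set Z) (r : N -> Z) :=
  [/\ unif_continuous r,
      forall z : N, A (r z) &
      forall z : N, A (\val z) -> r z = \val z].

Definition uniform_ANR (Y : uniformType) : Prop :=
  (exists d : Y -> Y -> R, metrizes d) /\
  forall (Z : uniformType) (d : Z -> Z -> R) (i : Y -> Z),
    metrizes d -> uniform_embedding i -> closed (range i) ->
    exists (N : set Z) (r : N -> Z),
      uniform_nbhd d (range i) N /\ uniform_retraction (range i) r.

End UniformANR.

(* The uniform disjoint union. It induces the topology that the library
   already puts on [{i & X i}]. *)
Section Coproduct.
Local Open Scope relation_scope.
Context {I : choiceType} {X : I -> uniformType}.
Implicit Types A : set ({i & X i} * {i & X i}).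

Definition sigT_ent : set_system ({i & X i} * {i & X i}) :=
  [set A | forall i, entourage [set xy | A (existT X i xy.1, existT X i xy.2)]].

Let sigT_ent_filter : Filter sigT_ent.
Proof.
split=> [i|A B eA eB i|A B AB eA i].
- exact: filterT.
- exact: filterI (eA i) (eB i).
- by apply: filterS (eA i) => xy; apply: AB.
Qed.

Let sigT_ent_refl A : sigT_ent A -> diagonal `<=` A.
Proof.
by move=> eA [[i x] y] /diagonalP/= <-; apply: (entourage_refl x (eA i)).
Qed.

Let sigT_ent_inv A : sigT_ent A -> sigT_ent A^-1.
Proof. by move=> eA i; apply: entourage_inv (eA i). Qed.

Let sigT_ent_split A : sigT_ent A -> exists2 B, sigT_ent B & B \; B `<=` A.
Proof.
move=> eA; pose B i := split_ent [set xy | A (existT X i xy.1, existT X i xy.2)].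
exists [set p | exists i (x y : X i),
    [/\ B i (x, y), p.1 = existT X i x & p.2 = existT X i y]].
  move=> i; apply: filterS (entourage_split_ent (eA i)) => -[x y] Bxy.
  by exists i, x, y.
move=> [p q] [r [i [x [y [Bxy /= -> ->]]]] [j [y' [z [Byz /= e ->]]]]].
have ij : i = j by have := congr1 (@projT1 _ _) e.
subst j; have yy' : y = y' by apply: eq_from_Tagged e.
by subst y'; apply: (entourage_split y (eA i) Bxy Byz).
Qed.

Let sigT_ent_nbhs : @nbhs _ {i & X i} = nbhs_ sigT_ent.
Proof.
rewrite predeq2E => -[i x] U; split.
  move=> /nbhsP[E entE EU].
  exists [set p | projT1 p.1 = projT1 p.2 /\ forall y z : X i,
      p.1 = existT X i y -> p.2 = existT X i z -> E (y, z)].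
    move=> j; have [ij|ij] := pselect (i = j).
      subst j; apply: (@filterS _ entourage _ E) => //.
      move=> -[y z] Eyz; split=> // y' z' /=.
      move=> e1 e2; have <- : y = y' by exact: eq_from_Tagged e1.
      by have <- : z = z' by exact: eq_from_Tagged e2.
    apply: (@filterS _ entourage _ setT) filterT => -[y z] _; split=> // y' z' /=.
    by move=> /(congr1 (@projT1 _ _))/= ji; case: ij.
  move=> [j y] /xsectionP/= [/= ij H]; subst j.
  by apply: EU; apply/xsectionP; exact: H.
move=> [A eA AU]; apply/nbhsP.
exists [set xy | A (existT X i xy.1, existT X i xy.2)]; first exact: eA.
by move=> y /xsectionP/= Axy; apply: AU; apply/xsectionP.
Qed.

HB.instance Definition _ := Nbhs_isUniform.Build {i & X i}
  sigT_ent_filter sigT_ent_refl sigT_ent_inv sigT_ent_split sigT_ent_nbhs.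

End Coproduct.

Section QuotientUniformity.
Local Open Scope relation_scope.
Local Open Scope quotient_scope.

Definition preuniformity (T : Type) (U : set_system (T * T)) : Prop :=
  [/\ Filter U,
      forall A, U A -> diagonal `<=` A,
      forall A, U A -> U A^-1 &
      forall A, U A -> exists2 B, U B & B \; B `<=` A].

Definition quotient_uniform (T : Type) (Q : quotType T) : Type := Q.

Context {T : uniformType} {Q0 : quotType T}.
Local Notation Q := (quotient_uniform Q0).

HB.instance Definition _ := Quotient.copy Q Q0.
HB.instance Definition _ := [Sub Q of T by %/].
HB.instance Definition _ := [Choice of Q by <:].

Definition pi_uniform (U : set_system (Q * Q)) : Prop :=
  forall A, U A -> entourage [set xy : T * T | A (\pi_Q xy.1, \pi_Q xy.2)].

(* The union of all the pre-uniformities for which the projection is uniformly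
   continuous. It is itself one of them, hence the finest one. *)
Definition quotient_ent : set_system (Q * Q) :=
  [set A | exists U, [/\ preuniformity U, pi_uniform U & U A]].

Let quotient_ent_filter : Filter quotient_ent.
Proof.
split.
- exists [set setT]; split=> //; last by move=> A ->; exact: filterT.
  split=> [|A -> //|A -> //|A ->]; last by exists setT.
  split=> // [A B -> ->|A B AB EA]; first by rewrite /= setTI.
  by apply/seteqP; split=> // x _; apply: AB; rewrite EA.
- move=> A B [U [[FU rU iU sU] pU UA]] [V [[FV rV iV sV] pV VB]].
  exists [set E | exists C D, [/\ U C, V D & C `&` D `<=` E]]; split.
  + split.
    * split.
      - by exists setT, setT; split=> //; exact: filterT.
      - move=> E E' [C [D [UC VD CD]]] [C' [D' [UC' VD' CD']]].
        exists (C `&` C'), (D `&` D'); split; [exact: filterI..|].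
        by move=> x [[? ?] [? ?]]; split; [exact: CD | exact: CD'].
      - by move=> E E' EE' [C [D [UC VD CD]]]; exists C, D; split=> // x /CD/EE'.
    * move=> E [C [D [UC VD CD]]] x dx.
      by apply: CD; split; [exact: rU dx | exact: rV dx].
    * move=> E [C [D [UC VD CD]]]; exists C^-1, D^-1.
      by split; [exact: iU | exact: iV | move=> x [? ?]; exact: CD].
    * move=> E [C [D [UC VD CD]]].
      have [C' UC' sC] := sU _ UC; have [D' VD' sD] := sV _ VD.
      exists (C' `&` D'); first by exists C', D'; split.
      move=> x [y [C1 D1] [C2 D2]]; apply: CD.
      by split; [apply: sC; exists y | apply: sD; exists y].
  + move=> E [C [D [UC VD CD]]].
    by apply: filterS (filterI (pU _ UC) (pV _ VD)) => x; exact: CD.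
  + by exists A, B; split.
- move=> A B AB [U [[FU rU iU sU] pU UA]]; exists U; split=> //.
  exact: filterS UA.
Qed.

Let quotient_ent_refl A : quotient_ent A -> diagonal `<=` A.
Proof. by move=> [U [[_ rU _ _] _ UA]]; exact: rU. Qed.

Let quotient_ent_inv A : quotient_ent A -> quotient_ent A^-1.
Proof. by move=> [U [pU cU UA]]; exists U; split=> //; case: pU => _ _ + _; apply. Qed.

Let quotient_ent_split A :
  quotient_ent A -> exists2 B, quotient_ent B & B \; B `<=` A.
Proof.
move=> [U [pU cU UA]]; have [_ _ _ /(_ _ UA)[B UB BA]] := pU.
by exists B => //; exists U.
Qed.

HB.instance Definition _ := isUniform.Build Q
  quotient_ent_filter quotient_ent_refl quotient_ent_inv quotient_ent_split.

Lemma pi_unif_continuous : unif_continuous (\pi_Q : T -> Q).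
Proof. by move=> A [U [_ cU UA]]; exact: cU. Qed.

Lemma quotient_uniform_finest (U : set_system (Q * Q)) :
  preuniformity U -> pi_uniform U -> U `<=` entourage.
Proof. by move=> pU cU A UA; exists U. Qed.

End QuotientUniformity.

Section Simplex.
Variable R : realType.

Definition simplex_set (n : nat) : set 'rV[R]_n.+1 :=
  [set t | (forall j, 0 <= t 0 j) /\ \sum_j t 0 j = 1].

Definition simplex (n : nat) : uniformType := set_type (@simplex_set n).

Definition coface_fun n (k : 'I_n.+2) (t : 'rV[R]_n.+1) : 'rV[R]_n.+2 :=
  \row_j (if unlift k j is Some j' then t 0 j' else 0).

Lemma coface_fun_simplex n (k : 'I_n.+2) (t : simplex n) :
  coface_fun k (\val t) \in @simplex_set n.+1.
Proof.
case: t => t /= /set_mem[t0 t1]; apply/mem_set; split=> [j|].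
  by rewrite mxE; case: unlift.
rewrite (bigD1_ord k)//= mxE unlift_none add0r -[RHS]t1.
by apply: eq_bigr => j _; rewrite mxE liftK.
Qed.

(* The inclusion of the face opposite to the [k]-th vertex. *)
Definition coface n (k : 'I_n.+2) (t : simplex n) : simplex n.+1 :=
  exist _ (coface_fun k (\val t)) (coface_fun_simplex k t).

End Simplex.


Record category := Category {
  ob :> Type;
  hom : ob -> ob -> Type;
  idm : forall a, hom a a;
  comp : forall a b c, hom b c -> hom a b -> hom a c;
  comp_idl : forall a b (f : hom a b), comp (idm b) f = f;
  comp_idr : forall a b (f : hom a b), comp f (idm a) = f;
  comp_assoc : forall a b c d (h : hom c d) (g : hom b c) (f : hom a b),
    comp h (comp g f) = comp (comp h g) f
}.
Arguments idm {_} a.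
Arguments comp {_ a b c} g f : rename.

Variant is_identity (C : category) (a : C) : forall b, hom a b -> Prop :=
  IsIdentity : is_identity (idm a).

(* An [n]-simplex of the nerve: a functor to [C] from the ordinal
   [0 -> 1 -> ... -> n]. It amounts to a sequence of [n] composable morphisms,
   [edge k l] being the composite of those between the vertices [k] and [l]. *)
Record nerve (C : category) (n : nat) := Nerve {
  vertex : 'I_n.+1 -> C;
  edge : forall k l : 'I_n.+1, (k <= l)%N -> hom (vertex k) (vertex l);
  edge_id : forall (k : 'I_n.+1) (kk : (k <= k)%N), edge kk = idm (vertex k);
  edge_comp : forall (k l m : 'I_n.+1)
    (kl : (k <= l)%N) (lm : (l <= m)%N) (km : (k <= m)%N),
    edge km = comp (edge lm) (edge kl)
}.
Arguments edge {C n} s {k l} : rename.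
Arguments edge_id {C n s k} : rename.
Arguments edge_comp {C n s k l m} : rename.

Definition nondegenerate (C : category) (n : nat) (s : nerve C n) : Prop :=
  forall (k l : 'I_n.+1) (kl : (k <= l)%N),
    l = k.+1 :> nat -> ~ is_identity (edge s kl).

Record chain (C : category) (n : nat) := Chain {
  chain_nerve :> nerve C n;
  chain_nondegenerate : nondegenerate chain_nerve
}.

HB.instance Definition _ C n := gen_eqMixin (chain C n).
HB.instance Definition _ C n := gen_choiceMixin (chain C n).

Record finite_category := FiniteCategory {
  fincat :> category;
  finite_chains : finite_set [set: {n & chain fincat n}]
}.

Section NerveFace.
Variables (C : category) (n : nat) (k : 'I_n.+2) (s : nerve C n.+1).

Lemma lift_le (i j : 'I_n.+1) : (i <= j)%N -> (lift k i <= lift k j)%N.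
Proof. by rewrite /= leq_bump2. Qed.

Program Definition nerve_face : nerve C n :=
  @Nerve C n (fun j => vertex s (lift k j))
    (fun i j ij => edge s (lift_le ij)) _ _.
Next Obligation. by move=> i ii; exact: edge_id. Qed.
Next Obligation. by move=> i j l ij jl il; exact: edge_comp. Qed.

End NerveFace.

(* In a category with finitely many chains a composite of non-identity
   morphisms is never an identity, so that faces of chains are chains. *)
Section Alternating.
Variables (C : category) (a b : C) (f : hom a b) (g : hom b a).
Hypotheses (fN : ~ is_identity f) (gN : ~ is_identity g).
Hypothesis gf : comp g f = idm a.

Let alt (o : bool) : C := if o then b else a.

Let altm (o p : bool) : hom (alt o) (alt p) :=
  match o, p with
  | false, false => idm a
  | false, true => f
  | true, false => g
  | true, true => comp f g
  end.

Let altmM o p q : altm o q = comp (altm p q) (altm o p).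
Proof.
case: o p q => [] [] [] /=; rewrite ?comp_idl ?comp_idr ?gf //.
- by rewrite comp_assoc -(comp_assoc f) gf comp_idr.
- by rewrite comp_assoc gf comp_idl.
- by rewrite -comp_assoc gf comp_idr.
Qed.

Let alt_edge n (k l : 'I_n.+1) : hom (alt (odd k)) (alt (odd l)) :=
  match @eqP _ k l with
  | ReflectT e => ecast z (hom (alt (odd k)) (alt (odd z))) e (idm _)
  | ReflectF _ => altm (odd k) (odd l)
  end.

Let alt_edge_id n (k : 'I_n.+1) : alt_edge k k = idm _.
Proof. by rewrite /alt_edge; case: eqP => // e; rewrite (eq_axiomK e). Qed.

Let alt_edge_neq n (k l : 'I_n.+1) : k <> l -> alt_edge k l = altm (odd k) (odd l).
Proof. by rewrite /alt_edge; case: eqP. Qed.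

Lemma alternating_chain n : exists s : chain C n, True.
Proof.
unshelve eexists; last by [].
unshelve eapply Chain.
  apply: (@Nerve C n (fun k => alt (odd k)) (fun k l _ => alt_edge k l)).
    by move=> k _; exact: alt_edge_id.
  move=> k l m kl lm km.
  have [<-|lm'] := eqVneq l m; first by rewrite alt_edge_id comp_idl.
  have [<-|kl'] := eqVneq k l; first by rewrite alt_edge_id comp_idr.
  have km' : k <> m.
    move=> e; subst m; case/eqP: kl'; apply: val_inj.
    by apply/eqP; rewrite eqn_leq kl lm.
  by rewrite !alt_edge_neq ?altmM//; exact/eqP.
move=> k l kl e /=; rewrite alt_edge_neq; last first.
  by move=> kl'; move: e; rewrite kl' => /eqP; rewrite ltn_eqF.
rewrite e /=; by case: (odd k).
Qed.

End Alternating.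

Section FiniteCategoryTheory.
Variable C : finite_category.

Lemma comp_not_identity (a b c : C) (f : hom a b) (g : hom b c) :
  ~ is_identity f -> ~ is_identity g -> ~ is_identity (comp g f).
Proof.
move=> fN gN gfI.
have [e] : exists e : a = c, comp g f = ecast z (hom a z) e (idm a).
  by case: gfI; exists erefl.
case: c / e g gN gfI => g gN _ /= gf.
suff : finite_set [set: nat] by exact: infinite_nat.
apply: sub_finite_set (finite_image (@projT1 _ _) (finite_chains C)) => n _.
by have [s _] := alternating_chain fN gN gf n; exists (existT _ n s).
Qed.

Lemma edge_not_identity n (s : chain C n) (k l : 'I_n.+1) (kl : (k <= l)%N) :
  (k < l)%N -> ~ is_identity (edge s kl).
Proof.
move=> kl'; have [/eqP e|kSl] := boolP (l == k.+1 :> nat).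
  exact: chain_nondegenerate.
have {}kSl : (k.+1 < l)%N by rewrite ltn_neqAle eq_sym kSl.
have Sn : (k.+1 < n.+1)%N by exact: leq_trans kSl (ltnW (ltn_ord l)).
pose m := Ordinal Sn; have km : (k <= m)%N by exact: leqnSn.
have ml : (m <= l)%N by exact: ltnW.
have fN : ~ is_identity (edge s km) by exact: chain_nondegenerate.
rewrite (edge_comp km ml kl); have [gI|gN] := pselect (is_identity (edge s ml)).
  move: (edge s km) fN; case: gI => f fN; by rewrite comp_idl.
exact: comp_not_identity.
Qed.

Lemma nerve_face_nondegenerate n (k : 'I_n.+2) (s : chain C n.+1) :
  nondegenerate (nerve_face k s).
Proof.
move=> i j ij e; apply: edge_not_identity.
by rewrite ltnNge /= leq_bump2 -ltnNge e.
Qed.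

Definition face n (k : 'I_n.+2) (s : chain C n.+1) : chain C n :=
  Chain (@nerve_face_nondegenerate n k s).

End FiniteCategoryTheory.

Record diagram (C : category) := Diagram {
  dob :> C -> uniformType;
  dmap : forall a b, hom a b -> dob a -> dob b;
  dmap_unif_continuous : forall a b (f : hom a b), unif_continuous (dmap f);
  dmap_id : forall a x, dmap (idm a) x = x;
  dmap_comp : forall a b c (g : hom b c) (f : hom a b) x,
    dmap (comp g f) x = dmap g (dmap f x)
}.

Arguments dmap {C} d {a b}.

Section HomotopyColimit.
Variables (R : realType) (I : finite_category) (D : diagram I).

Definition hocolim_sum : uniformType :=
  {s : {n & chain I n} &
    (D (vertex (projT2 s) ord0) * simplex R (projT1 s))%type}.

Definition hocolim_cell n (s : chain I n) (x : D (vertex s ord0))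
    (t : simplex R n) : hocolim_sum :=
  existT (fun s : {n & chain I n} =>
    (D (vertex (projT2 s) ord0) * simplex R (projT1 s))%type)
    (existT _ n s) (x, t).

(* The initial vertex of [face k s] is the vertex [lift k ord0] of [s]. Hence
   the edge below is [i_0 -> i_1] if [k = 0], and an identity otherwise. *)
Variant hocolim_glue : hocolim_sum -> hocolim_sum -> Prop :=
  HocolimGlue n (s : chain I n.+1) (k : 'I_n.+2)
      (x : D (vertex s ord0)) (t : simplex R n) :
    hocolim_glue (hocolim_cell x (coface k t))
      (@hocolim_cell n (face k s)
        (dmap D (edge s (leq0n (lift k ord0) : (@ord0 n.+1 <= _)%N)) x) t).

Definition hocolim_rel : rel hocolim_sum :=
  fun p q => `[< clos_refl_sym_trans _ hocolim_glue p q >].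

Lemma hocolim_rel_equiv : equiv_class_of hocolim_rel.
Proof.
split=> [p|p q|q p r].
- by apply/asboolP; exact: rst_refl.
- by apply/asboolP/asboolP; exact: rst_sym.
- by move=> /asboolP pq /asboolP qr; apply/asboolP; exact: rst_trans pq qr.
Qed.

Canonical hocolim_equiv := EquivRelPack hocolim_rel_equiv.

Definition hocolim : uniformType :=
  quotient_uniform {eq_quot hocolim_equiv}%qT.

End HomotopyColimit.

Section HomotopyLimit.
Variables (R : realType) (I : finite_category) (D : diagram I).

Definition unif_maps (K Y : uniformType) : uniformType :=
  set_type [set f : arrow_uniform_type K Y | unif_continuous (f : K -> Y)].

Definition holim_prod : uniformType :=
  prod_topology (fun s : {n & chain I n} =>
    unif_maps (simplex R (projT1 s)) (D (vertex (projT2 s) ord_max))).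

Definition holim_comp (phi : holim_prod) n (s : chain I n) :
    simplex R n -> D (vertex s ord_max) :=
  \val (phi (existT _ n s)).

(* Dually, the edge below is [i_{n-1} -> i_n] if [k] is the last vertex, and an
   identity otherwise. *)
Definition holim_set : set holim_prod :=
  [set phi | forall n (s : chain I n.+1) (k : 'I_n.+2) (t : simplex R n),
    holim_comp phi s (coface k t) =
    dmap D (edge s (leq_ord (lift k ord_max) : (_ <= @ord_max n.+1)%N))
      (holim_comp phi (face k s) t)].

Definition holim : uniformType := set_type holim_set.

End HomotopyLimit.

(* Main.v *)
Require Import Defs.
From mathcomp Require Import all_boot all_algebra all_classical all_reals topology.
From mathcomp Require Import all_order generic_quotient finmap ring lra zify.
From HB Require Import structures.
From Stdlib Require Import Relations.
Require Import Defs.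

Set Implicit Arguments.
Unset Strict Implicit.
Unset Printing Implicit Defensive.

Import Order.TTheory GRing.Theory Num.Theory.
Import numFieldTopology.Exports.

Local Open Scope classical_set_scope.
Local Open Scope ring_scope.

(** A metric space with a metric bounded by 1 is a uniform ANR as soon as 1-Lipschitz maps
into it from closed subsets of metric spaces extend to uniformly continuous maps on uniform
neighborhoods ([uniform_extensor_ANR]): a uniformly continuous map becomes 1-Lipschitz when a
modulus of continuity is added to the metric of its domain. Conversely, the Kuratowski embedding
sends a uniform ANR to functions on it, and functions near the image, paired with a height that
may vanish only on the image, retract to the space in a uniformly continuous way
([uniform_ANR_retraction]). Real functions being easy to extend, an extension of a map into a
uniform ANR is obtained by extending the real functions that describe it and applying this
retraction. The proof does so for all the spaces of the diagram at once.

The homotopy limit is metrized by the largest distance between components, there being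
finitely many chains ([holim_metrizes]). A map [f] from [A] into it is a family of maps
[A * simplex -> D], indexed by chains, and these are extended by induction on the length
of the chain ([holim_extensor]). The faces prescribe an extension on the boundary of the simplex.
The functions [d (f a t) _] are extended from [A] to all of the ambient space; the result is
corrected on the boundary, where it becomes the prescribed extension; and it is retracted to the
space, at a height that is the product of the distance to [A] and of the barycentric coordinates
of [t], and hence vanishes only where the functions already belong to the image of the space. The
usual extension of Lipschitz functions fails to be continuous in [t], so that another one is used
([regular_extension]).

A point of the homotopy colimit is a point [x] of the first space of a chain with weights on
the vertices of this chain, and has a value at each vertex, the image of [x]. Its coordinates are
the weights of the objects, those of the morphisms (for an edge of the chain, the smaller of the
weights of its ends) and, for each point [v] over an object [j], the weight of [j] times the
distance from the value at [j] to [v]. They respect the identifications, and metrize the quotient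
([hocolim_metrizes]): if all coordinates of two points are close, then the vertices of the first
that have a large weight and the edges between them belong also to the chain of the second, so
that both points are close to the cell of this common subchain ([common_cell]).

To extend a map [f] from [A] into the homotopy colimit ([hocolim_extensor]), all coordinates are
extended as real functions. At a point [z] near [A] they are those of some [f a] up to an error
that is small with respect to [sg], the square root of the distance to [A]. An object whose weight
is large with respect to [sg] occurs in [f a]. Its weighted distances, divided by its weight, are
close to a point of the Kuratowski image, and can be retracted to a value in the space. Values
found independently at two objects need not correspond to each other under the morphism between
them, as they must wherever both objects keep a positive weight. So by induction along the
morphisms of the diagram, which has no cycles, the value at an object is taken to be the one
transported from a preceding object when both weights are large with respect to [sg], the
independent value when one is small, and the retraction of a mixture in between
([extended_values_exist]). Decreasing the weights by a large multiple of [sg] and normalizing them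
leaves only objects with corresponding values, which form a point of the homotopy colimit
([realization]). Uniform continuity is proved by induction away from [A] ([values_ucont_away]),
where all the functions involved are Lipschitz; near [A] it holds because the new values are close
to those of [f] ([values_near]). *)

(** * Suprema and metrics *)

Section RealFamilies.
Variable R : realType.
Implicit Types (T : Type) (e M x y : R).

(** Over an empty index type both are zero; hence the sign condition in [supr_le],
and the inhabitant in [infr_ge]. *)
Definition supr T (g : T -> R) := sup (range g).
Definition infr T (g : T -> R) := inf (range g).

Lemma supr_ub T (g : T -> R) M t : (forall t, g t <= M) -> g t <= supr g.
Proof. by move=> gM; apply: ub_le_sup; [exists M => _ [u _ <-] | exists t]. Qed.

Lemma supr_le T (g : T -> R) e : 0 <= e -> (forall t, g t <= e) -> supr g <= e.
Proof.
move=> e0 ge; have [[t _]|/forallNP T0] := pselect (exists t : T, True).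
  by apply: ge_sup => [|_ [u _ <-]//]; exists (g t), t.
by rewrite /supr (_ : range g = set0) ?sup0//; apply/seteqP; split => // x [t _]; have := T0 t I.
Qed.

Lemma supr_ge0 T (g : T -> R) M : (forall t, 0 <= g t <= M) -> 0 <= supr g.
Proof.
move=> gM; have [[t _]|/forallNP T0] := pselect (exists t : T, True).
  by have /andP[g0 _] := gM t; apply: (le_trans g0); apply: (supr_ub _ (M := M)) => u; case/andP: (gM u).
by rewrite /supr (_ : range g = set0) ?sup0//; apply/seteqP; split => // x [t _]; have := T0 t I.
Qed.

Lemma supr_leD T (g h : T -> R) M e : 0 <= e -> (forall t, 0 <= h t <= M) ->
  (forall t, g t <= h t + e) -> supr g <= supr h + e.
Proof.
move=> e0 hM gh; apply: supr_le => [|t]; first by rewrite addr_ge0// (supr_ge0 hM).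
apply: (le_trans (gh t)); rewrite lerD2r; apply: (supr_ub _ (M := M)) => u.
by case/andP: (hM u).
Qed.

Lemma infr_lb T (g : T -> R) M t : (forall t, M <= g t) -> infr g <= g t.
Proof. by move=> gM; apply: ge_inf; [exists M => _ [u _ <-] | exists t]. Qed.

Lemma infr_ge T (g : T -> R) e (t0 : T) : (forall t, e <= g t) -> e <= infr g.
Proof. by move=> ge; apply: lb_le_inf => [|_ [u _ <-]//]; exists (g t0), t0. Qed.

Lemma absle x e : (`|x| <= e) <-> (- e <= x /\ x <= e).
Proof. by rewrite ler_norml; split=> [/andP[]|[-> ->]]. Qed.

Lemma abslt x e : (`|x| < e) <-> (- e < x /\ x < e).
Proof. by rewrite ltr_norml; split=> [/andP[]|[-> ->]]. Qed.

End RealFamilies.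

Section Metrics.
Variable R : realType.

Lemma metric_ge0 (T : Type) (d : T -> T -> R) : is_metric d -> forall x y, 0 <= d x y.
Proof.
move=> [d0 dC dT] x y; have := dT x y x.
by rewrite (dC y x) ((d0 x x).2 erefl); lra.
Qed.

Lemma metricxx (T : Type) (d : T -> T -> R) x : is_metric d -> d x x = 0.
Proof. by move=> [d0 _ _]; apply/d0. Qed.

Lemma kuratowski_lip (T : Type) (d : T -> T -> R) : is_metric d ->
  forall x y p, `|d x p - d y p| <= d x y.
Proof.
move=> [_ dC dT] x y p; apply/absle.
by have := dT x y p; have := dT y x p; rewrite (dC y x); lra.
Qed.

Lemma metrizesP (T : uniformType) (d : T -> T -> R) : metrizes d ->
  forall E, entourage E <-> exists2 e : R, 0 < e & forall x y, d x y < e -> E (x, y).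
Proof.
move=> [_ ->] E; split=> [[e e0 eE]|[e e0 eE]]; exists e => //.
  by move=> x y xy; exact: eE.
by move=> [x y] /= xy; exact: eE.
Qed.

Lemma metrizes_intro (T : uniformType) (d : T -> T -> R) : is_metric d ->
  (forall E, entourage E <-> exists2 e : R, 0 < e & forall x y, d x y < e -> E (x, y)) ->
  metrizes d.
Proof.
move=> dm dE; split=> //; apply/seteqP; split=> E.
  by move=> /dE[e e0 eE]; exists e => // -[x y] /= ?; exact: eE.
by move=> [e e0 eE]; apply/dE; exists e => // x y xy; exact: eE.
Qed.

Definition capm (T : Type) (d : T -> T -> R) x y := Num.min 1 (d x y).

Lemma capm_metric (T : Type) (d : T -> T -> R) : is_metric d -> is_metric (capm d).
Proof.
move=> dm; have [d0 dC dT] := dm; have dp := metric_ge0 dm; split=> [x y|x y|x y z].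
- rewrite -d0 /capm; have := dp x y; case: (leP 1 (d x y)) => h1 h2; split=> h; lra.
- by rewrite /capm dC.
- rewrite /capm; have := dT x y z; have := dp x y; have := dp y z; have := dp x z.
  by case: (leP 1 (d x y)); case: (leP 1 (d y z)); case: (leP 1 (d x z)) => *; lra.
Qed.

Lemma capm_le1 (T : Type) (d : T -> T -> R) x y : capm d x y <= 1.
Proof. by rewrite /capm ge_min lexx. Qed.

Lemma capm_le (T : Type) (d : T -> T -> R) x y : capm d x y <= d x y.
Proof. by rewrite /capm ge_min lexx orbT. Qed.

Lemma capm_lt (T : Type) (d : T -> T -> R) x y e : e <= 1 -> capm d x y < e -> d x y < e.
Proof. by rewrite /capm; case: (leP 1 (d x y)) => // h h1 h2; lra. Qed.

Lemma capm_metrizes (T : uniformType) (d : T -> T -> R) : metrizes d -> metrizes (capm d).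
Proof.
move=> dd; apply: metrizes_intro; first exact: capm_metric dd.1.
move=> E; rewrite (metrizesP dd); split=> -[e e0 eE].
  exists (Num.min 1 e) => [|x y xy]; first by rewrite lt_min e0 ltr01.
  have [e1 e2] : Num.min 1 e <= 1 /\ Num.min 1 e <= e by rewrite !ge_min !lexx orbT.
  by apply: eE; apply: lt_le_trans e2; apply: capm_lt xy.
by exists e => // x y xy; apply: eE; apply: le_lt_trans xy; exact: capm_le.
Qed.

Definition ucont_on (X Y : Type) (dX : X -> X -> R) (dY : Y -> Y -> R)
  (A : set X) (f : X -> Y) :=
  forall e : R, 0 < e -> exists2 de : R, 0 < de &
    forall x x', A x -> A x' -> dX x x' < de -> dY (f x) (f x') < e.

Lemma unif_continuous_metric (X Y : uniformType) dX dY (f : X -> Y) :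
  metrizes dX -> metrizes dY -> unif_continuous f <-> ucont_on dX dY setT f.
Proof.
move=> mX mY; split=> [fc e e0|fc E].
  have /fc/(metrizesP mX)[de de0 deP] : entourage [set xy | dY xy.1 xy.2 < e].
    by apply/(metrizesP mY); exists e.
  by exists de => // x x' _ _ /deP.
move=> /(metrizesP mY)[e e0 eE]; apply/(metrizesP mX).
by have [de de0 deP] := fc e e0; exists de => // x y xy; apply: eE; exact: deP.
Qed.

End Metrics.

(** * Extension of uniformly continuous maps *)

Section MetricTopology.
Variable R : realType.

Lemma metric_nbhsP (Z : uniformType) (d : Z -> Z -> R) (z : Z) (U : set Z) :
  metrizes d -> nbhs z U <-> exists2 e : R, 0 < e & forall y, d z y < e -> U y.
Proof.
move=> md; split=> [/nbhsP[E /(metrizesP md)[e e0 eE] EU]|[e e0 eU]].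
  by exists e => // y zy; apply: EU; apply/xsectionP; exact: eE.
apply/nbhsP; exists [set xy | d xy.1 xy.2 < e].
  by apply/(metrizesP md); exists e.
by move=> y /xsectionP; exact: eU.
Qed.

Lemma metric_closedP (Z : uniformType) (d : Z -> Z -> R) (A : set Z) :
  metrizes d -> closed A <->
  forall z, (forall e : R, 0 < e -> exists2 a, A a & d a z < e) -> A z.
Proof.
move=> md; have [_ dC _] := md.1; split=> [cA z zA|cA z zA].
  apply: cA => U /(metric_nbhsP _ _ md)[e e0 eU].
  by have [a Aa az] := zA e e0; exists a; split=> //; apply: eU; rewrite dC.
apply: cA => e e0; have [|a [Aa az]] := zA [set y | d z y < e].
  by apply/(metric_nbhsP _ _ md); exists e.
by exists a => //; rewrite dC.
Qed.

End MetricTopology.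

Section MetricSpace.
Variables (R : realType) (T : Type) (d : T -> T -> R).
Hypothesis dm : is_metric d.

(** The metric is a parameter of the type, so that it determines the uniformity. *)
Definition metric_space of is_metric d : Type := T.
Local Notation M := (metric_space dm).

HB.instance Definition _ := gen_eqMixin M.
HB.instance Definition _ := gen_choiceMixin M.

Definition metric_ent : set_system (M * M) :=
  entourage_ (fun (x : T) (e : R) => [set y | d x y < e]).

Local Open Scope relation_scope.

Let metric_ent_filter : Filter metric_ent.
Proof.
apply: filter_from_filter; first by exists 1 => /=.
move=> e f /= e0 f0; exists (Num.min e f); first by rewrite /= lt_min e0 f0.
by move=> [x y] /=; rewrite lt_min => /andP[].
Qed.

Let metric_ent_refl A : metric_ent A -> diagonal `<=` A.
Proof. by move=> [e /= e0 eA] [x y] /diagonalP/= <-; apply: eA => /=; rewrite metricxx. Qed.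

Let metric_ent_inv A : metric_ent A -> metric_ent A^-1.
Proof.
have [_ dC _] := dm.
by move=> [e /= e0 eA]; exists e => // -[x y] /= xy; apply: eA; rewrite /= dC.
Qed.

Let metric_ent_split A : metric_ent A -> exists2 B, metric_ent B & B \; B `<=` A.
Proof.
have [_ _ dT] := dm.
move=> [e /= e0 eA]; exists [set xy : M * M | d xy.1 xy.2 < e / 2].
  by exists (e / 2); rewrite //= divr_gt0.
move=> [x z] [y /= xy yz]; apply: eA => /=; have := dT x y z.
by move: xy yz => /=; lra.
Qed.

HB.instance Definition _ := isUniform.Build M
  metric_ent_filter metric_ent_refl metric_ent_inv metric_ent_split.

Lemma metric_space_metrizes : metrizes (d : M -> M -> R).
Proof. by split. Qed.

End MetricSpace.

Section Extensors.
Variable R : realType.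

Definition metric_closed (Z : Type) (d : Z -> Z -> R) (A : set Z) :=
  forall z, (forall e : R, 0 < e -> exists2 a, A a & d a z < e) -> A z.

Definition metric_nbhd (Z : Type) (d : Z -> Z -> R) (A : set Z) (e : R) : set Z :=
  [set z | exists2 a, A a & d a z < e].

(** Only 1-Lipschitz maps are extended, because the metric of the ambient space may
be enlarged within its uniformity: see [lipschitz_remetrization]. *)
Definition uniform_extensor (Y : Type) (dY : Y -> Y -> R) :=
  forall (Z : Type) (d : Z -> Z -> R) (A : set Z) (f : Z -> Y),
    is_metric d -> A !=set0 -> metric_closed d A ->
    (forall a a', A a -> A a' -> dY (f a) (f a') <= d a a') ->
    exists2 e : R, 0 < e & exists F : Z -> Y,
      (forall a, A a -> F a = f a) /\ ucont_on d dY (metric_nbhd d A e) F.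

Section Modulus.
Variables (Z Y : Type) (d : Z -> Z -> R) (dY : Y -> Y -> R) (A : set Z) (f : Z -> Y).
Hypotheses (dm : is_metric d) (dYm : is_metric dY) (dY1 : forall y y', dY y y' <= 1).
Hypothesis fA : ucont_on d dY A f.

Let affine_bound (b : R * R) := [/\ 0 <= b.1, 0 <= b.2 &
  forall a a', A a -> A a' -> dY (f a) (f a') <= b.1 + b.2 * d a a'].

(** A subadditive modulus of continuity of [f] on [A]. As [dY] is bounded, there are
affine bounds of the oscillation of [f] with an arbitrarily small constant term. *)
Let omega (t : R) : R := inf [set b.1 + b.2 * t | b in affine_bound].

Let bound1 : affine_bound (1, 0).
Proof. by split=> //= a a' _ _; rewrite mul0r addr0. Qed.

Let omega_le b (t : R) : 0 <= t -> affine_bound b -> omega t <= b.1 + b.2 * t.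
Proof.
move=> t0 bb; apply: ge_inf; last by exists b.
exists 0 => _ [c [c1 c2 _] <-]; by rewrite addr_ge0// mulr_ge0.
Qed.

Let omega_ge (t e : R) : (forall b, affine_bound b -> e <= b.1 + b.2 * t) -> e <= omega t.
Proof.
move=> be; apply: lb_le_inf => [|_ [b bb <-]]; last exact: be.
by exists (1 + 0 * t), (1, 0).
Qed.

Let omega_ge0 (t : R) : 0 <= t -> 0 <= omega t.
Proof. by move=> t0; apply: omega_ge => b [b1 b2 _]; rewrite addr_ge0// mulr_ge0. Qed.

Let omega_mono (t t' : R) : 0 <= t -> t <= t' -> omega t <= omega t'.
Proof.
move=> t0 tt'; apply: (@omega_ge t') => b bb; apply: (le_trans (omega_le t0 bb)).
by case: bb => b1 b2 _; rewrite lerD2l ler_wpM2l.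
Qed.

(** Of two affine bounds, the one with the smaller slope serves for the sum. *)
Let omegaD (t t' : R) : 0 <= t -> 0 <= t' -> omega (t + t') <= omega t + omega t'.
Proof.
move=> t0 t'0; rewrite -lerBlDr; apply: (@omega_ge t) => b bb; rewrite lerBlDr -lerBlDl.
apply: (@omega_ge t') => c bc; rewrite lerBlDl.
have [bc2|cb2] := lerP b.2 c.2.
  apply: le_trans (omega_le (addr_ge0 t0 t'0) bb) _.
  have := ler_wpM2r t'0 bc2; case: bc => c1 c2 _; case: bb => b1 b2 _; lra.
apply: le_trans (omega_le (addr_ge0 t0 t'0) bc) _.
have := ler_wpM2r t0 (ltW cb2); case: bc => c1 c2 _; case: bb => b1 b2 _; lra.
Qed.

Let omega_small (e : R) : 0 < e -> exists2 de : R, 0 < de & forall t : R, 0 <= t -> t < de -> omega t < e.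
Proof.
move=> e0; have e20 : 0 < e / 2 by rewrite divr_gt0.
have [de de0 deP] := fA e20; have bb : affine_bound (e / 2, de^-1).
  split=> /=; [exact: ltW|by rewrite invr_ge0 ltW|move=> a a' Aa Aa'].
  have [lt|ge] := ltrP (d a a') de.
    apply: le_trans (ltW (deP _ _ Aa Aa' lt)) _; rewrite lerDl mulr_ge0 ?metric_ge0// invr_ge0 ltW//.
  have : 1 <= de^-1 * d a a' by rewrite ler_pdivlMl// mulr1.
  by have := dY1 (f a) (f a'); rewrite /=; lra.
exists (de * (e / 2)) => [|t t0 te]; first by rewrite mulr_gt0.
apply: le_lt_trans (omega_le t0 bb) _ => /=.
have : de^-1 * t < e / 2 by rewrite ltr_pdivrMl.
by lra.
Qed.

(** The new metric is [d + omega o d], with [omega] the subadditive modulus. *)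
Lemma lipschitz_remetrization : exists d' : Z -> Z -> R, [/\ is_metric d',
  forall a a', A a -> A a' -> dY (f a) (f a') <= d' a a',
  forall e : R, 0 < e -> exists2 de : R, 0 < de & forall z z', d z z' < de -> d' z z' < e &
  forall e : R, 0 < e -> exists2 de : R, 0 < de & forall z z', d' z z' < de -> d z z' < e].
Proof.
have dp := metric_ge0 dm; have [d0 dC dT] := dm.
exists (fun z z' => omega (d z z') + d z z'); split.
- split=> [z z'|z z'|x y z].
  + split=> [h|->].
      by apply/d0; have := omega_ge0 (dp z z'); have := dp z z'; lra.
    rewrite (metricxx _ dm) addr0; apply/eqP; rewrite eq_le omega_ge0// andbT.
    apply/ler_addgt0Pr => e /omega_small[de de0 /(_ 0 (lexx _) de0)]; by rewrite add0r => /ltW.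
  + by rewrite dC.
  + have := omegaD (dp x y) (dp y z); have := omega_mono (dp x z) (dT x y z); have := dT x y z; lra.
- move=> a a' Aa Aa'; apply: (@le_trans _ _ (omega (d a a'))); last by rewrite lerDl.
  by apply: omega_ge => b [_ _]; apply.
- move=> e e0; have e20 : 0 < e / 2 by rewrite divr_gt0.
  have [de de0 deP] := omega_small e20; exists (Num.min de (e / 2)); first by rewrite lt_min de0.
  by move=> z z'; rewrite lt_min => /andP[/(deP _ (dp _ _)) h1 h2]; lra.
- move=> e e0; exists e => // z z'; have := omega_ge0 (dp z z'); lra.
Qed.

End Modulus.

(** The map to be extended is the inverse of the embedding. It needs a default value,
so that the empty space is treated apart. *)
Lemma uniform_extensor_ANR (Y : uniformType) (dY : Y -> Y -> R) : metrizes dY ->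
  (forall y y', dY y y' <= 1) -> uniform_extensor dY -> uniform_ANR R Y.
Proof.
move=> mY dY1 eY; split; first by exists dY.
move=> Z d i md [iI ic iE] cA.
have [[y0 _]|/forallNP Y0] := pselect (exists y : Y, True); last first.
  have A0 z : ~ range i z by move=> [y _ _]; have := Y0 y I.
  exists set0, (fun z => \val z); split; first by exists 1 => // a z /A0.
  by split=> [|z|z]; [by move=> E entE; exists E|have := set_valP z|].
pose f z := xget y0 [set y | i y = z].
have fi y : f (i y) = y by apply: iI; apply: (@xgetPex _ y0 [set y' | i y' = i y]); exists y.
have fA : ucont_on d dY (range i) f.
  move=> e e0; have [] := iE [set yy | dY yy.1 yy.2 < e].
    by apply/(metrizesP mY); exists e.
  move=> F /(metrizesP md)[de de0 deF] FE; exists de => // _ _ [y _ <-] [y' _ <-] yy.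
  by rewrite !fi; apply: FE; exact: deF.
have [d' [d'm d'f dd' d'd]] := lipschitz_remetrization md.1 dY1 fA.
have [|z zA|e e0 [F [FA Fc]]] := eY Z d' (range i) f d'm _ _ d'f.
- by exists (i y0), y0.
- apply: (metric_closedP _ md).1 => // e /d'd[de de0 deP].
  by have [a Aa az] := zA de de0; exists a => //; exact: deP.
exists (metric_nbhd d' (range i) e), (fun z => i (F (\val z))); split.
  by have [de de0 deP] := dd' e e0; exists de => // a z Aa /deP az; exists a.
split=> [E /ic/(metrizesP mY)[e1 e10 e1E]|z|z Az]; last 2 first.
- by exists (F (\val z)).
- by rewrite FA//; case: Az => y _ <-; rewrite fi.
have [e2 e20 e2P] := Fc e1 e10; have [e3 e30 e3P] := dd' e2 e20.
exists [set zz | d zz.1 zz.2 < e3]; first by apply/(metrizesP md); exists e3.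
move=> [z z'] /= zz; apply: (e1E (F (\val z)) (F (\val z'))); apply: e2P.
- exact: set_valP.
- exact: set_valP.
- exact: e3P.
Qed.

End Extensors.

(** * Retractions of function spaces *)

Section Retractions.
Variable R : realType.

(** The extra point [None], at distance 1 from all others, is the value of a partial
retraction where it is undefined. *)
Definition odist (Y : Type) (d : Y -> Y -> R) (x y : option Y) : R :=
  match x, y with
  | Some x, Some y => d x y
  | None, None => 0
  | _, _ => 1
  end.

Lemma odist_metric (Y : Type) (d : Y -> Y -> R) : is_metric d ->
  (forall x y, d x y <= 1) -> is_metric (odist d).
Proof.
move=> dm d1; have [d0 dC dT] := dm; have dp := metric_ge0 dm.
split=> [[x|] [y|]|[x|] [y|]|[x|] [y|] [z|]] //=.
- by rewrite d0; split=> [->|[->]].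
- by split=> // /eqP; rewrite oner_eq0.
- by split=> // /eqP; rewrite oner_eq0.
- by have := dp x y; lra.
- by have := d1 x z; lra.
- by lra.
- by have := dp y z; lra.
- by lra.
- by lra.
- by lra.
Qed.

Lemma odist_le1 (Y : Type) (d : Y -> Y -> R) : (forall x y, d x y <= 1) ->
  forall x y, odist d x y <= 1.
Proof. by move=> d1 [x|] [y|] //=. Qed.

(** A point of [cone] below, within [e0] of its base: [q] approximates a point of the
Kuratowski image, and has to lie in this image at height [s = 0]. *)
Definition admissible (Y : Type) (d : Y -> Y -> R) (e0 : R) (q : Y -> R) (s : R) :=
  (s = 0 -> exists y, q = d y) /\
  exists y, `|s| <= e0 /\ forall p, `|q p - d y p| <= e0.

(** A retraction onto the Kuratowski image, defined near the base of the cone. The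
height is needed because this image need not be closed among all functions. *)
Definition near_retraction (Y : Type) (d : Y -> Y -> R) (e0 : R)
    (r : (Y -> R) -> R -> option Y) :=
  [/\ 0 < e0, forall y, r (d y) 0 = Some y &
    forall e : R, 0 < e -> exists2 de : R, 0 < de & forall q s q' s',
      admissible d e0 q s -> admissible d e0 q' s' ->
      (forall p, `|q p - q' p| <= de) -> `|s - s'| <= de ->
      odist d (r q s) (r q' s') < e].

Section Cone.
Variables (Y : Type) (d : Y -> Y -> R).
Hypotheses (dm : is_metric d) (d1 : forall x y, d x y <= 1).

(** Functions with a height, those at height zero being the points of the space. *)
Definition cone : Type :=
  {qs : (Y -> R) * R | qs.2 = 0 -> exists y, qs.1 = d y}.

Definition cone_dist (z z' : cone) : R :=
  supr (fun p => Num.min 1 `|(sval z).1 p - (sval z').1 p|) +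
  Num.min 1 `|(sval z).2 - (sval z').2|.

Let min01 (x : R) : 0 <= Num.min 1 `|x| <= 1.
Proof. by rewrite le_min ler01 normr_ge0 ge_min lexx. Qed.

Let minD (x y : R) : Num.min 1 `|x + y| <= Num.min 1 `|x| + Num.min 1 `|y|.
Proof.
have := ler_normD x y; have := normr_ge0 x; have := normr_ge0 y.
by case: (leP 1 `|x|); case: (leP 1 `|y|); case: (leP 1 `|x + y|) => *; lra.
Qed.

Let min_eq0 (x : R) : Num.min 1 `|x| <= 0 -> x = 0.
Proof. by rewrite ge_min normr_le0 => /orP[|/eqP//]; lra. Qed.

Lemma cone_dist_metric : is_metric cone_dist.
Proof.
split=> [z z'|z z'|x y z].
- split=> [|->]; last first.
    rewrite /cone_dist subrr normr0 (min_r ler01) addr0.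
    apply/eqP; rewrite eq_le; apply/andP; split.
      by apply: supr_le => // t; rewrite subrr normr0 (min_r ler01).
    by apply: (supr_ge0 (M := 1)) => t; exact: min01.
  case: z z' => -[q s] /= h [[q' s'] h'] zz.
  have le0 p : Num.min 1 `|q p - q' p| <= supr (fun p => Num.min 1 `|q p - q' p|).
    by apply: (supr_ub (g := fun p => Num.min 1 `|q p - q' p|) (M := 1)) => t; case/andP: (min01 (q t - q' t)).
  have s0 : 0 <= supr (fun p => Num.min 1 `|q p - q' p|).
    by apply: (supr_ge0 (M := 1)) => t; exact: min01.
  have ss : s = s'.
    apply/subr0_eq/min_eq0; move: zz; rewrite /cone_dist /=.
    by case/andP: (min01 (s - s')); lra.
  have qq : q = q'.
    apply/funext => p; apply/subr0_eq/min_eq0; move: zz; rewrite /cone_dist /=.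
    by have := le0 p; case/andP: (min01 (s - s')); lra.
  by subst; congr exist; exact: Prop_irrelevance.
- by rewrite /cone_dist distrC; under eq_fun do rewrite distrC.
- rewrite /cone_dist; case: z y x => -[q3 s3] /= _ [[q2 s2] /= _] [[q1 s1] /= _].
  have /= := minD (s1 - s2) (s2 - s3); rewrite addrA subrK.
  suff : supr (fun p => Num.min 1 `|q1 p - q3 p|) <=
         supr (fun p => Num.min 1 `|q1 p - q2 p|) + supr (fun p => Num.min 1 `|q2 p - q3 p|) by lra.
  have h0 : 0 <= supr (fun p => Num.min 1 `|q2 p - q3 p|).
    by apply: (supr_ge0 (M := 1)) => t; exact: min01.
  apply: (supr_leD (M := 1)) => // t.
  have /= := minD (q1 t - q2 t) (q2 t - q3 t); rewrite addrA subrK.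
  have : Num.min 1 `|q2 t - q3 t| <= supr (fun p => Num.min 1 `|q2 p - q3 p|).
    by apply: (supr_ub (g := fun p => Num.min 1 `|q2 p - q3 p|) (M := 1)) => u; case/andP: (min01 (q2 u - q3 u)).
  lra.
Qed.

Definition cone_base (y : Y) : cone := exist _ (d y, 0) (fun=> ex_intro _ y erefl).

Lemma kuratowski_isometry y y' : supr (fun p => Num.min 1 `|d y p - d y' p|) = d y y'.
Proof.
have dp := metric_ge0 dm; have [_ dC dT] := dm.
apply/eqP; rewrite eq_le; apply/andP; split.
  apply: supr_le => // p; rewrite ge_min; apply/orP; right; apply/absle.
  by have := dT y y' p; have := dT y' y p; rewrite (dC y' y); lra.
have -> : d y y' = Num.min 1 `|d y y' - d y' y'|.
  by rewrite (metricxx _ dm) subr0 ger0_norm// min_r.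
by apply: (supr_ub (g := fun p => Num.min 1 `|d y p - d y' p|) (M := 1)) => u; case/andP: (min01 (d y u - d y' u)).
Qed.

Lemma cone_base_dist y y' : cone_dist (cone_base y) (cone_base y') = d y y'.
Proof.
by rewrite /cone_dist /= kuratowski_isometry subrr normr0 (min_r ler01) addr0.
Qed.

Lemma cone_distP (z z' : cone) (e : R) : 0 <= e ->
  (forall p, `|(sval z).1 p - (sval z').1 p| <= e) ->
  `|(sval z).2 - (sval z').2| <= e -> cone_dist z z' <= e + e.
Proof.
move=> e0 h1 h2; apply: lerD; last by rewrite ge_min h2 orbT.
by apply: supr_le => // p; rewrite ge_min h1 orbT.
Qed.

Lemma cone_base_closed : metric_closed cone_dist (range cone_base).
Proof.
case=> -[q s] h zA; have [s0|s0] := eqVneq s 0.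
  have [y /= qy] := h s0; exists y => //; subst q s.
  by congr exist; exact: Prop_irrelevance.
have m0 : 0 < Num.min 1 `|s| by rewrite lt_min ltr01 normr_gt0.
have [_ [y _ <-]] := zA _ m0; rewrite /cone_dist /= sub0r normrN.
have : 0 <= supr (fun p => Num.min 1 `|d y p - q p|).
  by apply: (supr_ge0 (M := 1)) => t; exact: min01.
by lra.
Qed.

End Cone.

(** The space is the base of its cone, which is closed there because the other points
have a nonzero height; hence a neighborhood of the base retracts onto it. The
retraction serves to correct an approximate extension of a map into the space: an
extension with values in functions, together with a height that vanishes only
where these values are in the image of the space, is a map into the cone. *)
Lemma uniform_ANR_retraction (Y : uniformType) : uniform_ANR R Y ->
  exists d : Y -> Y -> R, [/\ metrizes d, forall x y, d x y <= 1 &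
    exists e0 r, near_retraction d e0 r].
Proof.
move=> [[d0 md0] aY]; have md := capm_metrizes md0.
set d := capm d0 in md; have d1 : forall x y, d x y <= 1 by move=> x y; exact: capm_le1.
exists d; split=> //; have dm := md.1; have [dm0 _ _] := dm.
pose Dm := cone_dist_metric d.
have [N [r [[e e0 eN] [rc rA rid]]]] : exists (N : set (metric_space Dm)) (r : N -> metric_space Dm),
    @uniform_nbhd R (metric_space Dm) (@cone_dist _ d) (range (@cone_base _ d)) N /\
    @uniform_retraction (metric_space Dm) (range (@cone_base _ d)) N r.
  apply: (aY (metric_space Dm) (@cone_dist _ d) (@cone_base _ d)).
  - exact: metric_space_metrizes.
  - split=> [y y' /(congr1 (fun z => cone_dist z (cone_base d y')))||E].
    + by rewrite !cone_base_dist// (metricxx _ dm) => h; apply/dm0.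
    + apply/(unif_continuous_metric _ md (metric_space_metrizes Dm)) => e e0.
      by exists e => // x x' _ _; rewrite cone_base_dist.
    + move=> /(metrizesP md)[e e0 eE]; exists [set zz | cone_dist zz.1 zz.2 < e].
        by apply/(metrizesP (metric_space_metrizes Dm)); exists e.
      by move=> x y /=; rewrite cone_base_dist// => /eE.
  - by apply/(metric_closedP _ (metric_space_metrizes Dm)); exact: cone_base_closed.
have [g gr] : exists g : N -> Y, forall z, cone_base d (g z) = r z.
  have /choice[g gP] : forall z : N, exists y, cone_base d y = r z.
    by move=> z; have [y _ <-] := rA z; exists y.
  by exists g.
pose mk (z : metric_space Dm) (h : N z) : N := exist (fun z => z \in N) z (mem_set h).
pose r' q s : option Y := match pselect ((q, s).2 = 0 -> exists y, (q, s).1 = d y) with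
  | left h => match pselect (N (exist _ (q, s) h)) with
    | left hN => Some (g (mk _ hN))
    | right _ => None end
  | right _ => None end.
have adm q s : admissible d (e / 3) q s -> exists z : N, sval (\val z) = (q, s) /\ r' q s = Some (g z).
  move=> [h [y [se qe]]]; rewrite /r'; case: pselect => [h'|/(_ h)//].
  case: pselect => [hN|]; first by eexists; split; last reflexivity.
  case; apply: (eN (cone_base d y)); first by exists y.
  apply: (@le_lt_trans _ _ (e / 3 + e / 3)); last by lra.
  apply: cone_distP => /=; rewrite ?sub0r ?normrN//; first by lra.
  by move=> p; rewrite distrC.
exists (e / 3), r'; split; first by lra.
- move=> y; rewrite /r'; case: pselect => [h|]; last by case=> _; exists y.
  have yz : exist _ (d y, 0) h = cone_base d y by congr exist; exact: Prop_irrelevance.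
  case: pselect => [hN|]; last by case; rewrite yz; apply: (eN (cone_base d y)) => //; rewrite (metricxx _ Dm).
  congr Some; have := gr (mk _ hN).
  rewrite rid /=; last by rewrite yz; exists y.
  move=> /(fun E => etrans E yz).
  by move=> /(congr1 (fun z => cone_dist z (cone_base d y))); rewrite !cone_base_dist// (metricxx _ dm) => h'; apply/dm0.
- move=> e1 e10.
  have [B /(metrizesP (metric_space_metrizes Dm))[e2 e20 e2B] BP] :
      entourage ((fun xy : N * N => (r xy.1, r xy.2)) @^-1` [set zz | cone_dist zz.1 zz.2 < e1]).
    by apply: rc; apply/(metrizesP (metric_space_metrizes Dm)); exists e1.
  exists (e2 / 3); first by lra.
  move=> q s q' s' /adm[z [zE ->]] /adm[z' [zE' ->]] qq ss /=.
  rewrite -cone_base_dist// !gr; apply: (BP (z, z')); apply: e2B.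
  apply: (@le_lt_trans _ _ (e2 / 3 + e2 / 3)); last by lra.
  by apply: cone_distP; rewrite ?zE ?zE'//; lra.
Qed.

End Retractions.

(** * Extension of real functions *)

Section McShane.
Variable R : realType.

Lemma supr_dist (T : Type) (g h : T -> R) (M e : R) : 0 <= e ->
  (forall t, 0 <= g t <= M) -> (forall t, 0 <= h t <= M) ->
  (forall t, `|g t - h t| <= e) -> `|supr g - supr h| <= e.
Proof.
move=> e0 gM hM gh; apply/absle.
have : supr g <= supr h + e.
  by apply: supr_leD hM _ => // t; have /absle := gh t; lra.
have : supr h <= supr g + e.
  by apply: supr_leD gM _ => // t; have /absle := gh t; lra.
lra.
Qed.

Lemma max0_dist (x y e : R) : `|x - y| <= e -> `|Num.max 0 x - Num.max 0 y| <= e.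
Proof. by move=> /absle xy; apply/absle; case: (leP 0 x); case: (leP 0 y) => *; lra. Qed.

Variables (Z : Type) (d : Z -> Z -> R) (A : set Z).
Hypotheses (dm : is_metric d).

(** The supremum of the cones [phi a - d a z] over [A], cut off at zero. It is 1-Lipschitz,
and extends [phi] if [phi] is 1-Lipschitz on [A]. *)
Definition mcshane (phi : Z -> R) (z : Z) : R :=
  supr (fun a => if `[< A a >] then Num.max 0 (phi a - d a z) else 0).

Let kern01 (phi : Z -> R) : (forall a, A a -> phi a <= 1) ->
  forall z a, 0 <= (if `[< A a >] then Num.max 0 (phi a - d a z) else 0) <= 1.
Proof.
move=> phi1 z a; case: asboolP => Aa; last by rewrite lexx ler01.
have := phi1 a Aa; have := metric_ge0 dm a z.
by case: (leP 0 (phi a - d a z)) => *; apply/andP; split; lra.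
Qed.

Lemma mcshane01 phi z : (forall a, A a -> phi a <= 1) -> 0 <= mcshane phi z <= 1.
Proof.
move=> phi1; rewrite (supr_ge0 (M := 1))/= => [|a]; last exact: kern01.
by apply: supr_le => // a; case/andP: (kern01 phi1 z a).
Qed.

Lemma mcshane_lip phi z z' : (forall a, A a -> phi a <= 1) ->
  `|mcshane phi z - mcshane phi z'| <= d z z'.
Proof.
move=> phi1; have [_ dC dT] := dm.
apply: (supr_dist (M := 1)); [exact: metric_ge0|exact: kern01|exact: kern01|].
move=> a; case: asboolP => _; last by rewrite subrr normr0 metric_ge0.
apply: max0_dist; apply/absle.
by have := dT a z z'; have := dT a z' z; rewrite (dC z' z); lra.
Qed.

Lemma mcshane_ge phi z a : (forall a, A a -> phi a <= 1) -> A a ->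
  phi a - d a z <= mcshane phi z.
Proof.
move=> phi1 Aa.
apply: (@le_trans _ _ (if `[< A a >] then Num.max 0 (phi a - d a z) else 0)).
  by rewrite asboolT// le_max lexx orbT.
apply: (supr_ub (g := fun a => if `[< A a >] then Num.max 0 (phi a - d a z) else 0) (M := 1)).
by move=> b; case/andP: (kern01 phi1 z b).
Qed.

Lemma mcshane_id phi a : (forall a, A a -> 0 <= phi a <= 1) ->
  (forall a a', A a -> A a' -> `|phi a - phi a'| <= d a a') ->
  A a -> mcshane phi a = phi a.
Proof.
move=> phi01 phiL Aa; have phi1 b : A b -> phi b <= 1 by move=> /phi01/andP[].
apply/eqP; rewrite eq_le; apply/andP; split; last first.
  by have := mcshane_ge a phi1 Aa; rewrite (metricxx _ dm) subr0.
have /andP[p0 _] := phi01 a Aa.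
apply: supr_le => // b; case: asboolP => // Ab.
have := phiL _ _ Ab Aa; move=> /absle.
by case: (leP 0 (phi b - d b a)) => *; lra.
Qed.

(** The distance to [A], capped by 1. *)
Definition set_dist (z : Z) : R := 1 - mcshane (fun=> 1) z.

Lemma set_dist01 z : 0 <= set_dist z <= 1.
Proof.
have := @mcshane01 (fun=> 1) z (fun _ _ => lexx 1).
by rewrite /set_dist => /andP[? ?]; apply/andP; split; lra.
Qed.

Lemma set_dist_lip z z' : `|set_dist z - set_dist z'| <= d z z'.
Proof.
rewrite /set_dist opprB addrC addrA subrK distrC.
exact: mcshane_lip (fun _ _ => lexx 1).
Qed.

Lemma set_dist_le z a : A a -> set_dist z <= d a z.
Proof. by move=> Aa; have := mcshane_ge z (fun _ _ => lexx 1) Aa; rewrite /set_dist; lra. Qed.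

Lemma set_dist0 a : A a -> set_dist a = 0.
Proof.
move=> Aa; have := set_dist_le a Aa; rewrite (metricxx _ dm).
by have /andP[? ?] := set_dist01 a; lra.
Qed.

Lemma set_dist_near z (e : R) : set_dist z < e -> e <= 1 -> exists2 a, A a & d a z < e.
Proof.
move=> se e1; apply: contrapT => /forall2NP nA.
suff : mcshane (fun=> 1) z <= 1 - e by move: se; rewrite /set_dist; lra.
apply: supr_le; first by lra.
move=> a; case: asboolP => Aa; last by lra.
have [//|/negP] := nA a; rewrite -leNgt => ea.
by case: (leP 0 (1 - d a z)) => *; lra.
Qed.

Lemma set_dist_eq0 z : metric_closed d A -> set_dist z = 0 -> A z.
Proof.
move=> cA z0; apply: cA => e e0.
have [||a Aa az] := @set_dist_near z (Num.min 1 e).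
- by rewrite z0 lt_min ltr01.
- by rewrite ge_min lexx.
- by exists a => //; move: az; rewrite lt_min => /andP[].
Qed.

End McShane.

Section Regularization.
Variables (R : realType) (Z : Type) (d : Z -> Z -> R) (A : set Z).
Hypotheses (dm : is_metric d).
Variables (K : Type) (dK : K -> K -> R).
Hypotheses (dKm : is_metric dK) (dK1 : forall t t', dK t t' <= 1).
Variables (P : Type) (phi : Z -> K -> P -> R).
Hypothesis phi01 : forall a t p, A a -> 0 <= phi a t p <= 1.
Hypothesis phi_lip : forall a a' t p, A a -> A a' -> `|phi a t p - phi a' t p| <= d a a'.
Hypothesis phi_ucont : forall a, A a -> forall e : R, 0 < e ->
  exists2 de : R, 0 < de & forall t t' p, dK t t' < de -> `|phi a t p - phi a t' p| <= e.

Implicit Types (l e x : R).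

Let s := set_dist d A.

Let kern (l : R) z t p (b : Z * K) : R :=
  if `[< A b.1 >] then Num.max 0 (phi b.1 b.2 p - d b.1 z - l * dK t b.2) else 0.

(** The joint extension that is Lipschitz with constant [l] in the second variable. *)
Let Pl (l : R) z t p : R := supr (kern l z t p).

Let G z t p : R := mcshane d A (fun a => phi a t p) z.

Let kern01 l z t p b : 0 <= l -> 0 <= kern l z t p b <= 1.
Proof.
move=> l0; rewrite /kern; case: asboolP => Ab; last by rewrite lexx ler01.
have /andP[_ h1] := phi01 b.2 p Ab; have h2 := metric_ge0 dm b.1 z.
have h3 := mulr_ge0 l0 (metric_ge0 dKm t b.2).
by case: (leP 0 (phi b.1 b.2 p - d b.1 z - l * dK t b.2)) => *; apply/andP; split; lra.
Qed.

Let Pl01 l z t p : 0 <= l -> 0 <= Pl l z t p <= 1.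
Proof.
move=> l0; rewrite (supr_ge0 (M := 1))/= => [|a]; last exact: kern01.
by apply: supr_le => // a; case/andP: (kern01 z t p a l0).
Qed.

Let Pl_ge l z t p b : 0 <= l -> A b.1 ->
  phi b.1 b.2 p - d b.1 z - l * dK t b.2 <= Pl l z t p.
Proof.
move=> l0 Ab; apply: (@le_trans _ _ (kern l z t p b)).
  by rewrite /kern asboolT// le_max lexx orbT.
by apply: (supr_ub (M := 1)) => c; case/andP: (kern01 z t p c l0).
Qed.

Let Pl_lipz l z z' t p : 0 <= l -> `|Pl l z t p - Pl l z' t p| <= d z z'.
Proof.
move=> l0; have [_ dC dT] := dm.
apply: (supr_dist (M := 1)); [exact: metric_ge0|by move=> b; exact: kern01..|].
move=> b; rewrite /kern; case: asboolP => _; last by rewrite subrr normr0 metric_ge0.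
apply: max0_dist; apply/absle.
by have := dT b.1 z z'; have := dT b.1 z' z; rewrite (dC z' z); lra.
Qed.

Let Pl_lipt l z t t' p : 0 <= l -> `|Pl l z t p - Pl l z t' p| <= l * dK t t'.
Proof.
move=> l0; have [_ dC dT] := dKm; have h0 := mulr_ge0 l0 (metric_ge0 dKm t t').
apply: (supr_dist (M := 1)) => //; [by move=> b; exact: kern01..|].
move=> b; rewrite /kern; case: asboolP => _; last by rewrite subrr normr0.
apply: max0_dist; apply/absle.
have := ler_wpM2l l0 (dT t t' b.2); have := ler_wpM2l l0 (dT t' t b.2).
by rewrite (dC t' t) !mulrDr; lra.
Qed.

Let G01 z t p : 0 <= G z t p <= 1.
Proof. by apply: mcshane01 => // a /(phi01 t p)/andP[]. Qed.

Let G_lip z z' t p : `|G z t p - G z' t p| <= d z z'.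
Proof. by apply: mcshane_lip => // a /(phi01 t p)/andP[]. Qed.

Let G_id a t p : A a -> G a t p = phi a t p.
Proof.
move=> Aa; apply: (@mcshane_id _ _ _ _ dm (fun a => phi a t p)) => // b Ab; first exact: phi01.
by move=> Ab'; exact: phi_lip.
Qed.

Let G_le_Pl l z t p : 0 <= l -> G z t p <= Pl l z t p.
Proof.
move=> l0; apply: supr_le => [|a]; first by case/andP: (Pl01 z t p l0).
case: asboolP => Aa; last by case/andP: (Pl01 z t p l0).
have := @Pl_ge l z t p (a, t) l0 Aa; rewrite /= (metricxx _ dKm).
by have /andP[? _] := Pl01 z t p l0; case: (leP 0 (phi a t p - d a z)) => *; lra.
Qed.

Let Pl_step l eta z t p : 0 <= l -> 0 <= eta -> Pl l z t p <= Pl (l + eta) z t p + eta.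
Proof.
move=> l0 e0; have le0 := addr_ge0 l0 e0.
apply: (supr_leD (M := 1)) => // b; first exact: kern01.
rewrite /kern; case: asboolP => Ab; last by lra.
have : eta * dK t b.2 <= eta by rewrite ler_piMr.
have := mulr_ge0 e0 (metric_ge0 dKm t b.2); rewrite mulrDl.
case: (leP 0 (phi b.1 b.2 p - d b.1 z - l * dK t b.2));
case: (leP 0 (phi b.1 b.2 p - d b.1 z - (l * dK t b.2 + eta * dK t b.2))) => *; lra.
Qed.

Let Pl_small a (e : R) : A a -> 0 < e -> exists2 L : R, 0 <= L &
  forall l t p, L <= l -> Pl l a t p <= phi a t p + e.
Proof.
move=> Aa e0; have [de de0 deP] := phi_ucont Aa e0.
exists de^-1; first by rewrite invr_ge0 ltW.
move=> l t p Ll; have l0 : 0 <= l by apply: le_trans Ll; rewrite invr_ge0 ltW.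
have /andP[p0 p1] := phi01 t p Aa.
apply: supr_le; first by lra.
move=> [b u]; rewrite /kern /=; case: asboolP => Ab; last by lra.
have /andP[q0 q1] := phi01 u p Ab.
have := phi_lip u p Ab Aa; move=> /absle[_ h1].
have [lt|ge] := ltrP (dK t u) de.
  have := deP t u p lt => /absle[h2 _]; have := mulr_ge0 l0 (metric_ge0 dKm t u).
  by case: (leP 0 (phi b u p - d b a - l * dK t u)) => *; lra.
have : 1 <= l * dK t u.
  apply: (@le_trans _ _ (de^-1 * de)); first by rewrite mulVf// gt_eqF.
  by apply: ler_pM => //; [rewrite invr_ge0|]; exact: ltW.
have := metric_ge0 dm b a.
by case: (leP 0 (phi b u p - d b a - l * dK t u)) => *; lra.
Qed.

(** The error of the slope [l]; it tends to zero on [A] as [l] grows. *)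
Let er (l : R) z : R := supr (fun tp : K * P => Pl l z tp.1 tp.2 - G z tp.1 tp.2).

Let er01 l z tp : 0 <= l -> 0 <= Pl l z tp.1 tp.2 - G z tp.1 tp.2 <= 1.
Proof.
move=> l0; have := G_le_Pl z tp.1 tp.2 l0.
have /andP[? ?] := Pl01 z tp.1 tp.2 l0; have /andP[? ?] := G01 z tp.1 tp.2.
by move=> ?; apply/andP; split; lra.
Qed.

Let er_ub l z t p : 0 <= l -> Pl l z t p <= G z t p + er l z.
Proof.
move=> l0; suff : Pl l z t p - G z t p <= er l z by lra.
apply: (@supr_ub _ _ (fun tp => Pl l z tp.1 tp.2 - G z tp.1 tp.2) 1 (t, p)).
by move=> tp; case/andP: (er01 z tp l0).
Qed.

Let er_ge0 l z : 0 <= l -> 0 <= er l z.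
Proof. by move=> l0; apply: (supr_ge0 (M := 1)) => tp; exact: er01. Qed.

Let er_lip l z z' : 0 <= l -> `|er l z - er l z'| <= d z z' + d z z'.
Proof.
move=> l0; have h0 := metric_ge0 dm z z'.
apply: (supr_dist (M := 1)); [lra|by move=> tp; exact: er01..|].
move=> tp; have /absle := Pl_lipz z z' tp.1 tp.2 l0.
by have /absle := G_lip z z' tp.1 tp.2; move=> *; apply/absle; lra.
Qed.

Let er_small z a (e1 e : R) : A a -> d a z <= e1 -> 0 < e ->
  exists2 L : R, 0 <= L & forall l, L <= l -> er l z <= e1 + e1 + e.
Proof.
move=> Aa az e0; have [L L0 LP] := Pl_small Aa e0; exists L => // l Ll.
have l0 := le_trans L0 Ll; have h0 := metric_ge0 dm a z.
apply: supr_le => [|[t p] /=]; first by lra.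
have /absle := Pl_lipz a z t p l0; have /absle := G_lip a z t p.
by have := LP l t p Ll; rewrite G_id//; lra.
Qed.

(** There is no penalty while the error is at least [4 * s z]. For large slopes the error is
at most [3 * s z], because some point of [A] is at distance at most [5 / 4 * s z], and the
penalty at least [5 * s z]. *)
Let pen (l : R) z : R := 5 * Num.max 0 (4 * s z - er l z).

Let pen_ge0 l z : 0 <= pen l z.
Proof. by rewrite /pen mulr_ge0// le_max lexx. Qed.

Let pen_lip l z z' : 0 <= l -> `|pen l z - pen l z'| <= 30 * d z z'.
Proof.
move=> l0; rewrite /pen -mulrBr normrM (ger0_norm (ler0n _ 5)).
have -> : 30 * d z z' = 5 * (6 * d z z') by lra.
rewrite ler_wpM2l//; apply: max0_dist; apply/absle.
have /absle := er_lip z z' l0; have /absle := set_dist_lip A dm z z'.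
rewrite -/s; lra.
Qed.

(** Outside [A], the extension [G] need not be continuous in [t], because the functions
[phi a] have no common modulus of continuity; and [Pl l], though Lipschitz in [t], may exceed
[phi] on [A]. The infimum over all slopes is an extension of [phi], since there is no penalty
on [A]. Outside [A] the penalty discards the large slopes, so that the infimum is Lipschitz in
[t]. The penalty is Lipschitz in [z], and so is the infimum. *)
Definition regular_extension z t p : R :=
  Num.min (Pl 0 z t p) (infr (fun l : R => Pl `|l| z t p + pen `|l| z)).

Let H := regular_extension.

Let H_le l z t p : 0 <= l -> H z t p <= Pl l z t p + pen l z.
Proof.
move=> l0; rewrite /H /regular_extension ge_min; apply/orP; right.
have := @infr_lb R R (fun l : R => Pl `|l| z t p + pen `|l| z) 0 l.
rewrite ger0_norm//; apply => m; rewrite addr_ge0//.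
by case/andP: (Pl01 z t p (normr_ge0 m)).
Qed.

Let H_ge z t p x : x <= Pl 0 z t p ->
  (forall l, 0 <= l -> x <= Pl l z t p + pen l z) -> x <= H z t p.
Proof. by move=> x0 xl; rewrite /H /regular_extension le_min x0 (infr_ge 0)// => l; exact: xl. Qed.

Let H_le0 z t p : H z t p <= Pl 0 z t p.
Proof. by rewrite /H /regular_extension ge_min lexx. Qed.

Lemma regular_extension01 z t p : 0 <= regular_extension z t p <= 1.
Proof.
apply/andP; split.
  apply: H_ge => [|l l0]; first by case/andP: (Pl01 z t p (lexx 0)).
  by rewrite addr_ge0//; case/andP: (Pl01 z t p l0).
by apply: le_trans (H_le0 z t p) _; case/andP: (Pl01 z t p (lexx 0)).
Qed.

Lemma regular_extension_id a t p : A a -> regular_extension a t p = phi a t p.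
Proof.
move=> Aa; have sa : s a = 0 by apply: set_dist0.
apply/eqP; rewrite eq_le; apply/andP; split; last first.
  rewrite -G_id//; apply: H_ge => [|l l0]; first exact: G_le_Pl.
  by have := G_le_Pl a t p l0; have := pen_ge0 l a; lra.
apply/ler_addgt0Pr => e e0; have [L L0 LP] := Pl_small Aa e0.
apply: le_trans (H_le a t p L0) _; rewrite /pen sa mulr0 sub0r max_l; last first.
  by rewrite oppr_le0 er_ge0.
by rewrite mulr0 addr0 LP.
Qed.

Lemma regular_extension_lip z z' t p :
  `|regular_extension z t p - regular_extension z' t p| <= 31 * d z z'.
Proof.
have half u u' : H u t p <= H u' t p + 31 * d u u'.
  have d0 := metric_ge0 dm u u'; rewrite -lerBlDr; apply: H_ge => [|l l0].
    by have := H_le0 u t p; have /absle := Pl_lipz u u' t p (lexx 0); lra.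
  have := H_le u t p l0; have /absle := Pl_lipz u u' t p l0.
  by have /absle := pen_lip u u' l0; lra.
apply/absle; have := half z z'; have := half z' z; have [_ dC _] := dm.
by rewrite (dC z' z) /H; lra.
Qed.

(** Away from [A], the infimum over all slopes is that over bounded ones.
Indeed, if [m] is the last multiple of [s z] at which the error is at least
[4 * s z], then there is no penalty at [m], while for large slopes the penalty exceeds
the error at [m], which is less than [5 * s z]. *)
Let bounded_slopes z : 0 < s z -> s z < 1 -> exists2 L : R, 0 <= L &
  forall l t p, L <= l -> exists2 m, 0 <= m <= L & Num.min (Pl 0 z t p) (Pl m z t p + pen m z) <= Pl l z t p + pen l z.
Proof.
move=> s0 s1.
have [a Aa az] : exists2 a, A a & d a z <= 5 / 4 * s z.
  have [||a Aa az] := @set_dist_near _ _ d A z (Num.min 1 (5 / 4 * s z)).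
  - by rewrite lt_min -/s s1/=; lra.
  - by rewrite ge_min lexx.
  - by exists a => //; move: az; rewrite lt_min => /andP[_ /ltW].
have e0 : 0 < s z / 2 by lra.
have [L L0 LP] := er_small Aa az e0.
have ex : exists n : nat, er (n%:R * s z) z < 4 * s z.
  have n0 : 0 <= L / s z by rewrite divr_ge0// ltW.
  have [n nP] : exists n : nat, L / s z <= n%:R.
    by exists (Num.bound (L / s z)); rewrite ltW// archi_boundP.
  exists n; apply: le_lt_trans (LP _ _) _; last by lra.
  by rewrite -ler_pdivrMr.
have pen_large l : L <= l -> 5 * s z <= pen l z.
  move=> /LP h; rewrite /pen; suff : s z <= Num.max 0 (4 * s z - er l z) by lra.
  by rewrite le_max; apply/orP; right; lra.
case: (ex_minnP ex) => -[|n] nP nmin.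
  exists L => // l t p Ll; exists 0; first by rewrite lexx.
  rewrite ge_min; apply/orP; left; rewrite mul0r in nP.
  have := er_ub z t p (lexx 0); have := G_le_Pl z t p (le_trans L0 Ll).
  have := pen_large l Ll; lra.
have nn0 : 0 <= n%:R * s z by rewrite mulr_ge0// ltW.
exists (Num.max L (n%:R * s z)); first by rewrite le_max L0.
move=> l t p; rewrite ge_max => /andP[Ll nl]; exists (n%:R * s z).
  by rewrite nn0 le_max lexx orbT.
rewrite ge_min; apply/orP; right.
have -> : pen (n%:R * s z) z = 0.
  have : 4 * s z <= er (n%:R * s z) z.
    by rewrite leNgt; apply/negP => /nmin; rewrite ltnn.
  by move=> h; rewrite /pen max_l ?mulr0//; lra.
have S0 : 0 <= n%:R * s z + s z by lra.
have := Pl_step z t p nn0 (ltW s0); have := er_ub z t p S0.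
move: nP; rewrite -natr1 mulrDl mul1r => nP.
have := G_le_Pl z t p (le_trans L0 Ll); have := pen_large l Ll; lra.
Qed.

Lemma regular_extension_ucont z : metric_closed d A -> s z < 1 ->
  forall e : R, 0 < e -> exists2 de : R, 0 < de &
  forall t t' p, dK t t' < de -> `|regular_extension z t p - regular_extension z t' p| <= e.
Proof.
move=> cA s1 e e0; have /andP[s0 _] := set_dist01 A dm z; rewrite -/s in s0.
move: s0; rewrite le_eqVlt => /orP[/eqP s0|s0].
  have Az : A z by exact: set_dist_eq0 cA (esym s0).
  have [de de0 deP] := phi_ucont Az e0; exists de => // t t' p tt.
  by rewrite !regular_extension_id//; exact: deP.
have [L L0 LP] := bounded_slopes s0 s1.
have half t t' p : H z t p <= H z t' p + L * dK t t'.
  have d0 := mulr_ge0 L0 (metric_ge0 dKm t t').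
  have small l : 0 <= l <= L -> H z t p - L * dK t t' <= Pl l z t' p + pen l z.
    move=> /andP[l0 lL]; have := H_le z t p l0; have /absle := Pl_lipt z t t' p l0.
    by have := ler_wpM2r (metric_ge0 dKm t t') lL; lra.
  have zero : H z t p - L * dK t t' <= Pl 0 z t' p.
    by have := H_le0 z t p; have /absle := Pl_lipt z t t' p (lexx 0); lra.
  rewrite -lerBlDr; apply: H_ge => // l l0; have [lL|Ll] := lerP l L.
    by apply: small; rewrite l0.
  have [m mL] := LP l t' p (ltW Ll).
  by apply: le_trans; rewrite le_min zero small.
exists (e / (L + 1)); first by rewrite divr_gt0//; lra.
move=> t t' p; rewrite ltr_pdivlMr; last by lra.
have := half t t' p; have := half t' t p; have [_ dC _] := dKm; rewrite (dC t' t) /H.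
have d0 := metric_ge0 dKm t t'; rewrite mulrDr mulr1 (mulrC _ L) => *; apply/absle; lra.
Qed.

End Regularization.

(** * Simplices *)

Section FiniteUniform.
Variable R : realType.

Lemma finite_uniform_pos (T : eqType) (A : set T) (Q : T -> R -> Prop) :
  finite_set A -> (forall x (e e' : R), e' <= e -> Q x e -> Q x e') ->
  (forall x, A x -> exists2 e : R, 0 < e & Q x e) ->
  exists2 e : R, 0 < e & forall x, A x -> Q x e.
Proof.
move=> /finite_seqP[l ->] Qm; elim: l => [|x l IH] Ql; first by exists 1.
have [|e e0 eP] := IH; first by move=> y /= yl; apply: Ql; rewrite /= inE yl orbT.
have [|e' e'0 e'P] := Ql x; first by rewrite /= inE eqxx.
exists (Num.min e e') => [|y]; first by rewrite lt_min e0.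
rewrite /= inE => /orP[/eqP->|/eP]; first by apply: Qm e'P; rewrite ge_min lexx orbT.
by apply: Qm; rewrite ge_min lexx.
Qed.

Lemma finType_uniform_pos (T : finType) (Q : T -> R -> Prop) :
  (forall x (e e' : R), e' <= e -> Q x e -> Q x e') ->
  (forall x, exists2 e : R, 0 < e & Q x e) ->
  exists2 e : R, 0 < e & forall x, Q x e.
Proof.
move=> Qm Qp; have [||e e0 eP] := @finite_uniform_pos T setT Q _ Qm.
- exact: finite_finset.
- by move=> x _; exact: Qp.
- by exists e => // x; exact: eP.
Qed.

End FiniteUniform.

Section SimplexMetric.
Variable R : realType.

Definition coord n (t : simplex R n) (i : 'I_n.+1) : R := (\val t : 'rV[R]_n.+1) 0 i.

Lemma coord_ge0 n (t : simplex R n) i : 0 <= coord t i.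
Proof. by have /set_mem[+ _] := valP t; apply. Qed.

Lemma coord_sum n (t : simplex R n) : \sum_i coord t i = 1.
Proof. by have /set_mem[_ +] := valP t. Qed.

Lemma coord_le1 n (t : simplex R n) i : coord t i <= 1.
Proof.
rewrite -(coord_sum t) (bigD1 i)//= lerDl; apply: sumr_ge0 => j _; exact: coord_ge0.
Qed.

Lemma simplex_ext n (t t' : simplex R n) : (forall i, coord t i = coord t' i) -> t = t'.
Proof. by move=> tt; apply: val_inj; apply/rowP => i; exact: tt. Qed.

Lemma make_simplex n (f : 'I_n.+1 -> R) : (forall i, 0 <= f i) -> \sum_i f i = 1 ->
  exists t : simplex R n, forall i, coord t i = f i.
Proof.
move=> f0 f1; have h : \row_i f i \in @simplex_set R n.
  by apply/mem_set; split=> [j|]; [rewrite mxE|under eq_bigr do rewrite mxE].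
by exists (exist (fun t => t \in @simplex_set R n) _ h) => i; rewrite /coord /= mxE.
Qed.

Definition sdist n (t t' : simplex R n) : R := supr (fun i => `|coord t i - coord t' i|).

Let coord_dist01 n (t t' : simplex R n) i : 0 <= `|coord t i - coord t' i| <= 1.
Proof.
rewrite normr_ge0; apply/absle.
have := coord_ge0 t i; have := coord_ge0 t' i; have := coord_le1 t i; have := coord_le1 t' i; lra.
Qed.

Lemma coord_lip n (t t' : simplex R n) i : `|coord t i - coord t' i| <= sdist t t'.
Proof.
by apply: (@supr_ub _ _ (fun i => `|coord t i - coord t' i|) 1) => j; case/andP: (coord_dist01 t t' j).
Qed.

Lemma sdist_le n (t t' : simplex R n) (e : R) :
  (forall i, `|coord t i - coord t' i| <= e) -> sdist t t' <= e.
Proof. by move=> h; apply: supr_le => //; apply: le_trans (h ord0). Qed.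

Lemma sdist_le1 n (t t' : simplex R n) : sdist t t' <= 1.
Proof. by apply: sdist_le => i; case/andP: (coord_dist01 t t' i). Qed.

Lemma sdist_metric n : is_metric (@sdist n).
Proof.
split=> [t t'|t t'|x y z].
- split=> [tt|->]; last first.
    apply/eqP; rewrite eq_le (le_trans _ (coord_lip t' t' ord0))// andbT.
    by apply: sdist_le => i; rewrite subrr normr0.
  apply: simplex_ext => i; apply/subr0_eq/eqP; rewrite -normr_le0.
  by have := coord_lip t t' i; rewrite tt.
- by rewrite /sdist; congr supr; apply/funext => i; rewrite distrC.
- apply: sdist_le => i; apply: le_trans (ler_distD (coord y i) _ _) _.
  by apply: lerD; exact: coord_lip.
Qed.

Lemma simplex_metrizes n : metrizes (@sdist n).
Proof.
apply: metrizes_intro; first exact: sdist_metric.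
move=> E; split.
  move=> [B [Q Qent QB] BE].
  have [|ij|e e0 eP] := @finType_uniform_pos R ('I_1 * 'I_n.+1)%type
      (fun ij e => forall x y : R, `|x - y| < e -> Q ij.1 ij.2 (x, y)).
  - by move=> ij e e' ee h x y xy; apply: h; exact: lt_le_trans ee.
  - have := Qent ij.1 ij.2; rewrite -entourage_ballE => -[e /= e0 eQ].
    by exists e => // x y xy; exact: eQ.
  exists e => // t t' tt; apply: BE; apply: QB => i j.
  apply: (eP (i, j)); rewrite (ord1 i); exact: le_lt_trans (coord_lip t t' j) tt.
move=> [e e0 eE].
exists [set MN | forall i j, `|(MN.1 : 'rV[R]_n.+1) i j - (MN.2 : 'rV[R]_n.+1) i j| < e / 2].
  exists (fun i j => [set xy | `|xy.1 - xy.2| < e / 2]) => // i j.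
  by rewrite -entourage_ballE; exists (e / 2); rewrite //= divr_gt0.
move=> [t t'] /= tt; apply: eE; apply: (@le_lt_trans _ _ (e / 2)); last by lra.
by apply: sdist_le => i; exact/ltW/tt.
Qed.

Lemma coord_coface n (k : 'I_n.+2) (t : simplex R n) i : coord (coface k t) (lift k i) = coord t i.
Proof. by rewrite /coord /= mxE liftK. Qed.

Lemma coord_coface_eq0 n (k : 'I_n.+2) (t : simplex R n) : coord (coface k t) k = 0.
Proof. by rewrite /coord /= mxE unlift_none. Qed.

Lemma coface_inj n (k : 'I_n.+2) : injective (@coface R n k).
Proof. by move=> t t' tt; apply: simplex_ext => i; rewrite -!(coord_coface k) tt. Qed.

Lemma sdist_coface n (k : 'I_n.+2) (t t' : simplex R n) : sdist (coface k t) (coface k t') <= sdist t t'.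
Proof.
apply: sdist_le => i; case: (unliftP k i) => [j|] ->.
  by rewrite !coord_coface coord_lip.
by rewrite !coord_coface_eq0 subrr normr0 (metric_ge0 (sdist_metric n)).
Qed.

Lemma on_face n (k : 'I_n.+2) (t : simplex R n.+1) : coord t k = 0 -> exists t', t = coface k t'.
Proof.
move=> tk; have [||t' t'P] := @make_simplex n (fun i => coord t (lift k i)).
- by move=> i; exact: coord_ge0.
- by rewrite -(coord_sum t) [RHS](bigD1_ord k)//= tk add0r.
exists t'; apply: simplex_ext => i; case: (unliftP k i) => [j|] ->.
  by rewrite coord_coface t'P.
by rewrite coord_coface_eq0.
Qed.

(** The projection from the [k]-th vertex onto the opposite face, with an arbitrary value
at this vertex. *)
Lemma face_projection_exists n (k : 'I_n.+2) (t : simplex R n.+1) :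
  exists t' : simplex R n, coord t k < 1 -> forall i, coord t' i = coord t (lift k i) / (1 - coord t k).
Proof.
have [tk|tk] := ltP (coord t k) 1; last first.
  have [||t' _] := @make_simplex n (fun i => (i == ord0)%:R); last by exists t'; lra.
  - by move=> i; rewrite ler0n.
  - by rewrite (bigD1 ord0)//= big1 ?addr0// => i /negPf->.
have h : 0 < 1 - coord t k by lra.
have [||t' t'P] := @make_simplex n (fun i => coord t (lift k i) / (1 - coord t k)).
- by move=> i; rewrite divr_ge0 ?coord_ge0// ltW.
- rewrite -mulr_suml (_ : \sum_i _ = 1 - coord t k) ?divff ?gt_eqF//.
  by rewrite -(coord_sum t) (bigD1_ord k)//= addrAC subrr add0r.
by exists t'.
Qed.

Definition face_projection n (k : 'I_n.+2) (t : simplex R n.+1) : simplex R n :=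
  projT1 (cid (face_projection_exists k t)).

Lemma coord_face_projection n (k : 'I_n.+2) (t : simplex R n.+1) i : coord t k < 1 ->
  coord (face_projection k t) i = coord t (lift k i) / (1 - coord t k).
Proof. by move=> tk; rewrite /face_projection; case: cid => t' /= ->. Qed.

Lemma face_projectionK n (k : 'I_n.+2) (t : simplex R n) : face_projection k (coface k t) = t.
Proof.
apply: simplex_ext => i.
by rewrite coord_face_projection coord_coface_eq0// subr0 divr1 coord_coface.
Qed.

Lemma face_projection_eq0 n (j k : 'I_n.+2) (t : simplex R n.+1) : coord t k < 1 ->
  coord t j = 0 -> coord (coface k (face_projection k t)) j = 0.
Proof.
move=> tk; case: (unliftP k j) => [i|] -> tj; last by rewrite coord_coface_eq0.
by rewrite coord_coface coord_face_projection// tj mul0r.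
Qed.

Lemma face_projection_lip n (k : 'I_n.+2) (t t' : simplex R n.+1) :
  coord t k <= 1 / 2 -> coord t' k <= 1 / 2 ->
  sdist (face_projection k t) (face_projection k t') <= 8 * sdist t t'.
Proof.
move=> tk tk'; apply: sdist_le => i; rewrite !coord_face_projection; try lra.
have := coord_lip t t' (lift k i); have := coord_lip t t' k.
have := coord_ge0 t' (lift k i); have := coord_le1 t' (lift k i).
have := coord_ge0 t k; have := coord_ge0 t' k.
move: (coord t k) (coord t' k) (coord t (lift k i)) (coord t' (lift k i)) (sdist t t') tk tk'.
move=> a b x y e a2 b2 b0 a0 y1 y0 /absle ab /absle xy.
have a3 : 0 < 1 - a by lra. have b3 : 0 < 1 - b by lra.
have e0 : 0 <= e by lra.
have -> : x / (1 - a) - y / (1 - b) = ((x - y) * (1 - b) + y * (a - b)) / ((1 - a) * (1 - b)).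
  by field; lra.
have h : 1 / 4 <= (1 - a) * (1 - b) by nra.
rewrite normrM normfV (ger0_norm (x := (1 - a) * (1 - b))); last by lra.
rewrite ler_pdivrMr; last by lra.
apply: (@le_trans _ _ (2 * e)); last by nra.
have p1 : (x - y) * (1 - b) <= e * (1 - b) by rewrite ler_wpM2r//; lra.
have p2 : - e * (1 - b) <= (x - y) * (1 - b) by rewrite ler_wpM2r//; lra.
have p3 : y * (a - b) <= y * e by rewrite ler_wpM2l//; lra.
have p4 : y * (- e) <= y * (a - b) by rewrite ler_wpM2l//; lra.
have p5 : 0 <= e * b by rewrite mulr_ge0.
have p6 : y * e <= e by rewrite ler_piMl.
by apply/absle; move: p1 p2 p3 p4; rewrite !mulrDr !mulrN !mulr1 !mulNr; lra.
Qed.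

End SimplexMetric.

(** * Faces of chains *)

Section ChainEquality.
Variables (C : category) (n : nat).

(** Chains are compared together with an arbitrary datum [x] that depends on their vertices,
such as a point over the first vertex: equality of pairs needs no transport of this datum. *)
Lemma chain_pair_eq (F : ('I_n.+1 -> C) -> Type) (v : 'I_n.+1 -> C)
    (e e' : forall k l : 'I_n.+1, (k <= l)%N -> hom (v k) (v l)) p q r p' q' r' (x : F v) :
  (forall k l kl, e k l kl = e' k l kl) ->
  existT (fun c : chain C n => F (vertex c)) (@Chain C n (@Nerve C n v e p q) r) x =
  existT (fun c : chain C n => F (vertex c)) (@Chain C n (@Nerve C n v e' p' q') r') x.
Proof.
move=> ee; have E : e = e'.
  by apply: functional_extensionality_dep => k; apply: functional_extensionality_dep => l;
     apply: functional_extensionality_dep => kl.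
subst e'; case: _ / (Prop_irrelevance p p') r'; case: _ / (Prop_irrelevance q q') => r'.
by case: _ / (Prop_irrelevance r r').
Qed.

End ChainEquality.

Section Restriction.
Variables (C : category) (n m : nat).
Implicit Types (al : 'I_m.+1 -> 'I_n.+1).

Definition strictly_mono al := forall i j : 'I_m.+1, (i < j)%N -> (al i < al j)%N.

Lemma strictly_mono_le al : strictly_mono al -> forall i j : 'I_m.+1, (i <= j)%N -> (al i <= al j)%N.
Proof.
move=> h i j; rewrite leq_eqVlt => /orP[/eqP/val_inj->//|/h]; exact: ltnW.
Qed.

Lemma strictly_mono_inj al : strictly_mono al -> injective al.
Proof.
move=> h i j ij; apply: val_inj; case: (ltngtP i j) => // /h; by rewrite ij ltnn.
Qed.

Program Definition nerve_restriction al (h : strictly_mono al) (s : nerve C n) : nerve C m :=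
  @Nerve C m (fun i => vertex s (al i))
    (fun i j ij => edge s (strictly_mono_le h ij)) _ _.
Next Obligation. by move=> al h s i ii; exact: edge_id. Qed.
Next Obligation. by move=> al h s i j l ij jl il; exact: edge_comp. Qed.

End Restriction.

Section ChainTheory.
Variable C : finite_category.

Lemma nerve_restriction_nondegenerate n m (al : 'I_m.+1 -> 'I_n.+1) (h : strictly_mono al) (s : chain C n) :
  nondegenerate (nerve_restriction h s).
Proof. by move=> i j ij e; apply: edge_not_identity; apply: h; rewrite e. Qed.

Definition restriction n m (al : 'I_m.+1 -> 'I_n.+1) (h : strictly_mono al) (s : chain C n) : chain C m :=
  Chain (@nerve_restriction_nondegenerate n m al h s).

Lemma restriction_eq n m (F : ('I_m.+1 -> C) -> Type) (s : chain C n)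
    (al al' : 'I_m.+1 -> 'I_n.+1) h h' (x : forall al : 'I_m.+1 -> 'I_n.+1, F (fun i => vertex s (al i))) :
  (forall i, al i = al' i) ->
  existT (fun c : chain C m => F (vertex c)) (@restriction n m al h s) (x al) =
  existT (fun c : chain C m => F (vertex c)) (@restriction n m al' h' s) (x al').
Proof.
move=> /funext E; subst al'; apply: chain_pair_eq => k l kl.
by rewrite (bool_irrelevance (strictly_mono_le h kl) (strictly_mono_le h' kl)).
Qed.

Lemma strictly_mono_lift n (k : 'I_n.+2) : @strictly_mono n.+1 n (lift k).
Proof. by move=> i j; rewrite /= !ltnNge leq_bump2. Qed.

Lemma strictly_mono_comp n m l (al : 'I_m.+1 -> 'I_n.+1) (be : 'I_l.+1 -> 'I_m.+1) :
  strictly_mono al -> strictly_mono be -> strictly_mono (al \o be).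
Proof. by move=> ha hb i j ij; apply/ha/hb. Qed.

Lemma face_faceE n (F : ('I_n.+1 -> C) -> Type) (s : chain C n.+2) (j : 'I_n.+3) (i : 'I_n.+2)
    h (x : F (fun a => vertex s (lift j (lift i a)))) :
  existT (fun c : chain C n => F (vertex c)) (face i (face j s)) x =
  existT (fun c : chain C n => F (vertex c)) (@restriction _ _ (lift j \o lift i) h s) x.
Proof.
apply: (@chain_pair_eq C n F) => k l kl /=.
by congr edge; exact: bool_irrelevance.
Qed.

Lemma restriction_faceE n m (F : ('I_m.+1 -> C) -> Type) (s : chain C n.+1) (k : 'I_n.+2)
    (al : 'I_m.+1 -> 'I_n.+1) h h' (x : F (fun a => vertex s (lift k (al a)))) :
  existT (fun c : chain C m => F (vertex c)) (@restriction _ _ al h (face k s)) x =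
  existT (fun c : chain C m => F (vertex c)) (@restriction _ _ (lift k \o al) h' s) x.
Proof.
apply: (@chain_pair_eq C m F) => a b ab /=.
by congr edge; exact: bool_irrelevance.
Qed.

(** Omitting two vertices in either order gives the same chain. The morphism in the pair
is the one along which values at the end of this chain are moved to the end of [s]. *)
Lemma face_swap n (s : chain C n.+2) (j k : 'I_n.+3) (i i' : 'I_n.+2)
    (hj : (lift j (lift i ord_max) <= @ord_max n.+2)%N)
    (hk : (lift k (lift i' ord_max) <= @ord_max n.+2)%N) :
  (forall a, lift j (lift i a) = lift k (lift i' a)) ->
  existT (fun c : chain C n => hom (vertex c ord_max) (vertex s ord_max)) (face i (face j s)) (edge s hj) =
  existT (fun c : chain C n => hom (vertex c ord_max) (vertex s ord_max)) (face i' (face k s)) (edge s hk).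
Proof.
move=> e; pose F (v : 'I_n.+1 -> C) := hom (v ord_max) (vertex s ord_max).
have hJ := strictly_mono_comp (strictly_mono_lift j) (strictly_mono_lift i).
have hK := strictly_mono_comp (strictly_mono_lift k) (strictly_mono_lift i').
rewrite (@face_faceE n F s j i hJ) (@face_faceE n F s k i' hK).
rewrite (bool_irrelevance hj (leq_ord (lift j (lift i ord_max)))).
rewrite (bool_irrelevance hk (leq_ord (lift k (lift i' ord_max)))).
apply: (@restriction_eq _ _ F s (lift j \o lift i) (lift k \o lift i') hJ hK
  (fun al => edge s (leq_ord (al ord_max) : (al ord_max <= @ord_max n.+2)%N))).
exact: e.
Qed.

Fixpoint hom_pow (a : C) (e : hom a a) (n : nat) : hom a a :=
  if n is n'.+1 then comp e (hom_pow e n') else idm a.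

Lemma hom_powD (a : C) (e : hom a a) m n : hom_pow e (m + n) = comp (hom_pow e m) (hom_pow e n).
Proof. by elim: m => [|m IH] /=; rewrite ?comp_idl// IH comp_assoc. Qed.

(** The powers of an endomorphism that is not an identity form chains of every length. *)
Lemma endomorphism_identity (a : C) (e : hom a a) : is_identity e.
Proof.
apply: contrapT => eN; suff : finite_set [set: nat] by exact: infinite_nat.
apply: sub_finite_set (finite_image (@projT1 _ _) (finite_chains C)) => n _.
unshelve eexists.
  exists n; unshelve eapply Chain.
    apply: (@Nerve C n (fun=> a) (fun k l _ => hom_pow e (l - k))).
      by move=> k _; rewrite subnn.
    by move=> k l m kl lm km; rewrite -hom_powD addnBA// subnK.
  by move=> k l kl lk /=; rewrite lk subSnn /= comp_idr.
by [].
by [].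
Qed.

Lemma vertex_inj n (s : chain C n) : injective (vertex s).
Proof.
have lt (k l : 'I_n.+1) : (k < l)%N -> vertex s k <> vertex s l.
  move=> kl; have := @edge_not_identity C n s k l (ltnW kl) kl.
  move: (edge s _); move: (vertex s k) (vertex s l) => a b f fN ab; subst b.
  exact/fN/endomorphism_identity.
move=> k l kl; apply: val_inj; case: (ltngtP k l) => // /lt; rewrite kl; exact.
Qed.

End ChainTheory.

(** * The metric of the homotopy limit *)

Definition to_subtype (T : Type) (A : set T) (x : T) (Ax : A x) : set_type A :=
  exist (fun x => x \in A) x (mem_set Ax).

Lemma proj_entourage (J : Type) (T : J -> uniformType) (i : J) (E : set (T i * T i)) :
  entourage E -> entourage [set fg : prod_topology T * prod_topology T | E (fg.1 i, fg.2 i)].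
Proof.
move=> eE; pose W : set (prod_topology T * prod_topology T) := [set fg | E (fg.1 i, fg.2 i)].
exists W => //.
have h : `[< @entourage (initial_topology (@proj J T i)) W >] by apply/asboolP; exists E.
pose x := exist (fun p : {classic J} * set (prod_topology T * prod_topology T) =>
  `[< @entourage (initial_topology (@proj J T p.1)) p.2 >]) (i, W) h.
exact: (@finI_from1 _ _ setT _ x I).
Qed.

Section HolimMetric.
Variables (R : realType) (I : finite_category) (D : diagram I).
Variable dD : forall i : I, D i -> D i -> R.
Hypotheses (dDm : forall i, metrizes (@dD i)) (dD1 : forall i x y, @dD i x y <= 1).

Definition holim_eval (phi : holim R D) n (s : chain I n) (t : simplex R n) : D (vertex s ord_max) :=
  holim_comp (\val phi) s t.

Lemma holim_ext (phi psi : holim R D) :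
  (forall n (s : chain I n) t, holim_eval phi s t = holim_eval psi s t) -> phi = psi.
Proof.
move=> h; apply: val_inj; apply: functional_extensionality_dep => -[n s].
by apply: val_inj; apply/funext => t; exact: h.
Qed.

Lemma holim_eval_ucont (phi : holim R D) n (s : chain I n) :
  ucont_on (@sdist R n) (@dD _) setT (holim_eval phi s).
Proof.
apply/(unif_continuous_metric _ (simplex_metrizes R n) (dDm _)).
exact: (set_valP (\val phi (existT _ n s))).
Qed.

Lemma holim_eval_coface (phi : holim R D) n (s : chain I n.+1) (k : 'I_n.+2) t :
  holim_eval phi s (coface k t) =
  dmap D (edge s (leq_ord (lift k ord_max) : (_ <= @ord_max n.+1)%N)) (holim_eval phi (face k s) t).
Proof. by have := set_valP phi; apply. Qed.

Lemma make_holim (X : forall n (s : chain I n), simplex R n -> D (vertex s ord_max)) :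
  (forall n (s : chain I n), ucont_on (@sdist R n) (@dD _) setT (X n s)) ->
  (forall n (s : chain I n.+1) (k : 'I_n.+2) t, X n.+1 s (coface k t) =
    dmap D (edge s (leq_ord (lift k ord_max) : (_ <= @ord_max n.+1)%N)) (X n (face k s) t)) ->
  exists phi : holim R D, forall n (s : chain I n) t, holim_eval phi s t = X n s t.
Proof.
move=> Xc Xf.
have Xu (s : {n & chain I n}) :
    [set f : arrow_uniform_type (simplex R (projT1 s)) (D (vertex (projT2 s) ord_max)) |
      unif_continuous (f : _ -> _)] (X _ (projT2 s)).
  apply/(unif_continuous_metric _ (simplex_metrizes R _) (dDm _)); exact: Xc.
pose Y : holim_prod R D := fun s => to_subtype (Xu s).
have YP : @holim_set R I D Y by move=> n s k t; exact: Xf.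
by exists (to_subtype YP).
Qed.

Let cell := {s : {n & chain I n} & simplex R (projT1 s)}.

Definition holim_dist (phi psi : holim R D) : R :=
  supr (fun u : cell => dD (holim_eval phi (projT2 (projT1 u)) (projT2 u))
                            (holim_eval psi (projT2 (projT1 u)) (projT2 u))).

Lemma holim_dist_ub phi psi n (s : chain I n) t :
  dD (holim_eval phi s t) (holim_eval psi s t) <= holim_dist phi psi.
Proof.
apply: (@supr_ub _ _ (fun u : cell => dD (holim_eval phi (projT2 (projT1 u)) (projT2 u))
  (holim_eval psi (projT2 (projT1 u)) (projT2 u))) 1
  (existT (fun s : {n & chain I n} => simplex R (projT1 s)) (existT _ n s) t)) => u.
exact: dD1.
Qed.

Lemma holim_dist_le phi psi (e : R) : 0 <= e ->
  (forall n (s : chain I n) t, dD (holim_eval phi s t) (holim_eval psi s t) <= e) ->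
  holim_dist phi psi <= e.
Proof. by move=> e0 h; apply: supr_le => // u; exact: h. Qed.

Lemma holim_dist_le1 phi psi : holim_dist phi psi <= 1.
Proof. by apply: holim_dist_le. Qed.

Lemma holim_dist_metric : is_metric holim_dist.
Proof.
have ge0 phi psi : 0 <= holim_dist phi psi.
  by apply: (supr_ge0 (M := 1)) => u; rewrite dD1 metric_ge0//; exact: (dDm _).1.
split=> [phi psi|phi psi|x y z].
- split=> [h|->]; last first.
    apply/eqP; rewrite eq_le ge0 andbT; apply: holim_dist_le => // n s t.
    by rewrite (metricxx _ (dDm _).1).
  apply: holim_ext => n s t; have [d0 _ _] := (dDm (vertex s ord_max)).1; apply/d0.
  apply/eqP; rewrite eq_le (metric_ge0 (dDm _).1) andbT.
  by have := holim_dist_ub phi psi s t; rewrite h.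
- congr supr; apply/funext => u.
  by have [_ dC _] := (dDm (vertex (projT2 (projT1 u)) ord_max)).1; rewrite dC.
- apply: holim_dist_le => [|n s t]; first by rewrite addr_ge0.
  have [_ _ dT] := (dDm (vertex s ord_max)).1.
  by apply: le_trans (dT _ (holim_eval y s t) _) _; apply: lerD; exact: holim_dist_ub.
Qed.

(** There are finitely many chains, so that the supremum over all of them metrizes the product. *)
Lemma holim_metrizes : metrizes holim_dist.
Proof.
apply: metrizes_intro; first exact: holim_dist_metric.
move=> E; split.
  move=> [B [C [F _ FC] CB] BE].
  have [||f _|e e0 eP] := @finite_uniform_pos R _ [set` F]
      (fun ie (e : R) => forall phi psi : holim R D, holim_dist phi psi < e ->
         (projT1 ie).2 (\val phi, \val psi)).
  - exact: finite_fset.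
  - by move=> f e e' ee h phi psi hd; apply: h; exact: lt_le_trans ee.
  - case: f => -[s W] /= /asboolP[V [V' [Q /(metrizesP (dDm _))[e e0 eQ] QV'] V'V] VW].
    exists e => // phi psi hd; apply: VW; apply: V'V; apply: QV' => t /=; apply: eQ.
    by case: s {V V' W Q} t => n s t; exact: le_lt_trans (holim_dist_ub phi psi s t) hd.
  exists e => // phi psi hd; apply: BE; apply: CB; rewrite -FC => ie Fie.
  exact: eP.
move=> [e e0 eE].
have e20 : 0 < e / 2 by rewrite divr_gt0.
pose B : set (holim_prod R D * holim_prod R D) :=
  [set fg | forall s t, dD (\val (fg.1 s) t) (\val (fg.2 s) t) < e / 2].
exists B; last first.
  move=> [phi psi] /= h; apply: eE; apply: (@le_lt_trans _ _ (e / 2)); last by lra.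
  by apply: holim_dist_le => [|n s t]; [exact: ltW|apply: ltW; exact: h (existT _ n s) t].
have comp_ent s : entourage [set fg : holim_prod R D * holim_prod R D |
    forall t, dD (\val (fg.1 s) t) (\val (fg.2 s) t) < e / 2].
  pose F : set (_ * _) := [set fg : unif_maps (simplex R (projT1 s)) (D (vertex (projT2 s) ord_max)) *
     unif_maps (simplex R (projT1 s)) (D (vertex (projT2 s) ord_max)) | forall t, dD (\val fg.1 t) (\val fg.2 t) < e / 2].
  apply: (@proj_entourage _ _ s F); exists [set fg | forall t, dD (fg.1 t) (fg.2 t) < e / 2] => //.
  exists [set xy | dD xy.1 xy.2 < e / 2] => //.
  by apply/(metrizesP (dDm _)); exists (e / 2).
have /finite_fsetP[l lP] := finite_chains I.
have : entourage (\bigcap_(s in [set` l]) [set fg : holim_prod R D * holim_prod R D |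
    forall t, dD (\val (fg.1 s) t) (\val (fg.2 s) t) < e / 2]).
  by apply: filter_bigI => s _; exact: comp_ent.
by apply: filterS => fg h s; apply: h; rewrite -lP.
Qed.

End HolimMetric.

(** * Functions on a simplex depending uniformly on a parameter *)

Section SimplexFunctions.
Variable R : realType.

Lemma prod_lip (J : finType) (x y : J -> R) :
  (forall i, 0 <= x i <= 1) -> (forall i, 0 <= y i <= 1) ->
  `|\prod_i x i - \prod_i y i| <= \sum_i `|x i - y i|.
Proof.
move=> x01 y01.
suff [_ _] : [/\ 0 <= \prod_i x i <= 1, 0 <= \prod_i y i <= 1 &
  `|\prod_i x i - \prod_i y i| <= \sum_i `|x i - y i|] by [].
elim/big_rec3: _ => [|i a c b _ [/andP[b0 b1] /andP[c0 c1] h]]; first by rewrite subrr normr0 lexx ler01.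
have /andP[x0 x1] := x01 i; have /andP[y0 y1] := y01 i.
split; [by rewrite mulr_ge0//= mulr_ile1|by rewrite mulr_ge0//= mulr_ile1|].
have -> : x i * b - y i * c = (x i - y i) * b + y i * (b - c) by ring.
apply: le_trans (ler_normD _ _) _; apply: lerD; rewrite normrM.
  by rewrite ler_piMr// ger0_norm.
by apply: le_trans h; rewrite ler_piMl// ger0_norm.
Qed.

(** It vanishes exactly on the boundary: see [bary_eq0] and [bary_coface]. *)
Definition bary n (t : simplex R n) : R := \prod_i coord t i.

Lemma bary01 n (t : simplex R n) : 0 <= bary t <= 1.
Proof.
rewrite /bary; elim/big_rec: _ => [|i b _ /andP[b0 b1]]; first by rewrite ler01 lexx.
by rewrite mulr_ge0 ?coord_ge0//= mulr_ile1 ?coord_ge0 ?coord_le1.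
Qed.

Lemma bary_lip n (t t' : simplex R n) : `|bary t - bary t'| <= n.+1%:R * sdist t t'.
Proof.
apply: le_trans (prod_lip _ _) _ => [i|i|]; rewrite ?coord_ge0 ?coord_le1//.
apply: (@le_trans _ _ (\sum_(i < n.+1) sdist t t')).
  by apply: ler_sum => i _; exact: coord_lip.
by rewrite sumr_const card_ord mulr_natl.
Qed.

Lemma bary_eq0 n (t : simplex R n) : bary t = 0 -> exists k, coord t k = 0.
Proof. by move=> /eqP; rewrite prodf_seq_eq0 => /hasP[k _ /andP[_ /eqP tk]]; exists k. Qed.

Lemma bary_coface n (k : 'I_n.+2) (t : simplex R n) : bary (coface k t) = 0.
Proof. by rewrite /bary (bigD1 k)//= coord_coface_eq0 mul0r. Qed.

(** It is 1 on the face opposite to the [k]-th vertex, and vanishes where [face_projection]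
ceases to be uniformly continuous. *)
Definition cutoff n (k : 'I_n.+2) (t : simplex R n.+1) : R := Num.max 0 (1 - 2 * coord t k).

Lemma cutoff_lip n (k : 'I_n.+2) (t t' : simplex R n.+1) :
  `|cutoff k t - cutoff k t'| <= 2 * sdist t t'.
Proof.
by apply: max0_dist; apply/absle; have /absle := coord_lip t t' k; lra.
Qed.

Lemma cutoff01 n (k : 'I_n.+2) (t : simplex R n.+1) : 0 <= cutoff k t <= 1.
Proof.
rewrite /cutoff; have := coord_ge0 t k.
by case: (leP 0 (1 - 2 * coord t k)) => *; apply/andP; split; lra.
Qed.

End SimplexFunctions.

Section UniformFamilies.
Variables (R : realType) (Z : Type) (d : Z -> Z -> R) (P : Type).

Definition uniform_family (N : set Z) n (g : Z -> simplex R n -> P -> R) :=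
  [/\ exists M : R, forall z t p, N z -> `|g z t p| <= M,
    forall e : R, 0 < e -> exists2 de : R, 0 < de & forall z z', N z -> N z' ->
      d z z' < de -> forall t p, `|g z t p - g z' t p| <= e &
    forall z, N z -> forall e : R, 0 < e -> exists2 de : R, 0 < de & forall t t' p,
      sdist t t' < de -> `|g z t p - g z t' p| <= e].

Lemma uniform_familyS N N' n (g : Z -> simplex R n -> P -> R) :
  N' `<=` N -> uniform_family N g -> uniform_family N' g.
Proof.
move=> NN [[M gM] g1 g2]; split; first by exists M => z t p /NN; exact: gM.
- move=> e /g1[de de0 deP]; exists de => // z z' /NN Nz /NN Nz'; exact: deP.
- by move=> z /NN; exact: g2.
Qed.

Lemma uniform_familyD N n (g h : Z -> simplex R n -> P -> R) :
  uniform_family N g -> uniform_family N h -> uniform_family N (fun z t p => g z t p + h z t p).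
Proof.
move=> [[M gM] g1 g2] [[M' hM] h1 h2]; split.
- exists (M + M') => z t p Nz; apply: le_trans (ler_normD _ _) _.
  by apply: lerD; [exact: gM|exact: hM].
- move=> e e0; have e20 : 0 < e / 2 by lra.
  have [de de0 deP] := g1 _ e20; have [de' de'0 de'P] := h1 _ e20.
  exists (Num.min de de') => [|z z' Nz Nz']; first by rewrite lt_min de0.
  rewrite lt_min => /andP[zz zz'] t p.
  have /absle := deP z z' Nz Nz' zz t p; have /absle := de'P z z' Nz Nz' zz' t p.
  by move=> ? ?; apply/absle; lra.
- move=> z Nz e e0; have e20 : 0 < e / 2 by lra.
  have [de de0 deP] := g2 z Nz _ e20; have [de' de'0 de'P] := h2 z Nz _ e20.
  exists (Num.min de de') => [|t t' p]; first by rewrite lt_min de0.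
  rewrite lt_min => /andP[tt tt'].
  have /absle := deP t t' p tt; have /absle := de'P t t' p tt'.
  by move=> ? ?; apply/absle; lra.
Qed.

Lemma uniform_familyN N n (g : Z -> simplex R n -> P -> R) :
  uniform_family N g -> uniform_family N (fun z t p => - g z t p).
Proof.
move=> [[M gM] g1 g2]; split.
- by exists M => z t p Nz; rewrite normrN; exact: gM.
- move=> e /g1[de de0 deP]; exists de => // z z' Nz Nz' zz t p.
  by rewrite -opprD normrN; exact: deP.
- move=> z Nz e /(g2 z Nz)[de de0 deP]; exists de => // t t' p tt.
  by rewrite -opprD normrN; exact: deP.
Qed.

Lemma uniform_family_coface N n (k : 'I_n.+2) (g : Z -> simplex R n.+1 -> P -> R) :
  uniform_family N g -> uniform_family N (fun z t p => g z (coface k t) p).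
Proof.
move=> [[M gM] g1 g2]; split; first by exists M => z t p; exact: gM.
- by move=> e /g1[de de0 deP]; exists de => // z z' Nz Nz' zz t p; exact: deP.
- move=> z Nz e /(g2 z Nz)[de de0 deP]; exists de => // t t' p tt.
  by apply: deP; exact: le_lt_trans (sdist_coface k t t') tt.
Qed.

Lemma uniform_family_cutoff N n (k : 'I_n.+2) (v : Z -> simplex R n -> P -> R) :
  uniform_family N v ->
  uniform_family N (fun z t p => cutoff k t * v z (face_projection k t) p).
Proof.
move=> [[M vM] v1 v2]; split.
- exists M => z t p Nz; rewrite normrM; have := vM z (face_projection k t) p Nz.
  have /andP[c0 c1] := cutoff01 k t.
  by apply: le_trans; rewrite ler_piMl// ger0_norm.
- move=> e /v1[de de0 deP]; exists de => // z z' Nz Nz' zz t p.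
  rewrite -mulrBr normrM; have := deP z z' Nz Nz' zz (face_projection k t) p.
  have /andP[c0 c1] := cutoff01 k t.
  by apply: le_trans; rewrite ler_piMl// ger0_norm.
- move=> z Nz e e0; have e20 : 0 < e / 2 by lra.
  have [de de0 deP] := v2 z Nz _ e20.
  pose M' : R := `|M| + 1; have M'0 : 0 < M' by rewrite /M' ltr_wpDl.
  have vM' t p : `|v z t p| <= M'.
    by apply: le_trans (vM z t p Nz) _; rewrite /M'; have := ler_norm M; lra.
  have a0 : 0 < e / (4 * M') by rewrite divr_gt0// mulr_gt0.
  exists (Num.min (de / 8) (e / (4 * M'))) => [|t t' p].
    by rewrite lt_min a0 divr_gt0.
  rewrite lt_min => /andP[t1]; rewrite ltr_pdivlMr ?mulr_gt0// => t2.
  have cl : `|cutoff k t - cutoff k t'| * M' <= e / 2.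
    have := ler_wpM2r (ltW M'0) (cutoff_lip k t t'); lra.
  have cz (u : simplex R n.+1) : 1 / 2 <= coord u k -> cutoff k u = 0.
    by move=> h; rewrite /cutoff max_l//; lra.
  have cM (x y : R) (u : simplex R n) q : `|x - y| * M' <= e / 2 -> `|(x - y) * v z u q| <= e / 2.
    by rewrite normrM; apply: le_trans; rewrite ler_wpM2l.
  have [tk|tk] := lerP (1 / 2) (coord t k).
    rewrite (cz t)// mul0r sub0r normrN -[cutoff k t']subr0.
    by apply: (@le_trans _ _ (e / 2)); [apply: cM; rewrite -(cz t)// distrC|lra].
  have [tk'|tk'] := lerP (1 / 2) (coord t' k).
    rewrite (cz t')// mul0r subr0 -[cutoff k t]subr0.
    by apply: (@le_trans _ _ (e / 2)); [apply: cM; rewrite -(cz t')|lra].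
  set p1 := face_projection k t; set p2 := face_projection k t'.
  have -> : cutoff k t * v z p1 p - cutoff k t' * v z p2 p =
    cutoff k t * (v z p1 p - v z p2 p) + (cutoff k t - cutoff k t') * v z p2 p by ring.
  apply: le_trans (ler_normD _ _) _; have -> : e = e / 2 + e / 2 by lra.
  apply: lerD; last exact: cM.
  have /andP[c0 c1] := cutoff01 k t; rewrite normrM.
  have h : `|v z p1 p - v z p2 p| <= e / 2.
    apply: deP; apply: le_lt_trans (face_projection_lip (ltW tk) (ltW tk')) _; lra.
  by apply: le_trans h; rewrite ler_piMl// ger0_norm.
Qed.

(** Replaces the values of a function on one face by prescribed ones. On the
other faces nothing changes at the points where the prescribed values are
taken on the intersection of the two faces. *)
Definition correction n (k : 'I_n.+2) (u : Z -> simplex R n -> P -> R)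
    (g : Z -> simplex R n.+1 -> P -> R) z t p : R :=
  g z t p + cutoff k t *
    (u z (face_projection k t) p - g z (coface k (face_projection k t)) p).

Lemma uniform_family_correction N n (k : 'I_n.+2) u g :
  uniform_family N u -> uniform_family N g -> uniform_family N (@correction n k u g).
Proof.
move=> hu hg; apply: uniform_familyD => //.
apply: (@uniform_family_cutoff N n k (fun z t p => u z t p - g z (coface k t) p)).
by apply: uniform_familyD => //; apply: uniform_familyN; exact: uniform_family_coface.
Qed.

Section Corrections.
Variables (n : nat) (u : 'I_n.+2 -> Z -> simplex R n -> P -> R).

Definition corrections (g : Z -> simplex R n.+1 -> P -> R) : Z -> simplex R n.+1 -> P -> R :=
  foldl (fun g k => correction k (u k) g) g (enum 'I_n.+2).

Let matches z g j := forall t p, g z (coface j t) p = u j z t p.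

Let correction_matches z g k : matches z (correction k (u k) g) k.
Proof.
move=> t p; rewrite /correction face_projectionK /cutoff coord_coface_eq0.
rewrite mulr0 subr0 (max_r ler01) mul1r; ring.
Qed.

Let correction_keeps z g j k :
  (forall j k t t', coface j t = coface k t' -> forall p, u j z t p = u k z t' p) ->
  matches z g j -> matches z (correction k (u k) g) j.
Proof.
move=> compat gj t p; rewrite /correction gj /cutoff.
have [tk|tk] := lerP (1 / 2) (coord (coface j t) k).
  by rewrite max_l ?mul0r ?addr0//; lra.
have [|t' t'E] := @on_face _ _ j (coface k (face_projection k (coface j t))).
  by apply: face_projection_eq0; [lra|exact: coord_coface_eq0].
by rewrite t'E gj (compat k j _ t' t'E) subrr mulr0 addr0.
Qed.

Lemma uniform_family_corrections N g : (forall k, uniform_family N (u k)) ->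
  uniform_family N g -> uniform_family N (corrections g).
Proof.
move=> hu; rewrite /corrections; elim: (enum _) g => [//|k l IH] g hg /=.
by apply: IH; exact: uniform_family_correction.
Qed.

(** Each correction enforces the values on one face and, by compatibility, spoils no face on
which they were enforced before. *)
Lemma corrections_coface z g :
  (forall j k t t', coface j t = coface k t' -> forall p, u j z t p = u k z t' p) ->
  forall j t p, corrections g z (coface j t) p = u j z t p.
Proof.
move=> compat j; suff : matches z (corrections g) j by [].
rewrite /corrections; have : matches z g j \/ j \in enum 'I_n.+2 by right; rewrite mem_enum.
elim: (enum _) g => [g []//|k l IH] g h /=; apply: IH.
case: h => [gj|]; first by left; exact: correction_keeps.
by rewrite inE => /orP[/eqP->|]; [left; exact: correction_matches|right].
Qed.

Lemma corrections_id z g : (forall j t p, g z (coface j t) p = u j z t p) ->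
  corrections g z = g z.
Proof.
rewrite /corrections; elim: (enum _) g => [//|k l IH] g gu /=.
have e : correction k (u k) g z = g z.
  by apply/funext => t; apply/funext => p; rewrite /correction gu subrr mulr0 addr0.
by rewrite IH e.
Qed.

End Corrections.

End UniformFamilies.

(** * Extension of maps into the homotopy limit *)

Lemma lift_lift_comm n (j k : 'I_n.+3) (i i' : 'I_n.+2) : k = lift j i -> j = lift k i' ->
  forall a, lift j (lift i a) = lift k (lift i' a).
Proof.
move=> /(congr1 val) /= e1 /(congr1 val) /= e2 a; apply: val_inj => /=.
by move: e1 e2; rewrite /bump; lia.
Qed.

Section HolimExtension.
Variables (R : realType) (I : finite_category) (D : diagram I).
Variable dD : forall i : I, D i -> D i -> R.
Hypotheses (dDm : forall i, metrizes (@dD i)) (dD1 : forall i x y, @dD i x y <= 1).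
Variables (e0 : I -> R) (r : forall i : I, (D i -> R) -> R -> option (D i)).
Hypothesis rP : forall i, near_retraction (@dD i) (e0 i) (@r i).
Variables (Z : Type) (d : Z -> Z -> R) (A : set Z) (f : Z -> holim R D).
Hypotheses (dm : is_metric d) (cA : metric_closed d A).
Hypothesis f_lip : forall a a', A a -> A a' -> holim_dist dD (f a) (f a') <= d a a'.
Variable pt : forall i : I, D i.

Let N e := metric_nbhd d A e.
Let s := set_dist d A.
Let ret i q x : D i := odflt (pt i) (r q x).

Let NS e e' : e <= e' -> N e `<=` N e'.
Proof. by move=> ee z [a Aa az]; exists a => //; exact: lt_le_trans ee. Qed.

Let ret_id i x : @ret i (dD x) 0 = x.
Proof. by rewrite /ret; have [_ -> _] := rP i. Qed.

Let ret_ucont i (e : R) : 0 < e -> exists2 de : R, 0 < de & forall q x q' x',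
  admissible (@dD i) (e0 i) q x -> admissible (@dD i) (e0 i) q' x' ->
  (forall p, `|q p - q' p| <= de) -> `|x - x'| <= de -> dD (ret q x) (ret q' x') < e.
Proof.
move=> e1; have [_ _ /(_ e e1)[de de0 deP]] := rP i; exists de => // q x q' x' h1 h2 h3 h4.
apply: le_lt_trans (deP q x q' x' h1 h2 h3 h4); rewrite /ret.
by case: (r q x) => [y|]; case: (r q' x') => [y'|] //=; rewrite (metricxx _ (dDm i).1).
Qed.

Let kappa n (c : chain I n) z t (p : D (vertex c ord_max)) : R := dD (holim_eval (f z) c t) p.

Let base n (c : chain I n) : Z -> simplex R n -> D (vertex c ord_max) -> R :=
  regular_extension d A (@sdist R n) (@kappa n c).

Let kappa01 n (c : chain I n) z t p : 0 <= @kappa n c z t p <= 1.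
Proof. by rewrite /kappa dD1 (metric_ge0 (dDm _).1). Qed.

Let kappa_lip n (c : chain I n) a a' t p : A a -> A a' -> `|@kappa n c a t p - @kappa n c a' t p| <= d a a'.
Proof.
move=> Aa Aa'; apply: le_trans (kuratowski_lip (dDm _).1 _ _ _) _; apply: le_trans (f_lip Aa Aa').
exact: holim_dist_ub.
Qed.

Let kappa_ucont n (c : chain I n) a (e : R) : 0 < e -> exists2 de : R, 0 < de &
  forall t t' p, sdist t t' < de -> `|@kappa n c a t p - @kappa n c a t' p| <= e.
Proof.
move=> e1; have [de de0 deP] := holim_eval_ucont dDm (f a) c e1.
exists de => // t t' p tt; apply: le_trans (kuratowski_lip (dDm _).1 _ _ _) _.
by apply/ltW/deP.
Qed.

Let base_id n (c : chain I n) a t p : A a -> @base _ c a t p = @kappa n c a t p.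
Proof.
move=> Aa; by apply: (regular_extension_id dm (@sdist_metric R n)) => *;
  [exact: kappa01|exact: kappa_lip|exact: kappa_ucont|].
Qed.

Let base_uniform n (c : chain I n) : uniform_family d (N 1) (@base _ c).
Proof.
split.
- exists 1 => z t p _.
  have /andP[h0 h1] : 0 <= @base _ c z t p <= 1.
    apply: (regular_extension01 dm (@sdist_metric R n)) => *; exact: kappa01.
  by rewrite ger0_norm.
- move=> e e1; exists (e / 31); first by lra.
  move=> z z' _ _ zz t p.
  have : `|@base _ c z t p - @base _ c z' t p| <= 31 * d z z'.
    by apply: (regular_extension_lip dm (@sdist_metric R n)) => *; exact: kappa01.
  by move/le_trans; apply; lra.
- move=> z [a Aa az] e e1.
  have s1 : set_dist d A z < 1 by exact: le_lt_trans (set_dist_le dm _ Aa) az.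
  have := @regular_extension_ucont R Z d A dm _ _ (@sdist_metric R n) (@sdist_le1 R n) _ (@kappa n c).
  apply; [by move=> *; exact: kappa01|by move=> *; exact: kappa_lip|
    by move=> *; exact: kappa_ucont|exact: cA|exact: s1|exact: e1].
Qed.

(** Continuity in the parameter is required to be uniform over the simplex: it becomes the
uniform continuity of the extension into the homotopy limit. *)
Definition good_section n (c : chain I n) (X : Z -> simplex R n -> D (vertex c ord_max)) (e : R) :=
  [/\ forall a t, A a -> X a t = holim_eval (f a) c t,
    forall e1 : R, 0 < e1 -> exists2 de : R, 0 < de & forall z z', N e z -> N e z' ->
      d z z' < de -> forall t, dD (X z t) (X z' t) < e1 &
    forall z, N e z -> ucont_on (@sdist R n) (@dD _) setT (X z)].

Let good_sectionS n (c : chain I n) X e e' : e' <= e -> @good_section n c X e -> @good_section n c X e'.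
Proof.
move=> ee [h1 h2 h3]; split => //.
- move=> e1 /h2[de de0 deP]; exists de => // z z' /(NS ee) Nz /(NS ee) Nz'; exact: deP.
- by move=> z /(NS ee); exact: h3.
Qed.

(** Near the closed set, a family close to the Kuratowski images of the
prescribed maps is retracted, at a height that vanishes only where the
family already takes values in the Kuratowski image. *)
Let retract_family n (c : chain I n) (h : Z -> simplex R n -> D (vertex c ord_max) -> R) (e : R) : 0 < e ->
  uniform_family d (N e) h ->
  (forall a t, A a -> h a t = dD (holim_eval (f a) c t)) ->
  (forall z t, N e z -> bary t = 0 -> exists y, h z t = dD y) ->
  exists2 e' : R, 0 < e' & good_section (fun z t => ret (h z t) (s z * bary t)) e'.
Proof.
move=> ep [_ h2 h3] hA hb; set i := vertex c ord_max.
have [e00 _ _] := rP i; have [de de0 deP] := h2 _ e00.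
pose e' := Num.min e (Num.min de (e0 i)).
have [e'e [e'de e'e0]] : e' <= e /\ e' <= de /\ e' <= e0 i.
  by rewrite /e' !ge_min !lexx !orbT.
have s01 z := set_dist01 A dm z.
have sb z (t : simplex R n) : 0 <= s z * bary t by rewrite mulr_ge0//; [case/andP: (s01 z)|case/andP: (@bary01 R n t)].
have adm z t : N e' z -> admissible (@dD i) (e0 i) (h z t) (s z * bary t).
  move=> Nz; have [a Aa az] := Nz; split.
    move=> /eqP; rewrite mulf_eq0 => /orP[/eqP sz|/eqP bt].
      by exists (holim_eval (f z) c t); rewrite hA//; exact: set_dist_eq0 cA sz.
    by apply: hb => //; exact: NS Nz.
  exists (holim_eval (f a) c t); split.
    rewrite ger0_norm//; apply: (@le_trans _ _ (s z)).
      by rewrite ler_piMr//; [case/andP: (s01 z)|case/andP: (@bary01 R n t)].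
    apply: le_trans (set_dist_le dm z Aa) _; apply: le_trans (ltW az) e'e0.
  move=> p; rewrite -hA// distrC; apply: deP.
  - by exists a => //; rewrite (metricxx _ dm).
  - exact: NS Nz.
  - exact: lt_le_trans az e'de.
exists e'; first by rewrite /e' !lt_min ep de0.
split.
- by move=> a t Aa; rewrite hA// /s set_dist0// mul0r ret_id.
- move=> e1 e10; have [d1 d10 d1P] := ret_ucont i e10.
  have [d2 d20 d2P] := h2 _ d10; exists (Num.min d1 d2); first by rewrite lt_min d10.
  move=> z z' Nz Nz'; rewrite lt_min => /andP[zz1 zz2] t; apply: d1P; [exact: adm|exact: adm| |].
    by move=> p; apply: d2P => //; [exact: NS Nz|exact: NS Nz'].
  rewrite -mulrBl normrM (ger0_norm (x := bary t)); last by case/andP: (@bary01 R n t).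
  apply: le_trans (ltW zz1); apply: le_trans (set_dist_lip A dm z z').
  by rewrite ler_piMr//; case/andP: (@bary01 R n t).
- move=> z Nz e1 e10; have [d1 d10 d1P] := ret_ucont i e10.
  have [d2 d20 d2P] := h3 z (NS e'e Nz) _ d10.
  have n0 : 0 < n.+1%:R :> R by rewrite ltr0n.
  exists (Num.min (d1 / n.+1%:R) d2); first by rewrite lt_min d20 divr_gt0.
  move=> t t' _ _; rewrite lt_min => /andP[tt1 tt2]; apply: d1P; [exact: adm|exact: adm| |].
    by move=> p; exact: d2P.
  rewrite -mulrBr normrM (ger0_norm (x := s z)); last by case/andP: (s01 z).
  move: tt1; rewrite ltr_pdivlMr// mulrC => /ltW; apply: le_trans.
  apply: le_trans (bary_lip t t').
  by rewrite ler_piMl//; case/andP: (s01 z).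
Qed.

Let last_edge n (c : chain I n.+1) (k : 'I_n.+2) : hom (vertex (face k c) ord_max) (vertex c ord_max) :=
  edge c (leq_ord (lift k ord_max) : (_ <= @ord_max n.+1)%N).

Let boundary n (X : forall c : chain I n, Z -> simplex R n -> D (vertex c ord_max)) (c : chain I n.+1)
    (k : 'I_n.+2) z t : D (vertex c ord_max) :=
  dmap D (last_edge c k) (X (face k c) z t).

(** By induction on the length of the chain. The faces prescribe the boundary values; the
height vanishes on the boundary, where these values already are points of the space. *)
Fixpoint holim_section n : forall c : chain I n, Z -> simplex R n -> D (vertex c ord_max) :=
  match n with
  | 0 => fun c z t => ret (@base _ c z t) (s z * bary t)
  | n'.+1 => fun c z t =>
      ret (corrections (fun k z t p => dD (boundary (@holim_section n') c k z t) p) (@base _ c) z t)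
        (s z * bary t)
  end.

Let compatible n : forall (c : chain I n) (e : R), Prop :=
  match n with
  | 0 => fun _ _ => True
  | n'.+1 => fun c e => forall z, N e z -> forall (k : 'I_n'.+2) t,
      holim_section c z (coface k t) = boundary (@holim_section n') c k z t
  end.

Let compatibleS n (c : chain I n) (e e' : R) : e' <= e -> compatible c e -> compatible c e'.
Proof. by case: n c => // n c ee h z /(NS ee); exact: h. Qed.

Let boundary_swap n (X : forall c : chain I n, Z -> simplex R n -> D (vertex c ord_max))
    (c : chain I n.+2) (j k : 'I_n.+3) (i i' : 'I_n.+2) z t :
  k = lift j i -> j = lift k i' ->
  dmap D (last_edge c j) (dmap D (last_edge (face j c) i) (X (face i (face j c)) z t)) =
  dmap D (last_edge c k) (dmap D (last_edge (face k c) i') (X (face i' (face k c)) z t)).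
Proof.
move=> kj jk; rewrite -!dmap_comp.
have hj : (lift j (lift i ord_max) <= @ord_max n.+2)%N by exact: leq_ord.
have hk : (lift k (lift i' ord_max) <= @ord_max n.+2)%N by exact: leq_ord.
have -> : comp (last_edge c j) (last_edge (face j c) i) = edge c hj.
  apply/esym; apply: (@edge_comp _ _ c (lift j (lift i ord_max)) (lift j ord_max) ord_max).
have -> : comp (last_edge c k) (last_edge (face k c) i') = edge c hk.
  apply/esym; apply: (@edge_comp _ _ c (lift k (lift i' ord_max)) (lift k ord_max) ord_max).
have := face_swap c hj hk (lift_lift_comm kj jk).
pose G (u : {c' : chain I n & hom (vertex c' ord_max) (vertex c ord_max)}) :=
  dmap D (projT2 u) (X (projT1 u) z t).
by move=> /(congr1 G).
Qed.

(** Where two faces meet, both prescribed values come from the chain that omits two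
vertices. The two faces of a segment do not meet. *)
Let boundary_compat n (c : chain I n.+1) z (e : R) : N e z ->
  (forall k, compatible (face k c) e) ->
  forall (j k : 'I_n.+2) t t', coface j t = coface k t' ->
  boundary (@holim_section n) c j z t = boundary (@holim_section n) c k z t'.
Proof.
move=> Nz; case: n c => [|n] c comp j k t t' tt.
  have [jk|jk] := eqVneq j k; first by subst k; rewrite (coface_inj tt).
  have := coord_sum (coface j t); rewrite big_ord_recl big_ord1.
  have c1 : coord (coface j t) j = 0 by rewrite coord_coface_eq0.
  have c2 : coord (coface j t) k = 0 by rewrite tt coord_coface_eq0.
  have z0 i : coord (coface j t) i = 0.
    suff [->|->] : i = j \/ i = k by [].
    have jk' : j <> k :> nat by move=> /val_inj /eqP; exact/negP.
    have := ltn_ord i; have := ltn_ord j; have := ltn_ord k => ? ? ?.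
    have [/val_inj|/val_inj] : i = j :> nat \/ i = k :> nat by lia.
      by left.
    by right.
  by rewrite !z0 addr0 => /esym/eqP; rewrite oner_eq0.
have [jk|jk] := eqVneq j k; first by subst k; rewrite (coface_inj tt).
have [i kE] : exists i, k = lift j i by case: (unliftP j k) jk => [i ->|->]; [exists i|rewrite eqxx].
have [i' jE] : exists i, j = lift k i by case: (unliftP k j) jk => [i' ->|->]; [exists i'|rewrite eqxx].
have [t1 tE] : exists t1, t = coface i t1.
  by apply: on_face; rewrite -(coord_coface j) -kE tt coord_coface_eq0.
have [t2 t'E] : exists t2, t' = coface i' t2.
  by apply: on_face; rewrite -(coord_coface k) -jE -tt coord_coface_eq0.
have t12 : t1 = t2.
  apply: simplex_ext => a; rewrite -(coord_coface i) -tE -(coord_coface j) tt.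
  by rewrite (lift_lift_comm kE jE) coord_coface t'E coord_coface.
subst t2 t t'; rewrite /boundary (comp j z Nz i t1) (comp k z Nz i' t1).
exact: boundary_swap.
Qed.

Lemma holim_section_good n (c : chain I n) : exists2 e : R, 0 < e &
  good_section (holim_section c) e /\ compatible c e.
Proof.
elim: n c => [|n IH] c.
  have [||e ep he] := @retract_family 0 c (@base _ c) 1 ltr01 (@base_uniform _ c).
  - by move=> a t Aa; apply/funext => p; rewrite base_id.
  - move=> z t _ /bary_eq0[k tk]; have := coord_sum t; rewrite big_ord1.
    by move: tk; rewrite (ord1 k) => -> /esym/eqP; rewrite oner_eq0.
  by exists e.
have [||e ep he] := @finType_uniform_pos R 'I_n.+2 (fun k e =>
    good_section (holim_section (face k c)) e /\ compatible (face k c) e).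
- by move=> k e e' ee [h1 h2]; split; [exact: good_sectionS h1|exact: compatibleS h2].
- by move=> k; exact: IH.
pose e1 := Num.min 1 e.
have [e11 e1e] : e1 <= 1 /\ e1 <= e by rewrite /e1 !ge_min !lexx orbT.
have e1p : 0 < e1 by rewrite /e1 lt_min ltr01.
pose u k z t p := dD (boundary (@holim_section n) c k z t) p.
have uU k : uniform_family d (N e1) (u k).
  have [[h1 h2 h3] _] := he k.
  split.
  - by exists 1 => z t p _; rewrite /u ger0_norm// (metric_ge0 (dDm _).1).
  - move=> e2 e20.
    have /(unif_continuous_metric _ (dDm _) (dDm _))/(_ _ e20)[d2 d20 d2P] :=
      @dmap_unif_continuous _ D _ _ (last_edge c k).
    have [d3 d30 d3P] := h2 _ d20; exists d3 => // z z' Nz Nz' zz t p.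
    apply: le_trans (kuratowski_lip (dDm _).1 _ _ _) _; apply/ltW/d2P => //; apply: d3P => //; exact: NS e1e _ _.
  - move=> z Nz e2 e20.
    have /(unif_continuous_metric _ (dDm _) (dDm _))/(_ _ e20)[d2 d20 d2P] :=
      @dmap_unif_continuous _ D _ _ (last_edge c k).
    have [d3 d30 d3P] := h3 z (NS e1e Nz) _ d20; exists d3 => // t t' p tt.
    by apply: le_trans (kuratowski_lip (dDm _).1 _ _ _) _; apply/ltW/d2P => //; exact: d3P.
have compat z : N e1 z -> forall j k t t', coface j t = coface k t' -> forall p, u j z t p = u k z t' p.
  move=> Nz j k t t' tt p; rewrite /u; congr dD.
  by apply: (boundary_compat (NS e1e Nz)) => // l; have [] := he l.
have cor z (Nz : N e1 z) := @corrections_coface _ _ _ _ u z (@base _ c) (compat z Nz).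
have [|||e2 e20 he2] := @retract_family n.+1 c (corrections u (@base _ c)) e1 e1p.
- apply: uniform_family_corrections => //; apply: uniform_familyS (@base_uniform _ c).
  exact: NS.
- move=> a t Aa; rewrite corrections_id; first by apply/funext => p; rewrite base_id.
  move=> j t' p; rewrite base_id// /kappa holim_eval_coface /u /boundary.
  by have [[-> //]] := he j.
- move=> z t Nz /bary_eq0[k /on_face[t' ->]]; exists (boundary (@holim_section n) c k z t').
  by apply/funext => p; rewrite cor.
exists (Num.min e1 e2); first by rewrite lt_min e1p.
split; first by apply: good_sectionS he2; rewrite ge_min lexx orbT.
move=> z Nz k t /=; rewrite bary_coface mulr0 -[RHS]ret_id; congr ret.
apply/funext => p; apply: cor; apply: NS Nz; by rewrite ge_min lexx.
Qed.

Lemma holim_extension : exists2 e : R, 0 < e & exists F : Z -> holim R D,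
  (forall a, A a -> F a = f a) /\ ucont_on d (holim_dist dD) (metric_nbhd d A e) F.
Proof.
have [|||e ep he] := @finite_uniform_pos R {n & chain I n} setT
  (fun c e => good_section (@holim_section _ (projT2 c)) e /\ compatible (projT2 c) e).
- exact: finite_chains.
- by move=> k e e' ee [h1 h2]; split; [exact: good_sectionS h1|exact: compatibleS h2].
- by move=> [n c] _; exact: holim_section_good.
have {}he n (c : chain I n) := he (existT _ n c) Logic.I.
have /choice[F FP] : forall z, exists phi : holim R D, N e z ->
    forall n (c : chain I n) t, holim_eval phi c t = holim_section c z t.
  move=> z; have [Nz|Nz] := pselect (N e z); last by exists (f z).
  have [||phi phiP] := make_holim (D := D) dDm (X := fun n c => @holim_section n c z).
  - by move=> n c; have [[_ _ /(_ z Nz)]] := he n c.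
  - by move=> n c k t; have [_ /(_ z Nz)] := he n.+1 c.
  by exists phi.
exists e => //; exists F; split.
  move=> a Aa; apply: holim_ext => n c t; have [[h _ _] _] := he n c.
  by rewrite FP ?h//; exists a => //; rewrite (metricxx _ dm).
move=> e1 e10; have e20 : 0 < e1 / 2 by lra.
have [|||de de0 deP] := @finite_uniform_pos R {n & chain I n} setT
  (fun c de => forall z z', N e z -> N e z' -> d z z' < de ->
    forall t, dD (holim_section (projT2 c) z t) (holim_section (projT2 c) z' t) < e1 / 2).
- exact: finite_chains.
- by move=> c de de' dd h z z' Nz Nz' zz; apply: h => //; exact: lt_le_trans dd.
- by move=> [n c] _; have [[_ h _] _] := he n c; exact: h.
exists de => // z z' Nz Nz' zz; apply: (@le_lt_trans _ _ (e1 / 2)); last by lra.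
apply: holim_dist_le => [|n c t]; first exact: ltW.
by rewrite !FP//; apply: ltW; exact: (deP (existT _ n c)).
Qed.

End HolimExtension.

Section ObjectChain.
Variable C : category.

Program Definition object_nerve (i : C) : nerve C 0 :=
  @Nerve C 0 (fun=> i) (fun k l _ => idm i) _ _.
Next Obligation. by []. Qed.
Next Obligation. by move=> *; rewrite comp_idl. Qed.

Lemma object_nerve_nondegenerate (i : C) : nondegenerate (object_nerve i).
Proof. by move=> k l kl lk; have := ltn_ord l; rewrite lk. Qed.

Definition object_chain (i : C) : chain C 0 := Chain (@object_nerve_nondegenerate i).

End ObjectChain.

Lemma holim_extensor (R : realType) (I : finite_category) (D : diagram I)
    (dD : forall i : I, D i -> D i -> R) (e0 : I -> R) (r : forall i : I, (D i -> R) -> R -> option (D i)) :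
  (forall i, metrizes (@dD i)) -> (forall i x y, @dD i x y <= 1) ->
  (forall i, near_retraction (@dD i) (e0 i) (@r i)) ->
  uniform_extensor (holim_dist dD).
Proof.
move=> dDm dD1 rP Z d A f dm [a0 Aa0] cA f_lip.
have [t0 _] : exists t : simplex R 0, forall i, coord t i = 1.
  by apply: make_simplex => [i|]; rewrite ?ler01// big_ord1.
apply: (holim_extension dDm dD1 rP dm cA f_lip) => i.
exact: (holim_eval (f a0) (object_chain i) t0).
Qed.

(** * Coordinates on the cells of the homotopy colimit *)

Section Coordinates.
Variables (R : realType) (I : finite_category) (D : diagram I).
Variable dD : forall i : I, D i -> D i -> R.
Hypotheses (dDm : forall i, metrizes (@dD i)) (dD1 : forall i x y, @dD i x y <= 1).

Definition morphism := {ab : I * I & hom ab.1 ab.2}.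
Definition mor (a b : I) (f : hom a b) : morphism := existT (fun ab : I * I => hom ab.1 ab.2) (a, b) f.
Definition point := {i : I & D i}.
Definition pnt (i : I) (x : D i) : point := existT (fun i => dob D i) i x.

(** The distance in a fibre. Points of distinct fibres count for nothing in the sums of
[weighted_dist]. *)
Definition fiber_dist (u v : point) : R :=
  if pselect (projT1 u = projT1 v) is left e then dD (eq_rect _ (dob D) (projT2 u) _ e) (projT2 v) else 0.

Lemma fiber_dist_same i (x y : D i) : fiber_dist (pnt x) (pnt y) = dD x y.
Proof.
rewrite /fiber_dist; case: pselect => // e /=.
by rewrite (Prop_irrelevance e erefl).
Qed.

Lemma fiber_dist_neq u v : projT1 u <> projT1 v -> fiber_dist u v = 0.
Proof. by rewrite /fiber_dist; case: pselect. Qed.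

Lemma fiber_dist01 u v : 0 <= fiber_dist u v <= 1.
Proof.
rewrite /fiber_dist; case: pselect => [e|_]; last by rewrite lexx ler01.
by rewrite dD1 (metric_ge0 (dDm _).1).
Qed.

Lemma fiber_dist_lip i (x y : D i) v : `|fiber_dist (pnt x) v - fiber_dist (pnt y) v| <= dD x y.
Proof.
case: v => j z; have [ij|ij] := pselect (i = j).
  by subst j; rewrite !fiber_dist_same; exact: kuratowski_lip (dDm _).1 _ _ _.
by rewrite !fiber_dist_neq// subrr normr0 (metric_ge0 (dDm _).1).
Qed.

Section Cell.
Variables (n : nat) (s : chain I n).
Implicit Types (x : D (vertex s ord0)) (t : simplex R n).

Definition value x (k : 'I_n.+1) : D (vertex s k) := dmap D (edge s (leq0n k : (@ord0 n <= k)%N)) x.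

Lemma value0 x : value x ord0 = x.
Proof. by rewrite /value edge_id dmap_id. Qed.

Lemma value_edge x (k l : 'I_n.+1) (kl : (k <= l)%N) : dmap D (edge s kl) (value x k) = value x l.
Proof.
rewrite /value -dmap_comp.
by rewrite -(edge_comp (leq0n k : (@ord0 n <= k)%N) kl (leq0n l)).
Qed.

Definition is_edge (k l : 'I_n.+1) (f : morphism) := exists kl : (k <= l)%N, f = mor (edge s kl).

Lemma is_edge_uniq k l k' l' f : is_edge k l f -> is_edge k' l' f -> k = k' /\ l = l'.
Proof.
move=> [kl ->] [kl' /(congr1 (@projT1 _ _))/= []] e1 e2.
by split; apply: (@vertex_inj _ _ s).
Qed.

Definition weight (j : I) t : R := \sum_k (if `[< vertex s k = j >] then coord t k else 0).

(** Being a minimum, it vanishes as soon as one end of the edge has no weight, which makes it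
compatible with faces. Its support is the set of edges of the smallest cell of a point. *)
Definition edge_weight (f : morphism) t : R :=
  \sum_k \sum_l (if `[< is_edge k l f >] then Num.min (coord t k) (coord t l) else 0).

(** The Kuratowski image of the value at each vertex, scaled by the weight of the vertex. *)
Definition weighted_dist (v : point) x t : R := \sum_k coord t k * fiber_dist (pnt (value x k)) v.

Lemma weight_vertex t k : weight (vertex s k) t = coord t k.
Proof.
rewrite /weight (bigD1 k)//= asboolT// big1 ?addr0// => l lk.
by rewrite asboolF// => /vertex_inj e; move: lk; rewrite e eqxx.
Qed.

Lemma weight_off t j : (forall k, vertex s k <> j) -> weight j t = 0.
Proof. by move=> h; rewrite /weight big1// => k _; rewrite asboolF//; exact: h. Qed.

Lemma weight_case t j : (exists2 k, vertex s k = j & weight j t = coord t k) \/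
  ((forall k, vertex s k <> j) /\ weight j t = 0).
Proof.
have [[k kj]|h] := pselect (exists k, vertex s k = j).
  by left; exists k => //; rewrite -kj weight_vertex.
by right; split; [|apply: weight_off] => k kj; apply: h; exists k.
Qed.

Lemma edge_weight_edge t (k l : 'I_n.+1) (kl : (k <= l)%N) : edge_weight (mor (edge s kl)) t = Num.min (coord t k) (coord t l).
Proof.
have e : is_edge k l (mor (edge s kl)) by exists kl.
rewrite /edge_weight (bigD1 k)//= (bigD1 l)//= asboolT// big1 ?addr0 => [|l' ll']; last first.
  by rewrite asboolF// => /(is_edge_uniq e)[_ e']; move: ll'; rewrite e' eqxx.
rewrite big1 ?addr0// => k' kk'; rewrite big1// => l' _.
by rewrite asboolF// => /(is_edge_uniq e)[e' _]; move: kk'; rewrite e' eqxx.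
Qed.

Lemma edge_weight_case t f :
  (exists (k l : 'I_n.+1) (kl : (k <= l)%N), f = mor (edge s kl) /\ edge_weight f t = Num.min (coord t k) (coord t l)) \/
  ((forall k l, ~ is_edge k l f) /\ edge_weight f t = 0).
Proof.
have [[k [l [kl fE]]]|h] := pselect (exists k l, is_edge k l f).
  by left; exists k, l, kl; split=> //; rewrite fE edge_weight_edge.
right; split=> [k l|]; first by move=> kl; apply: h; exists k, l.
rewrite /edge_weight big1// => k _; rewrite big1// => l _.
by rewrite asboolF// => kl; apply: h; exists k, l.
Qed.

Lemma weighted_dist_vertex x t k (y : D (vertex s k)) :
  weighted_dist (pnt y) x t = coord t k * dD (value x k) y.
Proof.
rewrite /weighted_dist (bigD1 k)//= fiber_dist_same big1 ?addr0// => l lk.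
by rewrite fiber_dist_neq ?mulr0// => /vertex_inj e; move: lk; rewrite e eqxx.
Qed.

Lemma weighted_dist_off x t v : (forall k, vertex s k <> projT1 v) -> weighted_dist v x t = 0.
Proof. by move=> h; rewrite /weighted_dist big1// => k _; rewrite fiber_dist_neq ?mulr0 //; exact: h. Qed.

Lemma weight01 j t : 0 <= weight j t <= 1.
Proof.
have [[k _ ->]|[_ ->]] := weight_case t j; last by rewrite lexx ler01.
by rewrite coord_ge0 coord_le1.
Qed.

Lemma edge_weight01 f t : 0 <= edge_weight f t <= 1.
Proof.
have [[k [l [kl [_ ->]]]]|[_ ->]] := edge_weight_case t f; last by rewrite lexx ler01.
by rewrite le_min !coord_ge0 ge_min coord_le1.
Qed.

Lemma weighted_dist01 v x t : 0 <= weighted_dist v x t <= 1.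
Proof.
rewrite /weighted_dist sumr_ge0 => [|k _]; last first.
  by rewrite mulr_ge0 ?coord_ge0//; case/andP: (fiber_dist01 (pnt (value x k)) v).
rewrite -(coord_sum t); apply: ler_sum => k _.
by rewrite ler_piMr ?coord_ge0//; case/andP: (fiber_dist01 (pnt (value x k)) v).
Qed.

End Cell.

Definition coordinate := ((I + morphism) + point)%type.

Definition cell_coord n (s : chain I n) (co : coordinate) (x : D (vertex s ord0)) (t : simplex R n) : R :=
  match co with
  | inl (inl j) => weight s j t
  | inl (inr f) => edge_weight s f t
  | inr v => weighted_dist v x t
  end.

Lemma cell_coord01 n (s : chain I n) co x t : 0 <= @cell_coord n s co x t <= 1.
Proof.
by case: co => [[j|f]|v] /=; [exact: weight01|exact: edge_weight01|exact: weighted_dist01].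
Qed.

Lemma cell_coord_glue n (s : chain I n.+1) (k : 'I_n.+2) (x : D (vertex s ord0)) (t : simplex R n) co :
  cell_coord co x (coface k t) = @cell_coord n (face k s) co (value x (lift k ord0)) t.
Proof.
have mint0 (y : R) : 0 <= y -> Num.min 0 y = 0 by move=> ?; rewrite min_l.
have mintr0 (y : R) : 0 <= y -> Num.min y 0 = 0 by move=> ?; rewrite min_r.
case: co => [[j|f]|v] /=.
- rewrite /weight (bigD1_ord k)//= coord_coface_eq0 if_same add0r.
  by apply: eq_bigr => i _; rewrite coord_coface.
- rewrite /edge_weight (bigD1_ord k)//= big1 ?add0r => [|l _]; last first.
    by rewrite coord_coface_eq0 mint0 ?coord_ge0// if_same.
  apply: eq_bigr => i _; rewrite (bigD1_ord k)//= coord_coface_eq0 mintr0 ?coord_ge0// if_same add0r.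
  apply: eq_bigr => l _; rewrite !coord_coface.
  suff -> : `[< is_edge s (lift k i) (lift k l) f >] = `[< is_edge (face k s) i l f >] by [].
  apply/asboolP/asboolP => -[kl ->].
    have il : (i <= l)%N by move: kl; rewrite /= leq_bump2.
    by exists il; rewrite (bool_irrelevance kl (lift_le k il)).
  by exists (lift_le k kl).
- rewrite /weighted_dist (bigD1_ord k)//= coord_coface_eq0 mul0r add0r.
  apply: eq_bigr => i _; rewrite coord_coface; congr (_ * fiber_dist (pnt _) _).
  rewrite -(value_edge x (lift_le k (leq0n i : (@ord0 n <= i)%N))).
  by rewrite /value.
Qed.

Lemma cell_coord_ucont n (s : chain I n) (e : R) : 0 < e -> exists2 de : R, 0 < de &
  forall x x' t t', dD x x' < de -> sdist t t' < de ->
  forall co, `|@cell_coord n s co x t - cell_coord co x' t'| <= e.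
Proof.
move=> e0; pose N : R := n.+1%:R; have N0 : 0 < N by rewrite ltr0n.
have N1 : 1 <= N by rewrite ler1n.
have e1 : 0 < e / 2 / N by rewrite !divr_gt0.
have [|k|d1 d10 d1P] := @finType_uniform_pos R 'I_n.+1 (fun k de =>
    forall x x' : D (vertex s ord0), dD x x' < de -> dD (value x k) (value x' k) < e / 2 / N).
- by move=> k de de' dd h x x' xx; apply: h; exact: lt_le_trans dd.
- have /(unif_continuous_metric _ (dDm _) (dDm _))/(_ _ e1)[de de0 deP] :=
    @dmap_unif_continuous _ D _ _ (edge s (leq0n k : (@ord0 n <= k)%N)).
  by exists de => // x x' xx; exact: deP.
pose d2 := e / 2 / (N * N).
have d20 : 0 < d2 by rewrite !divr_gt0// mulr_gt0.
exists (Num.min d1 d2); first by rewrite lt_min d10.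
move=> x x' t t'; rewrite !lt_min => /andP[xx _] /andP[_ tt] co.
have ct k : `|coord t k - coord t' k| <= d2 by apply: le_trans (coord_lip t t' k) (ltW tt).
have sumN (c : R) : \sum_(k < n.+1) c = N * c by rewrite sumr_const card_ord mulr_natl.
have NNd : N * (N * d2) = e / 2 by rewrite mulrA mulrC divfK// gt_eqF// mulr_gt0.
have Nd : N * d2 <= e / 2 by rewrite -NNd ler_peMl// mulr_ge0// ltW.
case: co => [[j|f]|v] /=.
- rewrite /weight -sumrB; apply: le_trans (ler_norm_sum _ _ _) _.
  apply: (@le_trans _ _ (\sum_(k < n.+1) d2)); last by rewrite sumN; lra.
  by apply: ler_sum => k _; case: asboolP => // _; rewrite subrr normr0 ltW.
- rewrite /edge_weight -sumrB; apply: le_trans (ler_norm_sum _ _ _) _.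
  apply: (@le_trans _ _ (\sum_(k < n.+1) \sum_(l < n.+1) d2)); last first.
    by under eq_bigr do rewrite sumN; rewrite sumN; lra.
  apply: ler_sum => k _; rewrite -sumrB; apply: le_trans (ler_norm_sum _ _ _) _.
  apply: ler_sum => l _; case: asboolP => _; last by rewrite subrr normr0 ltW.
  have /absle := ct k; have /absle := ct l.
  by case: (leP (coord t k) (coord t l)); case: (leP (coord t' k) (coord t' l)) => *; apply/absle; lra.
- rewrite /weighted_dist -sumrB; apply: le_trans (ler_norm_sum _ _ _) _.
  apply: (@le_trans _ _ (\sum_(k < n.+1) (d2 + e / 2 / N))); last first.
    rewrite sumN mulrDr; have -> : N * (e / 2 / N) = e / 2 by rewrite mulrC divfK// gt_eqF.
    by lra.
  apply: ler_sum => k _; set g := fiber_dist _ v; set g' := fiber_dist _ v.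
  have /andP[g0 g1] : 0 <= g <= 1 by exact: fiber_dist01.
  have gg : `|g - g'| <= e / 2 / N by apply: le_trans (fiber_dist_lip _ _ _) _; exact/ltW/d1P.
  have -> : coord t k * g - coord t' k * g' = (coord t k - coord t' k) * g + coord t' k * (g - g') by ring.
  apply: le_trans (ler_normD _ _) _; rewrite !normrM; apply: lerD.
    by apply: le_trans (ct k); rewrite ler_piMr// ger0_norm.
  by apply: le_trans gg; rewrite ler_piMl// ger0_norm ?coord_ge0// coord_le1.
Qed.

End Coordinates.

(** * Cells of the homotopy colimit *)

Local Open Scope quotient_scope.

Section Restriction.
Variables (R : realType) (I : finite_category) (D : diagram I).

Definition hcell n (s : chain I n) (x : D (vertex s ord0)) (t : simplex R n) : hocolim R D :=
  \pi_(hocolim R D) (hocolim_cell x t).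

Lemma hcell_surj (p : hocolim R D) : exists n (s : chain I n) x t, p = @hcell n s x t.
Proof.
rewrite -(reprK p); case: (repr p) => -[n s] [x t].
by exists n, s, x, t.
Qed.

Lemma hcell_eqP n (s : chain I n) x t n' (s' : chain I n') x' t' :
  @hcell n s x t = @hcell n' s' x' t' <->
  clos_refl_sym_trans _ (@hocolim_glue R I D) (hocolim_cell x t) (hocolim_cell x' t').
Proof.
split=> [/eqquotP|h]; first by move=> /asboolP.
by apply/eqquotP/asboolP.
Qed.

Lemma hcell_coface n (s : chain I n.+1) (k : 'I_n.+2) x (t : simplex R n) :
  hcell x (coface k t) = @hcell n (face k s) (value x (lift k ord0)) t.
Proof. by apply/hcell_eqP; apply: rst_step; exact: HocolimGlue. Qed.

(** [T] is the image of [t] in the face spanned by the vertices [al i]. *)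
Definition pushed n m (al : 'I_m.+1 -> 'I_n.+1) (t : simplex R m) (T : simplex R n) :=
  (forall i, coord T (al i) = coord t i) /\ (forall k, (forall i, al i <> k) -> coord T k = 0).

Lemma pushed_exists n m (al : 'I_m.+1 -> 'I_n.+1) (t : simplex R m) : injective al ->
  exists T, pushed al t T.
Proof.
move=> inj; pose g k := \sum_(i | al i == k) coord t i.
have [||T TP] := @make_simplex R n g.
- by move=> k; apply: sumr_ge0 => i _; exact: coord_ge0.
- by rewrite -(coord_sum t) [RHS](partition_big al xpredT).
exists T; split=> [i|k h]; rewrite TP /g.
  by rewrite (bigD1 i)//= big1 ?addr0// => j /andP[/eqP/inj-> /eqP].
by rewrite big1// => i /eqP e; have := h i e.
Qed.

Lemma strictly_mono_bij n (al : 'I_n.+1 -> 'I_n.+1) : strictly_mono al -> forall i, al i = i.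
Proof.
move=> h; have ge (i : 'I_n.+1) : (i <= al i)%N.
  case: i => i; elim: i => [//|i IH] lt; have lt' := ltnW lt.
  apply: leq_ltn_trans (IH lt') _; apply: h; exact: ltnSn.
have le m (i : 'I_n.+1) : (i + m = n -> al i <= i)%N.
  elim: m i => [|m IH] i e; first by rewrite addn0 in e; rewrite e leq_ord.
  have lt : (i.+1 < n.+1)%N by lia.
  have := IH (Ordinal lt); rewrite /= addSnnS => /(_ e) h1.
  by rewrite -ltnS; apply: leq_trans h1; apply: h => /=.
move=> i; apply: val_inj; apply/eqP; rewrite eqn_leq ge andbT.
by apply: (le (n - i)%N); rewrite subnKC// leq_ord.
Qed.

Lemma restriction_id n (F : ('I_n.+1 -> I) -> Type) (s : chain I n) (al : 'I_n.+1 -> 'I_n.+1) h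
    (x : forall al : 'I_n.+1 -> 'I_n.+1, F (fun i => vertex s (al i))) :
  (forall i, al i = i) ->
  existT (fun c : chain I n => F (vertex c)) (@restriction _ _ _ al h s) (x al) =
  existT (fun c : chain I n => F (vertex c)) s (x id).
Proof.
move=> /funext E; subst al; case: s x => -[v e p q] r x.
apply: (@chain_pair_eq I n F v _ e _ _ _ p q r (x id)) => k l kl /=.
by congr e; exact: bool_irrelevance.
Qed.

Lemma value_face n (s : chain I n.+1) (k : 'I_n.+2) (x : D (vertex s ord0)) i :
  value (n := n) (s := face k s) (value x (lift k ord0)) i = value x (lift k i).
Proof. by rewrite -(value_edge x (lift_le k (leq0n i : (@ord0 n <= i)%N))). Qed.

(** The vertices missed by [al] are omitted one at a time, by [hcell_coface]. *)
Lemma hcell_restriction n m (al : 'I_m.+1 -> 'I_n.+1) (h : strictly_mono al) (s : chain I n)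
    (x : D (vertex s ord0)) t T : pushed al t T ->
  hcell x T = @hcell m (restriction h s) (value x (al ord0)) t.
Proof.
pose F m (v : 'I_m.+1 -> I) := dob D (v ord0).
pose G m t (u : {c : chain I m & F m (vertex c)}) := @hcell m (projT1 u) (projT2 u) t.
elim: n m al h s x t T => [|n IH] m al h s x t T [T1 T0].
  have m0 : m = 0%N.
    have := leq_card al (strictly_mono_inj h); rewrite !card_ord; by case: (m).
  subst m; have al0 : forall i, al i = i by move=> i; rewrite (ord1 i) (ord1 (al _)).
  have tT : T = t by apply: simplex_ext => i; rewrite -T1 al0.
  have := @restriction_id _ (F 0%N) s al h (fun al => value x (al ord0)) al0.
  by move=> /(congr1 (G 0%N t)); rewrite /G /= value0 tT => <-.
have [[k kal]|surj] := pselect (exists k, forall i, al i <> k).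
  have [T' TE] := on_face (T0 k kal).
  have /choice[al' al'P] : forall i, exists i', al i = lift k i'.
    by move=> i; case: (unliftP k (al i)) => [i' ->|/kal//]; exists i'.
  have h' : strictly_mono al'.
    by move=> i j /h; rewrite !al'P /= !ltnNge leq_bump2.
  have := IH m al' h' (face k s) (value x (lift k ord0)) t T'.
  rewrite -hcell_coface -TE => ->; last first.
    split=> [i|l lal]; first by rewrite -T1 al'P TE coord_coface.
    by rewrite -(coord_coface k) -TE; apply: T0 => i; rewrite al'P => /lift_inj/lal.
  have hl := strictly_mono_comp (strictly_mono_lift k) h'.
  rewrite value_face.
  have e1 := @restriction_faceE _ _ _ (F m) s k al' h' hl (value x (lift k (al' ord0))).
  have e2 := @restriction_eq _ _ _ (F m) s al (lift k \o al') h hl (fun al => value x (al ord0)) al'P.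
  exact: (congr1 (G m t) (etrans e1 (esym e2))).
have mn : m = n.+1.
  apply/eqP; rewrite eqn_leq -!(ltnS m) -(ltnS n.+1).
  have := leq_card al (strictly_mono_inj h); rewrite !card_ord => ->/=.
  have /choice[be beP] : forall k, exists i, al i = k.
    by move=> k; apply: contrapT => nk; apply: surj; exists k => i ik; apply: nk; exists i.
  have : injective be by move=> k l kl; rewrite -(beP k) kl beP.
  by move=> /leq_card; rewrite !card_ord.
subst m; have ali := strictly_mono_bij h.
have tT : T = t by apply: simplex_ext => i; rewrite -T1 ali.
have := @restriction_id _ (F n.+1) s al h (fun al => value x (al ord0)) ali.
by move=> /(congr1 (G n.+1 t)); rewrite /G /= value0 tT => <-.
Qed.

Lemma subset_enumeration n (K : {set 'I_n.+1}) : K != finset.set0 ->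
  exists m (al : 'I_m.+1 -> 'I_n.+1), strictly_mono al /\ forall k, k \in K <-> exists i, al i = k.
Proof.
move=> K0; pose l := enum K.
have sz : (0 < size l)%N by rewrite -cardE card_gt0.
exists (size l).-1, (fun i => nth ord0 l i).
have lt (i : 'I_(size l).-1.+1) : (i < size l)%N by have := ltn_ord i; lia.
have srt : sorted ltn (map val l).
  apply: (@subseq_sorted _ ltn ltn_trans _ (map val (enum 'I_n.+1))).
    apply: map_subseq; rewrite /l {1}/enum_mem -enumT; exact: filter_subseq.
  by rewrite val_enum_ord iota_ltn_sorted.
split=> [i j ij|k].
  have := sorted_ltn_nth ltn_trans 0%N srt (i : nat) (j : nat).
  rewrite !inE size_map !lt => /(_ isT isT ij).
  by rewrite !(nth_map ord0).
rewrite -(mem_enum K) -/l; split=> [kl|[i <-]]; last by rewrite mem_nth.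
have ki : (index k l < (size l).-1.+1)%N by rewrite prednK// index_mem.
by exists (Ordinal ki); rewrite nth_index.
Qed.

End Restriction.

(** * Points with close coordinates *)

Section ChainExt.

Lemma existT_inj2 (A : Type) (F : A -> Type) (a : A) (x y : F a) : existT F a x = existT F a y -> x = y.
Proof.
move=> e; have := projT2_eq e; rewrite (Prop_irrelevance (projT1_eq e) erefl); exact.
Qed.

Lemma chain_ext (C : finite_category) n (s s' : chain C n) :
  (forall (k l : 'I_n.+1) (kl : (k <= l)%N), mor (edge s kl) = mor (edge s' kl)) -> s = s'.
Proof.
case: s s' => -[v e p q] r [[v' e' p' q'] r'] /= h.
have vv : v = v'.
  by apply/funext => k; have /(congr1 (@projT1 _ _))/= [] := h k k (leqnn k).
subst v'; pose F (w : 'I_n.+1 -> C) := unit.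
have := @chain_pair_eq C n F v e e' p q r p' q' r' tt.
move=> /(_ _)/(congr1 (@projT1 _ _)); apply => k l kl; exact: existT_inj2 (h k l kl).
Qed.

End ChainExt.

Section Embedding.
Variables (R : realType) (I : finite_category) (D : diagram I).
Variable dD : forall i : I, D i -> D i -> R.
Hypotheses (dDm : forall i, metrizes (@dD i)) (dD1 : forall i x y, @dD i x y <= 1).

Local Notation coordinate := (coordinate D).

Definition hcoord (co : coordinate) (p : hocolim R D) : R :=
  let c := repr p in
  @cell_coord R I D dD _ (projT2 (projT1 c)) co (projT2 c).1 (projT2 c).2.

Lemma hcoord_hcell n (s : chain I n) x t co : hcoord co (@hcell R I D n s x t) = cell_coord dD co x t.
Proof.
pose g (c : hocolim_sum R D) : R := @cell_coord R I D dD _ (projT2 (projT1 c)) co (projT2 c).1 (projT2 c).2.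
rewrite -[RHS]/(g (hocolim_cell x t)) -[LHS]/(g (repr (@hcell R I D n s x t))).
have : clos_refl_sym_trans _ (@hocolim_glue R I D) (repr (hcell x t)) (hocolim_cell x t).
  have : hcell x t = \pi_(hocolim R D) (repr (hcell x t)) by rewrite reprK.
  by move=> /esym/eqquotP/asboolP.
elim=> {n s x t} [c c' []|//|c c' _ -> //|c c' c'' _ -> _ -> //].
by move=> n s k x t; exact: cell_coord_glue.
Qed.

Lemma hcoord01 co p : 0 <= hcoord co p <= 1.
Proof. exact: cell_coord01. Qed.

Lemma transport_dist n (c c' : chain I n) (E : c' = c) (y : D (vertex c ord0)) (y' : D (vertex c' ord0)) :
  exists y2 : D (vertex c ord0), (forall t : simplex R n, hcell y' t = hcell y2 t) /\
    fiber_dist dD (pnt y') (pnt y) = dD y2 y.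
Proof. by subst c'; exists y'; split=> //; exact: fiber_dist_same. Qed.

(** Two points with close coordinates are close to points of a common cell:
forgetting the vertices of small weight of the first point leaves a chain that
is also formed by vertices of the second one, and its edges are edges of both
chains. *)
Lemma common_cell n (s : chain I n) x t n' (s' : chain I n') x' t' (K : {set 'I_n.+1}) (de rho : R) :
  0 <= de -> K != finset.set0 -> (forall k, k \in K -> de < coord t k) ->
  \sum_(k | k \notin K) coord t k <= rho ->
  (forall co, `|cell_coord dD co x t - @cell_coord R I D dD n' s' co x' t'| <= de) ->
  exists m (c : chain I m) (y y' : D (vertex c ord0)) (u : simplex R m) (T : simplex R n) (T' : simplex R n'),
    [/\ @hcell R I D n s x T = hcell y u, @hcell R I D n' s' x' T' = hcell y' u,
      sdist t T <= rho, sdist t' T' <= rho + de &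
      exists2 k, k \in K & dD y y' * (coord t k - de) <= de].
Proof.
move=> de0 K0 Kt Krho cc.
have [m [al [hal alK]]] := subset_enumeration K0.
have alKi i : al i \in K by apply/alK; exists i.
have cw j : `|weight s j t - weight s' j t'| <= de by exact: (cc (inl (inl j))).
have ce f : `|edge_weight s f t - edge_weight s' f t'| <= de by exact: (cc (inl (inr f))).
have cv v : `|weighted_dist dD v x t - weighted_dist dD v x' t'| <= de by exact: (cc (inr v)).
have common_edge (i j : 'I_m.+1) (ij : (al i <= al j)%N) : exists (k l : 'I_n'.+1) (kl : (k <= l)%N),
    mor (edge s ij) = mor (edge s' kl).
  have := ce (mor (edge s ij)); rewrite edge_weight_edge.
  have [[k [l [kl [e _]]]] _|[_ ->]] := edge_weight_case s' t' (mor (edge s ij)).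
    by exists k, l, kl.
  rewrite subr0 ger0_norm ?le_min ?coord_ge0// ge_min.
  by have := Kt _ (alKi i); have := Kt _ (alKi j); rewrite !ltNge => /negPf-> /negPf->.
have /choice[be beP] : forall i, exists k, vertex s' k = vertex s (al i).
  move=> i; have [k [l [kl /(congr1 (@projT1 _ _))/= [e _]]]] := common_edge i i (leqnn _).
  by exists k.
have hbe : strictly_mono be.
  move=> i j ij; have ij' := ltnW (hal i j ij).
  have [k [l [kl /(congr1 (@projT1 _ _))/= [e e']]]] := common_edge i j ij'.
  have ki : k = be i by apply: (@vertex_inj _ _ s'); rewrite beP e.
  have lj : l = be j by apply: (@vertex_inj _ _ s'); rewrite beP e'.
  rewrite ltn_neqAle -{2}ki -{2}lj kl andbT; apply/eqP => /val_inj bb.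
  have /vertex_inj aa : vertex s (al i) = vertex s (al j) by rewrite -!beP bb.
  by have := hal i j ij; rewrite aa ltnn.
have E : restriction hbe s' = restriction hal s.
  apply: chain_ext => i j ij /=.
  have aij := strictly_mono_le hal ij.
  have [k [l [kl e]]] := common_edge i j aij.
  have [e1 e2] : vertex s (al i) = vertex s' k /\ vertex s (al j) = vertex s' l.
    by have := congr1 (@projT1 _ _) e => /= -[].
  have ki : k = be i by apply: (@vertex_inj _ _ s'); rewrite beP e1.
  have lj : l = be j by apply: (@vertex_inj _ _ s'); rewrite beP e2.
  subst k l; rewrite (bool_irrelevance (strictly_mono_le hal ij) aij) e.
  by rewrite (bool_irrelevance (strictly_mono_le hbe ij) kl).
(* The common point has the weights of the first one on [K], normalized. *)
pose S := \sum_(i < m.+1) coord t (al i).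
have sumal (g : 'I_n.+1 -> R) : \sum_(k in K) g k = \sum_i g (al i).
  rewrite (reindex_onto al (fun k => odflt ord0 [pick i | al i == k])).
    apply: eq_bigl => i; rewrite alKi /=; case: pickP => [j /eqP/(strictly_mono_inj hal)->|/(_ i)]; by rewrite eqxx.
  move=> k kK; case: pickP => [i /eqP//|nk].
  by have /alK[i ik] := kK; have := nk i; rewrite ik eqxx.
have S1 : S + \sum_(k | k \notin K) coord t k = 1.
  by rewrite /S -(sumal (coord t)) -[RHS](coord_sum t) [RHS](bigID (mem K)).
have S1' : S <= 1.
  by rewrite -S1 lerDl; apply: sumr_ge0 => k _; exact: coord_ge0.
have Spos : 0 < S.
  rewrite /S (bigD1 ord0)//= ltr_pwDl//; first by apply: le_lt_trans de0 _; exact: Kt.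
  by apply: sumr_ge0 => i _; exact: coord_ge0.
have [||u uP] := @make_simplex R m (fun i => coord t (al i) / S).
- by move=> i; rewrite divr_ge0 ?coord_ge0// ltW.
- by rewrite -mulr_suml -/S divff// gt_eqF.
have [T TP] := pushed_exists u (strictly_mono_inj hal).
have [T' TP'] := pushed_exists u (strictly_mono_inj hbe).
have off k : k \notin K -> coord t k <= rho.
  move=> kK; apply: le_trans Krho; rewrite (bigD1 k)//= lerDl.
  by apply: sumr_ge0 => l _; exact: coord_ge0.
have rho0 : 0 <= rho by apply: le_trans Krho; apply: sumr_ge0 => l _; exact: coord_ge0.
have on i : `|coord t (al i) - coord u i| <= rho.
  have e : coord t (al i) = coord u i * S by rewrite uP divfK// gt_eqF.
  have := coord_ge0 u i; have := coord_le1 u i => u1 u0.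
  have h : coord t (al i) - coord u i = - (coord u i * (1 - S)) by rewrite e; ring.
  have c0 : 0 <= 1 - S by lra.
  rewrite h normrN ger0_norm ?mulr_ge0//.
  by apply: (@le_trans _ _ (1 - S)); [rewrite ler_piMl|lra].
pose y := value x (al ord0); pose y' := value x' (be ord0).
have [y2 [y2P y2d]] := transport_dist E y y'.
exists m, (restriction hal s), y, y2, u, T, T'; split.
- exact: hcell_restriction TP.
- by rewrite -y2P; exact: hcell_restriction TP'.
- apply: sdist_le => k; have [kK|kK] := boolP (k \in K).
    by have /alK[i <-] := kK; rewrite TP.1.
  rewrite TP.2 ?subr0 ?ger0_norm ?coord_ge0 ?off// => i ik; by rewrite -ik alKi in kK.
- apply: sdist_le => l; have [[i il]|nl] := pselect (exists i, be i = l).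
    rewrite -il TP'.1; have := cw (vertex s (al i)).
    by rewrite -{2}(beP i) !weight_vertex => /absle ?; have /absle ? := on i; apply/absle; lra.
  rewrite TP'.2 => [|i il]; last by apply: nl; exists i.
  rewrite subr0 ger0_norm ?coord_ge0//; have := cw (vertex s' l); rewrite weight_vertex.
  have [[k kl ->]|[_ ->]] := weight_case s t (vertex s' l); last by move=> /absle; lra.
  have kK : k \notin K.
    apply/negP => /alK[i ik]; apply: nl; exists i; apply: (@vertex_inj _ _ s').
    by rewrite beP ik.
  by have := off k kK => ? /absle; lra.
- exists (al ord0) => //.
  have := cv (pnt y); rewrite weighted_dist_vertex (metricxx _ (dDm _).1) mulr0 sub0r normrN.
  have w0 k : 0 <= coord t' k * fiber_dist dD (pnt (value x' k)) (pnt y).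
    by rewrite mulr_ge0 ?coord_ge0//; case/andP: (fiber_dist01 dDm dD1 (pnt (value x' k)) (pnt y)).
  rewrite ger0_norm; last by apply: sumr_ge0.
  rewrite /weighted_dist (bigD1 (be ord0))//= -/y' y2d => h.
  have h1 : coord t' (be ord0) * dD y2 y <= de.
    by apply: le_trans h; rewrite lerDl; exact: sumr_ge0.
  have := cw (vertex s (al ord0)); rewrite -{2}(beP ord0) !weight_vertex => /absle[_ h2].
  have [_ dC _] := (dDm (vertex (restriction hal s) ord0)).1.
  rewrite dC mulrC; apply: le_trans h1; apply: ler_wpM2r; last by lra.
  exact: metric_ge0 (dDm _).1 _ _.
Qed.

End Embedding.

(** * The metric of the homotopy colimit *)

Section HocolimMetric.
Variables (R : realType) (I : finite_category) (D : diagram I).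
Variable dD : forall i : I, D i -> D i -> R.
Hypotheses (dDm : forall i, metrizes (@dD i)) (dD1 : forall i x y, @dD i x y <= 1).

Local Notation hc := (hcoord dD).

Definition hocolim_dist (p q : hocolim R D) : R := supr (fun co => `|hc co p - hc co q|).

Let coord_dist01 p q co : 0 <= `|hc co p - hc co q| <= 1.
Proof.
rewrite normr_ge0; apply/absle.
have /andP[? ?] := hcoord01 dDm dD1 co p; have /andP[? ?] := hcoord01 dDm dD1 co q; lra.
Qed.

Lemma hocolim_dist_ub co p q : `|hc co p - hc co q| <= hocolim_dist p q.
Proof. by apply: (@supr_ub _ _ (fun co => `|hc co p - hc co q|) 1) => c; case/andP: (coord_dist01 p q c). Qed.

Lemma hocolim_dist_le p q (e : R) : 0 <= e -> (forall co, `|hc co p - hc co q| <= e) -> hocolim_dist p q <= e.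
Proof. exact: supr_le. Qed.

Lemma hocolim_dist_le1 p q : hocolim_dist p q <= 1.
Proof. by apply: hocolim_dist_le => // co; case/andP: (coord_dist01 p q co). Qed.

(** The case of [common_cell] in which no weight is neglected. *)
Lemma hcoord_inj p q : (forall co, hc co p = hc co q) -> p = q.
Proof.
have [n [s [x [t ->]]]] := hcell_surj p; have [n' [s' [x' [t' ->]]]] := hcell_surj q => pq.
pose K := finset (fun k => 0 < coord t k).
have K0 : K != finset.set0.
  apply/negP => /eqP KE; have := coord_sum t; rewrite big1 => [/esym/eqP|k _]; first by rewrite oner_eq0.
  have : k \notin K by rewrite KE inE.
  by rewrite inE -leNgt => tk; apply/eqP; rewrite eq_le tk coord_ge0.
have [k kK|||m [c [y [y' [u [T [T' [e1 e2 tT tT' [k kK yy]]]]]]]]] :=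
    @common_cell R I D dD dDm dD1 n s x t n' s' x' t' K 0 0 (lexx 0) K0.
- by rewrite inE in kK.
- by rewrite big1// => k; rewrite inE -leNgt => tk; apply/eqP; rewrite eq_le tk coord_ge0.
- by move=> co; have := pq co; rewrite !hcoord_hcell => ->; rewrite subrr normr0.
have sd (j : nat) (v w : simplex R j) : sdist v w <= 0 -> v = w.
  move=> h; have [d0 _ _] := sdist_metric R j; apply/d0; apply/eqP.
  by rewrite eq_le h (metric_ge0 (sdist_metric R j)).
rewrite (sd _ _ _ tT) e1; rewrite addr0 in tT'; rewrite (sd _ _ _ tT') e2; congr hcell.
have [d0 _ _] := (dDm (vertex c ord0)).1; apply/d0; apply/eqP.
rewrite eq_le (metric_ge0 (dDm _).1) andbT; move: yy; rewrite subr0 pmulr_lle0//.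
by rewrite inE in kK.
Qed.

Lemma hocolim_dist_metric : is_metric hocolim_dist.
Proof.
have ge0 p q : 0 <= hocolim_dist p q by apply: (supr_ge0 (M := 1)) => co; exact: coord_dist01.
split=> [p q|p q|p q r].
- split=> [h|->]; last first.
    apply/eqP; rewrite eq_le ge0 andbT; apply: hocolim_dist_le => // co.
    by rewrite subrr normr0.
  apply: hcoord_inj => co; apply/subr0_eq/eqP; rewrite -normr_le0.
  by have := hocolim_dist_ub co p q; rewrite h.
- by congr supr; apply/funext => co; rewrite distrC.
- apply: hocolim_dist_le => [|co]; first by rewrite addr_ge0.
  by apply: le_trans (ler_distD (hc co q) _ _) _; apply: lerD; exact: hocolim_dist_ub.
Qed.

Lemma hcell_entourage (B : set (hocolim R D * hocolim R D)) : entourage B ->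
  exists2 eta : R, 0 < eta & forall n (s : chain I n) x x' t t',
    dD x x' < eta -> sdist t t' < eta -> B (@hcell R I D n s x t, @hcell R I D n s x' t').
Proof.
move=> /pi_unif_continuous eB.
have [|||eta eta0 etaP] := @finite_uniform_pos R {n & chain I n} setT
  (fun c eta => forall x x' (t t' : simplex R (projT1 c)), dD x x' < eta -> sdist t t' < eta ->
     B (@hcell R I D _ (projT2 c) x t, @hcell R I D _ (projT2 c) x' t')).
- exact: finite_chains.
- by move=> c e e' ee h x x' t t' h1 h2; apply: h; exact: lt_le_trans ee.
- move=> [n s] _; have [[P Q] [/= Pe Qe] PQ] := eB (existT _ n s).
  have [e1 e10 e1P] := (metrizesP (dDm _) _).1 Pe.
  have [e2 e20 e2P] := (metrizesP (simplex_metrizes R n) _).1 Qe.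
  exists (Num.min e1 e2); first by rewrite lt_min e10.
  move=> x x' t t'; rewrite !lt_min => /andP[xx _] /andP[_ tt].
  have [[[a b] [a' b']] /= ab e] := PQ ((x, x'), (t, t')) (conj (e1P _ _ xx) (e2P _ _ tt)).
  by case: e ab => -> -> -> ->.
by exists eta => // n s x x' t t'; exact: (etaP (existT _ n s)).
Qed.

(** Being uniformly continuous on every cell, the coordinates are uniformly continuous on the
quotient. Conversely, points with close coordinates are joined by three short steps inside
cells: from the first point to one of a common cell, within this cell, and to the second point. *)
Lemma hocolim_metrizes : metrizes hocolim_dist.
Proof.
apply: metrizes_intro; first exact: hocolim_dist_metric.
move=> E; split; last first.
  move=> [e e0 eE]; pose U : set_system (hocolim R D * hocolim R D) :=
    @entourage (metric_space hocolim_dist_metric).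
  have UE : U E by exists e => // -[p q] /= pq; exact: eE.
  exists U; split=> //.
    split.
    - exact: (@entourage_filter (metric_space hocolim_dist_metric)).
    - by move=> A UA [x y] /diagonalP/= <-; exact: (@entourage_refl (metric_space hocolim_dist_metric)).
    - by move=> A UA; exact: (@entourage_inv (metric_space hocolim_dist_metric)).
    - by move=> A UA; exact: (@entourage_split_ex (metric_space hocolim_dist_metric)).
  move=> A [e1 e10 e1A].
  suff h : forall c : {n & chain I n},
      entourage [set xy : (D (vertex (projT2 c) ord0) * simplex R (projT1 c)) *
                          (D (vertex (projT2 c) ord0) * simplex R (projT1 c)) |
        A (@hcell R I D _ (projT2 c) xy.1.1 xy.1.2, @hcell R I D _ (projT2 c) xy.2.1 xy.2.2)].
    by move=> -[n s]; apply: filterS (h (existT _ n s)) => -[[x t] [x' t']].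
  move=> [n s] /=.
  have e20 : 0 < e1 / 2 by rewrite divr_gt0.
  have [de de0 deP] := cell_coord_ucont dDm dD1 s e20.
  have h1 : entourage [set xy : D (vertex s ord0) * D (vertex s ord0) | dD xy.1 xy.2 < de].
    by apply/(metrizesP (dDm _)); exists de.
  have h2 : entourage [set tt : simplex R n * simplex R n | sdist tt.1 tt.2 < de].
    by apply/(metrizesP (simplex_metrizes R n)); exists de.
  apply: filterS (prod_entP h1 h2) => -[[x t] [x' t']] [/= xx tt].
  apply: e1A => /=; apply: (@le_lt_trans _ _ (e1 / 2)); last by lra.
  apply: hocolim_dist_le => [|co]; first exact: ltW.
  rewrite -[X in hc co X]/(@hcell R I D n s x t) -[X in _ - hc co X]/(@hcell R I D n s x' t').
  by rewrite !hcoord_hcell; exact: deP.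
move=> eE; have := entourage_split_ent eE; set B1 := split_ent E => eB1.
have := entourage_split_ent eB1; set B := split_ent B1 => eB.
have [eta eta0 etaP] := hcell_entourage (filterI eB (entourage_inv eB)).
have eta40 : 0 < eta / 4 by lra.
have [|||th th0 thP] := @finite_uniform_pos R {n & chain I n} setT
  (fun c th => (projT1 c).+1%:R * th <= Num.min (1 / 2) (eta / 4)).
- exact: finite_chains.
- by move=> [n s] e e' ee /=; apply: le_trans; rewrite ler_wpM2l.
- move=> [n s] _ /=; exists (Num.min (1 / 2) (eta / 4) / n.+1%:R).
    by rewrite divr_gt0// lt_min eta40 andbT; lra.
  by rewrite mulrC divfK ?lexx// pnatr_eq0.
(* The weight at the vertex given by [common_cell] exceeds [de] by at least [th / 2], so that
the values there are at distance less than [eta]. *)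
pose de := Num.min (th / 2) (th * eta / 4).
have de0 : 0 < de by rewrite lt_min !divr_gt0// mulr_gt0.
have [dth deth] : de <= th / 2 /\ de <= th * eta / 4 by rewrite !ge_min !lexx orbT.
have the4 n (s : chain I n) : n.+1%:R * th <= eta / 4 /\ n.+1%:R * th <= 1 / 2.
  by have := thP (existT _ n s) Logic.I; rewrite /= le_min => /andP[].
exists de => // p q; have [n [s [x [t ->]]]] := hcell_surj p.
have [n' [s' [x' [t' ->]]]] := hcell_surj q => pq.
pose K := finset (fun k => th <= coord t k).
have Ksum : \sum_(k | k \notin K) coord t k <= n.+1%:R * th.
  apply: (@le_trans _ _ (\sum_(k < n.+1) th)); last by rewrite sumr_const card_ord mulr_natl.
  rewrite [leRHS](bigID (fun k => k \notin K))/=.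
  apply: ler_wpDr; first by apply: sumr_ge0 => k _; exact: ltW.
  by apply: ler_sum => k; rewrite inE -ltNge => /ltW.
have [h1 h2] := the4 n s.
have K0 : K != finset.set0.
  apply/negP => /eqP KE; move: Ksum; rewrite (eq_bigl xpredT) ?coord_sum; first by lra.
  by move=> k; rewrite KE inE.
have [k kK||m [c [y [y' [u [T [T' [e1 e2 tT tT' [k kK yy]]]]]]]]] :=
    @common_cell R I D dD dDm dD1 n s x t n' s' x' t' K de (n.+1%:R * th) (ltW de0) K0 _ Ksum.
- by rewrite inE in kK; lra.
- move=> co; have := hocolim_dist_ub co (hcell x t) (hcell x' t'); rewrite !hcoord_hcell => h.
  by apply: (le_trans h); exact: ltW.
have th1 : th <= 1 / 2.
  have N1 : 1 <= n.+1%:R :> R by rewrite ler1n.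
  by have := ler_wpM2r (ltW th0) N1; lra.
have yy' : dD y y' < eta.
  rewrite inE in kK; have : dD y y' * (th / 2) <= de.
    apply: le_trans yy; apply: ler_wpM2l; first exact: metric_ge0 (dDm _).1 _ _.
    by lra.
  move=> h; have pth : 0 < th * eta by rewrite mulr_gt0.
  have {}h : dD y y' * (th / 2) < eta * (th / 2) by lra.
  by move: h; rewrite ltr_pM2r//; lra.
have dxx i (z : D i) : dD z z < eta by rewrite (metricxx _ (dDm _).1).
have suu j (v : simplex R j) : sdist v v < eta by rewrite (metricxx _ (sdist_metric R j)).
apply: (entourage_split (hcell x T) eE).
  apply: (entourage_split (hcell x t) eB1); first exact: entourage_refl.
  have [] := etaP n s x x t T (dxx _ _) _ => //; lra.
rewrite e1; apply: (entourage_split (hcell y' u) eB1).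
  by have [] := etaP m c y y' u u yy' (suu _ _).
rewrite -e2.
have [|_] := etaP n' s' x' x' t' T' (dxx _ _) => //.
by apply: (le_lt_trans tT'); nra.
Qed.

End HocolimMetric.

(** * Points with given coordinates *)

Section Objects.
Variable I : finite_category.

Lemma finite_objects : exists L : seq {classic I}, uniq L /\ forall j, j \in L.
Proof.
have : finite_set [set: {classic I}].
  apply: sub_finite_set (finite_image (fun c : {n & chain I n} => vertex (projT2 c) ord0 : {classic I}) (finite_chains I)).
  move=> j _; suff [c <-] : exists c : chain I 0, vertex c ord0 = j by exists (existT _ 0%N c).
  unshelve eexists.
    unshelve eapply Chain.
      by apply: (@Nerve I 0 (fun=> j) (fun k l _ => idm (j : I))) => // *; rewrite comp_idl.
    by move=> k l kl lk; have := ltn_ord l; rewrite lk.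
  by [].
move=> /finite_seqP[l lE]; exists (undup l); split; first exact: undup_uniq.
by move=> j; rewrite mem_undup; have : [set: {classic I}] j by []; rewrite lE.
Qed.

End Objects.

Section PointCoordinates.
Variables (R : realType) (I : finite_category) (D : diagram I).
Variable dD : forall i : I, D i -> D i -> R.
Hypotheses (dDm : forall i, metrizes (@dD i)) (dD1 : forall i x y, @dD i x y <= 1).

Definition pweight (j : I) (p : hocolim R D) : R := hcoord dD (inl (inl j)) p.
Definition pedge (i j : I) (f : hom i j) (p : hocolim R D) : R := hcoord dD (inl (inr (mor f))) p.
Definition pdist (v : point D) (p : hocolim R D) : R := hcoord dD (inr v) p.

(** The value of a point at an object of positive weight: the weighted distances determine it. *)
Definition is_value (j : I) (p : hocolim R D) (y : D j) :=
  0 < pweight j p /\ forall q : D j, pdist (pnt q) p = pweight j p * dD y q.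

Lemma pweight_hcell j n (s : chain I n) x t : pweight j (@hcell R I D n s x t) = weight s j t.
Proof. by rewrite /pweight hcoord_hcell. Qed.
Lemma pedge_hcell (i j : I) (f : hom i j) n (s : chain I n) x t :
  pedge f (@hcell R I D n s x t) = edge_weight s (mor f) t.
Proof. by rewrite /pedge hcoord_hcell. Qed.
Lemma pdist_hcell v n (s : chain I n) x t : pdist v (@hcell R I D n s x t) = weighted_dist dD v x t.
Proof. by rewrite /pdist hcoord_hcell. Qed.

Lemma pweight_vertex j n (s : chain I n) x t : 0 < pweight j (@hcell R I D n s x t) ->
  exists2 k, vertex s k = j & 0 < coord t k.
Proof.
rewrite pweight_hcell; have [[k kj ->] k0|[_ ->]] := weight_case s t j; first by exists k.
by rewrite ltxx.
Qed.

Lemma is_value_vertex n (s : chain I n) x t k : 0 < coord t k ->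
  is_value (@hcell R I D n s x t) (value x k).
Proof.
by move=> tk; split=> [|q]; rewrite pweight_hcell weight_vertex// pdist_hcell weighted_dist_vertex.
Qed.

Lemma is_value_exists j p : 0 < pweight j p -> exists y, @is_value j p y.
Proof.
have [n [s [x [t ->]]]] := hcell_surj p => /pweight_vertex[k kj k0]; subst j.
by exists (value x k); exact: is_value_vertex.
Qed.

Lemma is_value_uniq j p y y' : @is_value j p y -> @is_value j p y' -> y = y'.
Proof.
move=> [w0 h] [_ h']; have [d0 dC _] := (dDm j).1; apply/d0.
have := h y'; rewrite h' (metricxx _ (dDm j).1) mulr0 => /esym/eqP.
by rewrite mulf_eq0 gt_eqF//= => /eqP.
Qed.

Lemma pedge_vertex (i j : I) (f : hom i j) n (s : chain I n) x t : 0 < pedge f (@hcell R I D n s x t) ->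
  exists k l : 'I_n.+1, [/\ vertex s k = i, vertex s l = j, 0 < coord t k & 0 < coord t l].
Proof.
rewrite pedge_hcell; have [[k [l [kl [e ->]]]]|[_ ->]] := edge_weight_case s t (mor f); last by rewrite ltxx.
rewrite lt_min => /andP[tk tl]; exists k, l.
by have /= [-> ->] := congr1 (@projT1 _ _) e.
Qed.

Lemma pedge_edge n (s : chain I n) x t (k l : 'I_n.+1) (f : hom (vertex s k) (vertex s l)) :
  0 < pedge f (@hcell R I D n s x t) -> exists kl : (k <= l)%N, f = edge s kl.
Proof.
rewrite pedge_hcell; have [[k' [l' [kl [e ->]]]]|[_ ->]] := edge_weight_case s t (mor f); last by rewrite ltxx.
move=> _; have /= [e1 e2] := congr1 (@projT1 _ _) e.
have ek := vertex_inj e1; have el := vertex_inj e2; subst k' l'.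
by exists kl; exact: (@existT_inj2 _ (fun ab : I * I => hom ab.1 ab.2) (vertex s k, vertex s l)) e.
Qed.

Lemma pedge_min (i j : I) (f : hom i j) p : 0 < pedge f p -> pedge f p = Num.min (pweight i p) (pweight j p).
Proof.
have [n [s [x [t ->]]]] := hcell_surj p => f0; have [k [l [ki lj _ _]]] := pedge_vertex f0.
subst i j; have [kl fE] := pedge_edge f0; subst f.
by rewrite pedge_hcell !pweight_hcell edge_weight_edge !weight_vertex.
Qed.

Lemma pedge_value (i j : I) (f : hom i j) p y : 0 < pedge f p -> is_value p y -> is_value p (dmap D f y).
Proof.
have [n [s [x [t ->]]]] := hcell_surj p => f0 yv; have [k [l [ki lj k0 l0]]] := pedge_vertex f0.
subst i j; have [kl fE] := pedge_edge f0; subst f.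
rewrite (is_value_uniq yv (is_value_vertex x k0)) value_edge; exact: is_value_vertex.
Qed.

Lemma pedge_uniq (i j : I) (f g : hom i j) p : 0 < pedge f p -> 0 < pedge g p -> f = g.
Proof.
have [n [s [x [t ->]]]] := hcell_surj p => f0 g0; have [k [l [ki lj k0 l0]]] := pedge_vertex f0.
subst i j; have [kl ->] := pedge_edge f0; have [kl' ->] := pedge_edge g0.
by congr edge; exact: bool_irrelevance.
Qed.

Lemma pedge_comp (i j k : I) (f : hom i j) (g : hom j k) (h : hom i k) p :
  0 < pedge f p -> 0 < pedge g p -> 0 < pedge h p -> h = comp g f.
Proof.
have [n [s [x [t ->]]]] := hcell_surj p => f0 g0 h0; have [a [b [ai bj _ _]]] := pedge_vertex f0.
have [b' [c [bj' ck _ _]]] := pedge_vertex g0; subst i j k.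
have [ab ->] := pedge_edge f0; have [bc ->] := pedge_edge g0; have [ac ->] := pedge_edge h0.
exact: edge_comp.
Qed.

Lemma pedge_total (i j : I) p : 0 < pweight i p -> 0 < pweight j p ->
  (exists f : hom i j, 0 < pedge f p) \/ (exists f : hom j i, 0 < pedge f p).
Proof.
have [n [s [x [t ->]]]] := hcell_surj p => /pweight_vertex[k ki k0] /pweight_vertex[l lj l0]; subst i j.
case: (leqP k l) => [kl|/ltnW lk]; [left; exists (edge s kl)|right; exists (edge s lk)];
  by rewrite pedge_hcell edge_weight_edge lt_min k0 l0.
Qed.

Lemma sum_vertices (L : seq {classic I}) n (s : chain I n) (T : I -> R) : uniq L -> (forall j, j \in L) ->
  (forall j, (forall k, vertex s k <> j) -> T j = 0) ->
  \sum_(j <- L) T j = \sum_k T (vertex s k).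
Proof.
move=> uL mL T0; pose V := [seq (vertex s k : {classic I}) | k <- enum 'I_n.+1].
have uV : uniq V by rewrite map_inj_uniq ?enum_uniq//; exact: vertex_inj.
transitivity (\sum_(j <- V) T j); last by rewrite big_map big_enum.
rewrite (bigID (mem V))/= [X in _ + X]big1 ?addr0 => [|j jV]; last first.
  by apply: T0 => k kj; case/negP: jV; rewrite -kj; apply: map_f; rewrite mem_enum.
rewrite -big_filter; apply: perm_big; apply: uniq_perm => [||j]; rewrite ?filter_uniq//.
by rewrite mem_filter mL andbT.
Qed.

Lemma sum_pweight (L : seq {classic I}) p : uniq L -> (forall j, j \in L) -> \sum_(j <- L) pweight j p = 1.
Proof.
have [n [s [x [t ->]]]] := hcell_surj p => uL mL.
rewrite (@sum_vertices _ _ s (fun j => pweight j (hcell x t)))// => [|j nj]; last first.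
  by rewrite pweight_hcell weight_off.
by rewrite -(coord_sum t); apply: eq_bigr => k _; rewrite pweight_hcell weight_vertex.
Qed.

(** New weights may be given to the vertices of a chain, and new values to
those of positive weight, provided that the values match along the edges. *)
Lemma realization (L : seq {classic I}) (p : hocolim R D) (T : I -> R) (y : forall j : I, option (D j)) :
  uniq L -> (forall j, j \in L) ->
  (forall j, 0 <= T j) -> (forall j, 0 < T j -> 0 < pweight j p) -> \sum_(j <- L) T j = 1 ->
  (forall j, 0 < T j -> exists z, y j = Some z) ->
  (forall (i j : I) (f : hom i j), 0 < T i -> 0 < T j -> 0 < pedge f p -> y j = omap (dmap D f) (y i)) ->
  exists q : hocolim R D, [/\ forall j, pweight j q = T j,
    forall (j : I) (v : D j), pdist (pnt v) q = T j * odist (@dD j) (y j) (Some v) &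
    forall (i j : I) (f : hom i j), pedge f q = if `[< 0 < pedge f p >] then Num.min (T i) (T j) else 0].
Proof.
have [n [s [x [t ->]]]] := hcell_surj p => uL mL T0 Tw T1 yT yf.
have Toff j : (forall k, vertex s k <> j) -> T j = 0.
  move=> nj; apply/eqP; rewrite eq_le T0 andbT leNgt; apply/negP => /Tw/pweight_vertex[k kj _].
  exact: nj kj.
have Ts : \sum_k T (vertex s k) = 1 by rewrite -(sum_vertices uL mL Toff).
pose K := finset (fun k => 0 < T (vertex s k)).
have K0 : K != finset.set0.
  apply/negP => /eqP KE; move: Ts; rewrite big1 => [/esym/eqP|k _]; first by rewrite oner_eq0.
  have : k \notin K by rewrite KE inE.
  by rewrite inE -leNgt => Tk; apply/eqP; rewrite eq_le Tk T0.
have [m [al [hal alK]]] := subset_enumeration K0.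
have Tal i : 0 < T (vertex s (al i)) by have : al i \in K by [apply/alK; exists i]; rewrite inE.
have tal i : 0 < coord t (al i).
  by have := Tw _ (Tal i); rewrite pweight_hcell weight_vertex.
have edge_pos (i j : 'I_m.+1) (ij : (al i <= al j)%N) : 0 < pedge (edge s ij) (hcell x t).
  by rewrite pedge_hcell edge_weight_edge lt_min !tal.
have [||u uP] := @make_simplex R m (fun i => T (vertex s (al i))).
- by move=> i; exact: T0.
- rewrite -Ts [RHS](bigID (mem K))/= [X in _ = _ + X]big1 ?addr0 => [|k]; last first.
    by rewrite inE -leNgt => Tk; apply/eqP; rewrite eq_le Tk T0.
  rewrite (reindex_onto al (fun k => odflt ord0 [pick i | al i == k])) => [|k kK].
    apply: eq_bigl => i; rewrite inE Tal /=; case: pickP => [j /eqP/(strictly_mono_inj hal)->|/(_ i)]; by rewrite eqxx.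
  case: pickP => [i /eqP//|nk].
  by have /alK[i ik] := kK; have := nk i; rewrite ik eqxx.
pose c := restriction hal s.
have [z zE] := yT _ (Tal ord0).
have zval i : Some (@value I D m c z i) = y (vertex s (al i)).
  have i0 : (al ord0 <= al i)%N by exact: strictly_mono_le.
  rewrite (yf _ _ (edge s i0))// zE /= /value /=; congr (Some (dmap D (edge s _) z)).
  exact: bool_irrelevance.
have on j : 0 < T j -> exists i, vertex c i = j.
  move=> Tj; have /pweight_vertex[k kj _] := Tw j Tj.
  have /alK[i ik] : k \in K by rewrite inE kj.
  by exists i; rewrite /= ik.
have T_off j : (forall i, vertex c i <> j) -> T j = 0.
  move=> nj; apply/eqP; rewrite eq_le T0 andbT leNgt; apply/negP => /on[i]; exact: nj.
exists (@hcell R I D m c z u); split.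
- move=> j; rewrite pweight_hcell; have [[i <- ->]|[nj ->]] := weight_case c u j; first exact: uP.
  by rewrite T_off.
- move=> j v; rewrite pdist_hcell; have [[i ij]|nj] := pselect (exists i, vertex c i = j).
    by subst j; rewrite weighted_dist_vertex uP -zval.
  have nj' i : vertex c i <> j by move=> ij; apply: nj; exists i.
  by rewrite weighted_dist_off// T_off// mul0r.
- move=> i j f; rewrite pedge_hcell.
  have [[k [l [kl [e ->]]]]|[nf ->]] := edge_weight_case c u (mor f).
    have /= [ei ej] := congr1 (@projT1 _ _) e; subst i j.
    have fE := @existT_inj2 _ (fun ab : I * I => hom ab.1 ab.2) (vertex s (al k), vertex s (al l)) _ _ e.
    subst f; rewrite asboolT ?uP//; exact: edge_pos.
  case: asboolP => // f0; apply/esym/eqP; rewrite eq_le le_min !T0 andbT.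
  rewrite andbT leNgt lt_min; apply/negP => /andP[/on[a ai] /on[b bj]]; subst i j.
  have [ab fE] := @pedge_edge n s x t (al a) (al b) f f0.
  have ab' : (a <= b)%N.
    by rewrite leqNgt; apply/negP => /hal; rewrite ltnNge ab.
  apply: (nf a b); exists ab'; rewrite fE /=.
  by rewrite (bool_irrelevance ab (strictly_mono_le hal ab')).
Qed.

End PointCoordinates.

(** * The order of the objects *)

Section Rank.
Variables (I : finite_category) (L : seq {classic I}).
Hypotheses (mL : forall j, j \in L).

Definition precedes (i j : I) := exists f : hom i j, ~ is_identity f.

(** Non-identity morphisms raise the rank, since there are no cycles. *)
Definition rank (j : I) : nat := count (fun i : {classic I} => `[< precedes i j >]) L.

Lemma rank_lt (i j : I) : precedes i j -> (rank i < rank j)%N.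
Proof.
move=> [f fN].
have sub k : `[< precedes k i >] -> `[< precedes k j >].
  by move=> /asboolP[g gN]; apply/asboolP; exists (comp f g); exact: comp_not_identity.
have ij : `[< precedes i j >] by apply/asboolP; exists f.
have ii : ~~ `[< precedes i i >].
  by apply/negP => /asboolP[g]; apply; exact: endomorphism_identity.
rewrite /rank; have : (i : {classic I}) \in L by [].
elim: (L) => [//|k l IH]; rewrite inE => /orP[/eqP<-|il] /=.
  rewrite (negPf ii) ij add0n add1n ltnS.
  by elim: (l) => [//|m l' IH'] /=; apply: leq_add => //; case: asboolP => // /asboolP/sub->.
rewrite -addnS; apply: leq_add; last exact: IH.
by case: asboolP => // /asboolP/sub->.
Qed.

Lemma rank_le (j : I) : (rank j <= size L)%N.
Proof. exact: count_size. Qed.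

Lemma precedes_wf : well_founded precedes.
Proof.
move=> j; have [n] := ubnP (rank j); elim: n j => [//|n IH] j jn.
by apply: Acc_intro => i /rank_lt ij; apply: IH; exact: leq_trans ij jn.
Qed.

End Rank.

Section EdgeModulus.
Variables (R : realType) (I : finite_category) (D : diagram I).
Variable dD : forall i : I, D i -> D i -> R.
Hypotheses (dDm : forall i, metrizes (@dD i)) (dD1 : forall i x y, @dD i x y <= 1).

(** The morphisms concerned are edges of finitely many chains, hence the common modulus. *)
Lemma pedge_ucont (e : R) : 0 < e -> exists2 de : R, 0 < de & forall p (i j : I) (f : hom i j),
  0 < pedge dD f p -> forall x x', dD x x' < de -> dD (dmap D f x) (dmap D f x') < e.
Proof.
move=> e0.
have [|||de de0 deP] := @finite_uniform_pos R {n & chain I n} setT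
  (fun c de => forall (k l : 'I_(projT1 c).+1) (kl : (k <= l)%N) (x x' : D (vertex (projT2 c) k)),
    dD x x' < de -> dD (dmap D (edge (projT2 c) kl) x) (dmap D (edge (projT2 c) kl) x') < e).
- exact: finite_chains.
- by move=> c d d' dd h k l kl x x' xx; apply: h; exact: lt_le_trans dd.
- move=> [n s] _ /=.
  have [||de de0 deP] := @finType_uniform_pos R ('I_n.+1 * 'I_n.+1)%type
    (fun kl de => forall (h : (kl.1 <= kl.2)%N) (x x' : D (vertex s kl.1)),
      dD x x' < de -> dD (dmap D (edge s h) x) (dmap D (edge s h) x') < e).
  + by move=> kl d d' dd h kl' x x' xx; apply: h; exact: lt_le_trans dd.
  + move=> [k l] /=; have [kl|kl] := pselect (k <= l)%N; last by exists 1.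
    have /(unif_continuous_metric _ (dDm _) (dDm _))/(_ _ e0)[de de0 deP] :=
      @dmap_unif_continuous _ D _ _ (edge s kl).
    by exists de => // h x x' xx; rewrite (bool_irrelevance h kl); exact: deP.
  by exists de => // k l; exact: (deP (k, l)).
exists de => // p i j f; have [n [s [x0 [t ->]]]] := hcell_surj p => f0.
have [k [l [ki lj _ _]]] := pedge_vertex f0; subst i j.
have [kl ->] := pedge_edge f0 => x x'; exact: (deP (existT _ n s)).
Qed.

Lemma pdist_le_pweight (j : I) (v : D j) p : 0 <= pdist dD (pnt v) p <= pweight dD j p.
Proof.
have [n [s [x [t ->]]]] := hcell_surj p; rewrite pdist_hcell// pweight_hcell//.
have /andP[-> _] := weighted_dist01 dDm dD1 (pnt v) x t => /=.
have [[k kj]|nj] := pselect (exists k, vertex s k = j).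
  by subst j; rewrite weighted_dist_vertex weight_vertex ler_piMr ?coord_ge0.
by rewrite weighted_dist_off ?weight_off// => k kj; apply: nj; exists k.
Qed.

Lemma omap_ucont (i j : I) (f : hom i j) (de e : R) (o o' : option (D i)) : de <= 1 -> 0 < e ->
  (forall x x', dD x x' < de -> dD (dmap D f x) (dmap D f x') < e) ->
  odist (@dD i) o o' < de -> odist (@dD j) (omap (dmap D f) o) (omap (dmap D f) o') < e.
Proof.
move=> de1 e0 h; case: o => [x|]; case: o' => [x'|] //=; [exact: h|lra|lra].
Qed.

End EdgeModulus.

Section Clamp.
Variable R : realType.
Definition clamp (x : R) : R := Num.min 1 (Num.max 0 x).

Lemma clamp01 x : 0 <= clamp x <= 1.
Proof. by rewrite /clamp le_min ler01 le_max lexx ge_min lexx. Qed.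

Lemma clamp_lip x y : `|clamp x - clamp y| <= `|x - y|.
Proof.
have /absle[h1 h2] := lexx `|x - y|; apply/absle; rewrite /clamp.
by case: (leP 0 x); case: (leP 0 y); case: (leP 1 x); case: (leP 1 y) => *; rewrite ?(min_r ler01); lra.
Qed.

Lemma clamp_gt0 x : 0 < clamp x -> 0 < x.
Proof. by rewrite /clamp lt_min => /andP[_]; rewrite lt_max ltxx. Qed.

Lemma clamp_eq1 x : 1 <= x -> clamp x = 1.
Proof. by move=> x1; rewrite /clamp min_l// le_max x1 orbT. Qed.

End Clamp.

(** * Extension of maps into the homotopy colimit *)

Section Estimates.
Variable R : realType.

Lemma norm_sum4 (x a b k l : R) : 0 <= x -> `|a| <= x -> `|b| <= x * 2 -> `|k| <= 2 * x -> `|l| <= x ->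
  `|a - b + (k + l)| <= 8 * x.
Proof. by move=> x0 /absle ? /absle ? /absle ? /absle ?; apply/absle; lra. Qed.

Lemma scale_le (x s w : R) : x <= s -> 3 * s <= w -> 0 < x -> x <= w.
Proof. lra. Qed.

Lemma close_pos (x x' e : R) : `|x - x'| <= e -> e < x -> 0 < x'.
Proof. by move=> /absle; lra. Qed.

Lemma compl01 (t : R) : 0 <= t -> t <= 1 -> 0 <= 1 - t <= 1.
Proof. by move=> *; apply/andP; split; lra. Qed.

Lemma dist01 (k k' : R) : 0 <= k <= 1 -> 0 <= k' <= 1 -> `|k - k'| <= 1.
Proof. by move=> /andP[? ?] /andP[? ?]; apply/absle; lra. Qed.

Lemma twice_small (q s x : R) : - (2 * s) <= q -> q <= 2 * s -> s < x / 2 -> - x <= q /\ q <= x.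
Proof. by move=> *; split; lra. Qed.

Lemma triangle_small (o u k x : R) : o <= k + u -> u <= k + o -> k < x -> o - u <= x /\ - x <= o - u.
Proof. by move=> *; split; lra. Qed.

Lemma convex_close (t q u k x : R) : (1 - t) * (q - u) <= (1 - t) * x -> (1 - t) * - x <= (1 - t) * (q - u) ->
  t * (k - u) <= t * x -> t * - x <= t * (k - u) -> `|(1 - t) * q + t * k - u| <= x.
Proof. by move=> *; apply/absle; lra. Qed.

Lemma half_le (s x : R) : s < x / 2 -> 0 < x -> s <= x.
Proof. lra. Qed.

Lemma weight_half (w w' s q eta : R) : `|w - w'| <= 2 * q -> 0 <= s -> q <= s / 8 -> s <= eta / 4 -> eta <= w ->
  eta / 2 <= w'.
Proof. by move=> /absle [? ?] *; lra. Qed.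

Lemma value_close (eta w x D0 q q' s s' c k e : R) : 0 < eta -> 0 <= x -> eta / 2 <= w -> `|w * x| <= D0 ->
  D0 <= 2 * q + k / 2 + 2 * q' -> q <= s / 8 -> q' <= s' / 8 -> s < c -> s' < c -> c <= k / 8 -> 0 < k ->
  k = eta * e / 2 -> x < e.
Proof.
move=> h1 h2 h3 /absle[_ h4] h5 h6 h7 h8 h9 h10 h11 h12.
have h : eta / 2 * x <= w * x by rewrite ler_wpM2r.
have : eta / 2 * x < eta / 2 * e by lra.
by rewrite ltr_pM2l//; lra.
Qed.

Lemma three_thirds (o a b c x e : R) : o <= a + x -> x <= b + c -> a < e / 3 -> b < e / 3 -> c < e / 3 -> o < e.
Proof. lra. Qed.

Lemma near_scale (s s' c : R) : 0 < c -> s < c / 2 -> - (c / 2) < s - s' -> s - s' < c / 2 -> s < c /\ s' < c.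
Proof. by move=> *; split; lra. Qed.

Lemma near_scale' (s s' c : R) : 0 < c -> s' < c / 2 -> - (c / 2) < s - s' -> s - s' < c / 2 -> s < c /\ s' < c.
Proof. by move=> *; split; lra. Qed.

Lemma ratio_lip (x x' u u' a b : R) : 1 / 2 <= u -> 1 / 2 <= u' -> `|x'| <= 1 ->
  `|x - x'| <= a -> `|u - u'| <= b -> `|x / u - x' / u'| <= 2 * a + 4 * b.
Proof.
move=> u2 u'2 x1 xa ub; have up : 0 < u by lra. have u'p : 0 < u' by lra.
have -> : x / u - x' / u' = (x - x') / u + x' * ((u' - u) / (u * u')).
  by field; rewrite !gt_eqF.
have iu : u^-1 <= 2 by rewrite -[leRHS]invrK lef_pV2 ?posrE//; lra.
have iu' : u'^-1 <= 2 by rewrite -[leRHS]invrK lef_pV2 ?posrE//; lra.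
apply: le_trans (ler_normD _ _) _; apply: lerD; rewrite !normrM !normfV.
  by rewrite (gtr0_norm up) mulrC; apply: ler_pM => //; rewrite invr_ge0 ltW.
rewrite -[leRHS]mul1r; apply: ler_pM => //; first by rewrite mulr_ge0// invr_ge0 normr_ge0.
rewrite distrC mulrC; apply: ler_pM => //; first by rewrite invr_ge0 normr_ge0.
rewrite normrM !gtr0_norm// invfM (_ : 4 = 2 * 2); last by lra.
by apply: ler_pM => //; rewrite invr_ge0 ltW.
Qed.

Lemma max0_bounds (w c : R) : 0 <= c -> 0 <= w <= 1 -> w - c <= Num.max 0 (w - c) <= 1.
Proof. by move=> c0 /andP[? ?]; case: (leP 0 (w - c)) => *; apply/andP; split; lra. Qed.

Lemma max0_gt0 (x : R) : 0 < Num.max 0 x -> Num.max 0 x = x /\ 0 < x.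
Proof. by rewrite lt_max ltxx /= => x0; rewrite max_r// ltW. Qed.

Lemma product_close (t t' k k' e : R) : 0 <= t -> 0 <= t' -> t <= 1 -> 0 <= k <= 1 -> 0 <= k' <= 1 -> 0 < e ->
  `|t - t'| <= e / 8 -> (e / 4 <= t -> e / 8 <= t' -> `|k - k'| <= e / 2) -> `|t * k - t' * k'| <= e.
Proof.
move=> t0 t'0 t1 /andP[k0 k1] /andP[k'0 k'1] e0 /absle[h1 h2] h.
have [te|te] := ltP t (e / 4).
  have a1 : 0 <= t * k by rewrite mulr_ge0.
  have a2 : t * k <= t by rewrite ler_piMr.
  have a3 : 0 <= t' * k' by rewrite mulr_ge0.
  have a4 : t' * k' <= t' by rewrite ler_piMr.
  by apply/absle; lra.
have /absle[h3 h4] : `|k - k'| <= e / 2 by apply: h => //; lra.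
have -> : t * k - t' * k' = t * (k - k') + (t - t') * k' by ring.
have a1 : t * (k - k') <= e / 2.
  have : t * (k - k') <= t * (e / 2) by rewrite ler_wpM2l.
  have : t * (e / 2) <= e / 2 by rewrite ler_piMl//; lra.
  lra.
have a2 : - (e / 2) <= t * (k - k').
  have : t * (- (e / 2)) <= t * (k - k') by rewrite ler_wpM2l.
  have : t * (e / 2) <= e / 2 by rewrite ler_piMl//; lra.
  lra.
have a3 : `|(t - t') * k'| <= e / 8.
  rewrite normrM; apply: (@le_trans _ _ `|t - t'|); last by apply/absle.
  by rewrite ler_piMr// ger0_norm.
move: a3 => /absle a3; apply/absle; lra.
Qed.

Lemma eighth_le1 : 1 / 8 <= 1 :> R.
Proof. lra. Qed.

Lemma affine_factor (k m : R) : 2 * m + 4 * (k * m) <= (2 + 4 * k) * m.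
Proof. lra. Qed.

Lemma fraction_pos (e k : R) : 0 < e -> 0 < k -> 0 < e / k.
Proof. exact: divr_gt0. Qed.

Lemma edge_weight_contra (e s s' q q' w b : R) : 0 < e -> 0 <= s -> q <= s / 8 -> q' <= s' / 8 ->
  e / 2 + 4 * s < w + 2 * q -> - (e / 8) < s - s' -> b < e / 8 -> w <= 2 * q + b + 2 * q' -> False.
Proof. lra. Qed.

End Estimates.

Section HocolimExtension.
Variables (R : realType) (I : finite_category) (D : diagram I).
Variable dD : forall i : I, D i -> D i -> R.
Hypotheses (dDm : forall i, metrizes (@dD i)) (dD1 : forall i x y, @dD i x y <= 1).
Variables (e0 : I -> R) (r : forall i : I, (D i -> R) -> R -> option (D i)).
Hypothesis rP : forall i, near_retraction (@dD i) (e0 i) (@r i).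
Variables (Z : Type) (d : Z -> Z -> R) (A : set Z) (f : Z -> hocolim R D).
Hypotheses (dm : is_metric d) (cA : metric_closed d A).
Hypothesis f_lip : forall a a', A a -> A a' -> hocolim_dist dD (f a) (f a') <= d a a'.
Variable L : seq {classic I}.
Hypotheses (uL : uniq L) (mL : forall j, j \in L).

Implicit Types (i j : I) (z a : Z) (e c : R).

Let dD_metric i : is_metric (@dD i) := (dDm i).1.
Let om j : is_metric (odist (@dD j)) := odist_metric (dD_metric j) (@dD1 j).
Let od_ge0 j (x y : option (D j)) : 0 <= odist (@dD j) x y := metric_ge0 (om j) x y.
Let od_le1 j (x y : option (D j)) : odist (@dD j) x y <= 1 := odist_le1 (@dD1 j) x y.

(** The coordinates are extended first, forgetting the relations between them. *)
Let ext (co : coordinate D) z : R := mcshane d A (fun a => hcoord dD co (f a)) z.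
Let W j := ext (inl (inl j)).
Let E i j (g : hom i j) := ext (inl (inr (mor g))).
Let V j (v : D j) := ext (inr (pnt v)).

Let co_le1 co a : A a -> hcoord dD co (f a) <= 1.
Proof. by move=> _; case/andP: (hcoord01 dDm dD1 co (f a)). Qed.

Let ext_lip co z z' : `|ext co z - ext co z'| <= d z z'.
Proof. by apply: mcshane_lip => // a; exact: co_le1. Qed.

Let ext_id co a : A a -> ext co a = hcoord dD co (f a).
Proof.
move=> Aa; apply: (@mcshane_id _ _ _ _ dm (fun a => hcoord dD co (f a))) => //.
  by move=> b _; exact: hcoord01.
by move=> b b' Ab Ab'; apply: le_trans (f_lip Ab Ab'); exact: hocolim_dist_ub.
Qed.

Let ext_near co z a : A a -> `|ext co z - hcoord dD co (f a)| <= d a z.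
Proof. by move=> Aa; rewrite -(ext_id co Aa) distrC; exact: ext_lip. Qed.

Let ext01 co z : 0 <= ext co z <= 1.
Proof. by apply: (mcshane01 dm) => a; exact: co_le1. Qed.

(** The coordinates of a nearby point of the image determine those at [z] up to an error of
order [sg z * sg z], negligible with respect to [sg z], the scale at which weights are compared. *)
Let sg z : R := Num.sqrt (set_dist d A z).

Let sg_ge0 z : 0 <= sg z. Proof. exact: sqrtr_ge0. Qed.

Let sg_sq z : sg z * sg z = set_dist d A z.
Proof. by rewrite -expr2 sqr_sqrtr//; case/andP: (set_dist01 A dm z). Qed.

Let sg_A a : A a -> sg a = 0.
Proof. by move=> Aa; rewrite /sg set_dist0// sqrtr0. Qed.

Let sg_eq0 z : sg z = 0 -> A z.
Proof. by move=> z0; apply: (set_dist_eq0 cA); rewrite -sg_sq z0 mulr0. Qed.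

Let sg_ucont e : 0 < e -> exists2 de : R, 0 < de & forall z z', d z z' < de -> `|sg z - sg z'| < e.
Proof.
move=> ep; exists (e * e) => [|z z' zz]; first exact: mulr_gt0.
have h : `|sg z * sg z - sg z' * sg z'| < e * e by rewrite !sg_sq; apply: le_lt_trans (set_dist_lip A dm z z') zz.
have := sg_ge0 z; have := sg_ge0 z'; move: h => /abslt[h1 h2] s1 s2.
rewrite ltNge; apply/negP => h; have [le|le] := lerP (sg z) (sg z').
  rewrite distrC ger0_norm in h; last by lra.
  nra.
rewrite ger0_norm in h; last by lra.
nra.
Qed.

Definition near_point z a := A a /\ d a z <= 2 * (sg z * sg z).

Let near_exists z : sg z <= 1 / 2 -> exists a, near_point z a.
Proof.
move=> s1; have [z0|z0] := eqVneq (sg z) 0.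
  have Az := sg_eq0 z0; exists z; split=> //.
  by rewrite (metricxx _ dm) z0 mulr0 mulr0.
have sp : 0 < sg z by rewrite lt_neqAle eq_sym z0 sg_ge0.
have ssp : 0 < sg z * sg z by rewrite mulr_gt0.
have [||a Aa az] := @set_dist_near R Z d A z (2 * (sg z * sg z)).
- by rewrite -sg_sq; lra.
- nra.
by exists a; split=> //; exact: ltW.
Qed.

Let near_A a : A a -> near_point a a.
Proof. by move=> Aa; split=> //; rewrite (metricxx _ dm) sg_A// mulr0 mulr0. Qed.

Let near_A_eq z a : A z -> near_point z a -> a = z.
Proof.
move=> Az [_]; rewrite sg_A// mulr0 mulr0 => h; have [d0 _ _] := dm; apply/d0; apply/eqP.
by rewrite eq_le h (metric_ge0 dm).
Qed.

Let near_ext co z a : near_point z a -> `|ext co z - hcoord dD co (f a)| <= 2 * (sg z * sg z).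
Proof. by move=> [Aa az]; apply: le_trans az; exact: ext_near. Qed.

Let sq_small z : sg z <= 1 / 8 -> sg z * sg z <= sg z / 8.
Proof. by move=> s8; have := sg_ge0 z; nra. Qed.

(** Objects and morphisms with a larger weight than this occur in every nearby point of the
image: see [domain_pos] and [active_pos]. *)
Let domain z j := 3 * sg z < W j z.
Let active i j (g : hom i j) z := sg z < E g z.

Let domain_pos z a j : sg z <= 1 / 8 -> near_point z a -> domain z j -> 0 < pweight dD j (f a).
Proof.
move=> s8 /(near_ext (inl (inl j)))/absle[h1 h2]; rewrite /domain /W /pweight.
by have := sq_small s8; have := sg_ge0 z; lra.
Qed.

Let active_pos z a i j (g : hom i j) : sg z <= 1 / 8 -> near_point z a -> active g z -> 0 < pedge dD g (f a).
Proof.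
move=> s8 /(near_ext (inl (inr (mor g))))/absle[h1 h2]; rewrite /active /E /pedge.
by have := sq_small s8; have := sg_ge0 z; lra.
Qed.

Let pedge_active z a i j (g : hom i j) : sg z <= 1 / 8 -> near_point z a -> 0 < pedge dD g (f a) ->
  2 * sg z <= W i z -> 2 * sg z <= W j z -> active g z.
Proof.
move=> s8 na g0; have e := pedge_min g0.
have /absle[h1 h2] := near_ext (inl (inr (mor g))) na.
have /absle[h3 h4] := near_ext (inl (inl i)) na; have /absle[h5 h6] := near_ext (inl (inl j)) na.
move: g0 e; rewrite /active /E /W; rewrite /pedge /pweight => g0 e.
have := sq_small s8; have := sg_ge0 z; move: e.
case: (leP (hcoord dD (inl (inl i)) (f a)) (hcoord dD (inl (inl j)) (f a))) => *; first by have [|] := eqVneq (sg z) 0; [nra|move=> ?; nra].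
by have [|] := eqVneq (sg z) 0; [nra|move=> ?; nra].
Qed.

(** The value at an object is that at a preceding one, transported along the
morphism between them, when both have a weight that is large compared to [sg];
as these weights become smaller, it passes to a value found independently. *)
Let B j : R := 3 + (rank L j)%:R.

Let B3 j : 3 <= B j.
Proof. by rewrite /B lerDl. Qed.

Let B_lt i j : precedes i j -> B i + 1 <= B j.
Proof.
move=> /(rank_lt mL) ij; rewrite /B -addrA lerD2l natr1 ler_nat; exact: ij.
Qed.

(** It grows from 0 to 1 as the smaller weight grows from [B j] to [B j + 1] times [sg]. *)
Let th i j z : R := clamp (Num.min (W i z) (W j z) / sg z - B j).

Let Theta j z : R := supr (fun u : {i : I & hom i j} =>
  if `[< ~ is_identity (projT2 u) /\ active (projT2 u) z >] then th (projT1 u) j z else 0).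

Let Theta_term01 j z (u : {i : I & hom i j}) :
  0 <= (if `[< ~ is_identity (projT2 u) /\ active (projT2 u) z >] then th (projT1 u) j z else 0) <= 1.
Proof. by case: asboolP => _; [exact: clamp01|rewrite lexx ler01]. Qed.

Let Theta01 j z : 0 <= Theta j z <= 1.
Proof.
rewrite (supr_ge0 (M := 1))/= => [|u]; last exact: Theta_term01.
by apply: supr_le => // u; case/andP: (Theta_term01 z u).
Qed.

Let Theta_ge i j z (g : hom i j) : ~ is_identity g -> active g z -> th i j z <= Theta j z.
Proof.
move=> gN ga; have := @supr_ub R {i : I & hom i j} (fun u =>
  if `[< ~ is_identity (projT2 u) /\ active (projT2 u) z >] then th (projT1 u) j z else 0) 1
  (existT (fun i => hom i j) i g).
by rewrite /= asboolT//; apply=> u; case/andP: (Theta_term01 z u).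
Qed.

Let Theta_gt j z c : 0 <= c -> c < Theta j z -> exists i (g : hom i j),
  [/\ ~ is_identity g, active g z & c < th i j z].
Proof.
move=> c0 cT; apply: contrapT => nex; move: cT; rewrite ltNge => /negP; apply.
apply: supr_le => // -[i g] /=; case: asboolP => // -[gN ga].
by rewrite leNgt; apply/negP => h; apply: nex; exists i, g.
Qed.

Let th_gt0 i j z : 0 < th i j z -> [/\ 0 < sg z, B j * sg z < W i z & B j * sg z < W j z].
Proof.
move=> /clamp_gt0 h; have sp : 0 < sg z.
  rewrite lt_neqAle sg_ge0 andbT eq_sym; apply/eqP => s0.
  by move: h; rewrite s0 invr0 mulr0; have := B3 j; lra.
have : B j < Num.min (W i z) (W j z) / sg z by lra.
by rewrite ltr_pdivlMr// lt_min => /andP[].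
Qed.

Let Theta_A j z : sg z = 0 -> Theta j z = 0.
Proof.
move=> z0; have /andP[T0 _] := Theta01 j z; apply/eqP; rewrite eq_le T0 andbT leNgt.
by apply/negP => /(Theta_gt (lexx 0))[i [g [_ _ /th_gt0[]]]]; rewrite z0 ltxx.
Qed.

(** All its elements are equal when [z] is near [A]: see [values_compat]. *)
Let predecessor_value j (y : forall i, Z -> option (D i)) z : set (option (D j)) :=
  [set o | exists i (g : hom i j), [/\ ~ is_identity g, active g z, B j * sg z < W i z &
    o = omap (dmap D g) (y i z)]].

Let q0 j z (v : D j) : R := V v z / W j z.

(** Interpolates between the independently found value and the one transported from a
preceding object, both seen as functions. *)
Let mix j z (o : option (D j)) (v : D j) : R :=
  (1 - Theta j z) * q0 z v + Theta j z * odist (@dD j) o (Some v).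

(** It vanishes only on [A], where [q0] is the Kuratowski image of the value of [f], and where
[mix] is the image of the transported value. *)
Let height j z : R := sg z * (1 - Theta j z).

(** By recursion along non-identity morphisms. *)
Lemma extended_values_exist : exists y : forall j, Z -> option (D j), forall j z,
  y j z = r (mix z (xget None (@predecessor_value j y z))) (height j z).
Proof.
pose F j (rec : forall i, precedes i j -> Z -> option (D i)) z : option (D j) :=
  r (mix z (xget None [set o | exists i (g : hom i j), exists gN : ~ is_identity g,
    [/\ active g z, B j * sg z < W i z &
    o = omap (dmap D g) (rec i (ex_intro _ g gN) z)]])) (height j z).
exists (Fix (precedes_wf mL) (fun j => Z -> option (D j)) F) => j z.
rewrite Fix_eq => [|k g h gh]; last first.
  congr F; apply: functional_extensionality_dep => i; apply: functional_extensionality_dep => ij.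
  exact: gh.
rewrite /F; congr (r (mix z (xget None _)) _); apply/seteqP; split => o.
  by move=> [i [g [gN [ga Bg oE]]]]; exists i, g.
by move=> [i [g [gN ga Bg oE]]]; exists i, g, gN.
Qed.

Section ExtendedValues.
Variable y : forall j, Z -> option (D j).
Let p j z := xget None (@predecessor_value j y z).
Hypothesis yE : forall j z, y j z = r (mix z (p j z)) (height j z).

Let q0_near z a j (v : D j) : sg z <= 1 / 8 -> near_point z a -> domain z j -> is_value dD (f a) v ->
  forall q, `|q0 z q - dD v q| <= 2 * sg z.
Proof.
move=> s8 na Wj [_ vv] q.
have /absle[h1 h2] := near_ext (inr (pnt q)) na; have /absle[h3 h4] := near_ext (inl (inl j)) na.
rewrite -[hcoord dD (inr _) _]/(pdist dD (pnt q) (f a)) vv in h1 h2.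
rewrite -[hcoord dD (inl _) _]/(pweight dD j (f a)) in h3 h4.
rewrite -[ext (inr _) z]/(V q z) in h1 h2; rewrite -[ext (inl _) z]/(W j z) in h3 h4.
move: Wj; rewrite /domain /q0 => Wj; have s0 := sg_ge0 z; have W0 : 0 < W j z by lra.
have q1 := dD1 v q; have q00 := metric_ge0 (dD_metric j) v q.
have -> : V q z / W j z - dD v q = (V q z - W j z * dD v q) / W j z.
  by rewrite mulrBl (mulrC (W j z)) mulfK// gt_eqF.
rewrite normrM normfV (gtr0_norm W0) ler_pdivrMr//; apply/absle.
have k1 : (W j z - pweight dD j (f a)) * dD v q <= 2 * (sg z * sg z) * dD v q by rewrite ler_wpM2r.
have k2 : - (2 * (sg z * sg z)) * dD v q <= (W j z - pweight dD j (f a)) * dD v q by rewrite ler_wpM2r.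
have k3 : 2 * (sg z * sg z) * dD v q <= 2 * (sg z * sg z) by rewrite ler_piMr// mulr_ge0// mulr_ge0.
have k4 : sg z * (3 * sg z) <= sg z * W j z by rewrite ler_wpM2l// ltW.
rewrite mulrBl in k1 k2; lra.
Qed.

Let predecessor_close z a j o : sg z <= 1 / 8 -> near_point z a -> @predecessor_value j y z o ->
  exists i (g : hom i j) (v : D i), [/\ precedes i j, 0 < pedge dD g (f a), domain z i, is_value dD (f a) v &
    o = omap (dmap D g) (y i z)].
Proof.
move=> s8 na [i [g [gN ga Bg oE]]]; have g0 := active_pos s8 na ga.
have Wi : domain z i.
  by apply: le_lt_trans Bg; rewrite ler_wpM2r.
have [v vv] := is_value_exists (domain_pos s8 na Wi).
by exists i, g, v; split=> //; exists g.
Qed.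

(** By induction on the rank: both functions mixed in [mix] are close to the Kuratowski image
of [v], the transported one because [v] itself is transported from the value of [f a] at the
preceding object. *)
Lemma values_near n e : 0 < e -> exists2 c : R, 0 < c & forall j, (rank L j < n)%N ->
  forall z a (v : D j), sg z < c -> near_point z a -> domain z j -> is_value dD (f a) v ->
  odist (@dD j) (y j z) (Some v) < e /\
  admissible (@dD j) (e0 j) (mix z (p j z)) (height j z).
Proof.
elim: n e => [|n IH] e ep; first by exists 1.
suff [c cp cP] : exists2 c : R, 0 < c & forall j : {classic I}, [set: {classic I}] j -> (rank L j < n.+1)%N ->
    forall z a (v : D j), sg z < c -> near_point z a -> domain z j -> is_value dD (f a) v ->
    odist (@dD j) (y j z) (Some v) < e /\ admissible (@dD j) (e0 j) (mix z (p j z)) (height j z).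
  by exists c => // j; exact: (cP j).
apply: finite_uniform_pos.
- by apply/finite_seqP; exists L; apply/seteqP; split=> j //= _; exact: mL.
- move=> j c c' cc h jn z a v zc; apply: h => //; exact: lt_le_trans cc.
move=> j _; have [e0p rid rc] := rP j; have [d1 d1p d1P] := rc e ep.
pose d2 := Num.min (Num.min d1 (e0 j)) 1.
have d2p : 0 < d2 by rewrite !lt_min d1p e0p ltr01.
have [d2d1 [d2e0 d21]] : d2 <= d1 /\ d2 <= e0 j /\ d2 <= 1 by rewrite !ge_min !lexx !orbT.
have [d3 d3p d3P] := pedge_ucont dDm d2p.
have d4p : 0 < Num.min d3 1 by rewrite lt_min d3p ltr01.
have [c1 c1p c1P] := IH _ d4p.
exists (Num.min (Num.min c1 (1 / 8)) (d2 / 2)).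
  by rewrite !lt_min c1p /= divr_gt0//=; lra.
move=> jn z a v; rewrite !lt_min => /andP[/andP[zc1 z8] zd2] na Wj vv.
have s8 := ltW z8; have s0 := sg_ge0 z; have /andP[T0 T1] := Theta01 j z.
have pv : 0 < Theta j z -> odist (@dD j) (p j z) (Some v) < d2.
  move=> /(Theta_gt (lexx 0))[i [g [gN ga /th_gt0[_ Bi _]]]].
  have pP : @predecessor_value j y z (p j z).
    by apply: xgetPex; exists (omap (dmap D g) (y i z)); exists i, g.
  have [k [l [u [kj l0 Wk uv ->]]]] := predecessor_close s8 na pP.
  have kn : (rank L k < n)%N by apply: leq_trans (rank_lt mL kj) _; rewrite -ltnS.
  have [yu _] := c1P k kn z a u zc1 na Wk uv.
  have -> : v = dmap D l u by apply: (is_value_uniq dDm vv); exact: (pedge_value dDm l0 uv).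
  apply: (@omap_ucont R I D dD k j l (Num.min d3 1) d2 (y k z) (Some u)) => //.
    by rewrite ge_min lexx orbT.
  by move=> x x' xx; apply: (d3P (f a)) => //; apply: lt_le_trans xx _; rewrite ge_min lexx.
have mixv q : `|mix z (p j z) q - dD v q| <= d2.
  have /absle[k1 k2] := q0_near s8 na Wj vv q.
  have [k3 k4] : - d2 <= q0 z q - dD v q /\ q0 z q - dD v q <= d2 by exact: twice_small k1 k2 zd2.
  have T01 : 0 <= 1 - Theta j z by rewrite subr_ge0.
  have m1 : (1 - Theta j z) * (q0 z q - dD v q) <= (1 - Theta j z) * d2 by apply: ler_wpM2l.
  have m2 : (1 - Theta j z) * (- d2) <= (1 - Theta j z) * (q0 z q - dD v q) by apply: ler_wpM2l.
  have [m3 m4] : Theta j z * (odist (@dD j) (p j z) (Some q) - dD v q) <= Theta j z * d2 /\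
      Theta j z * (- d2) <= Theta j z * (odist (@dD j) (p j z) (Some q) - dD v q).
    move: T0; rewrite le_eqVlt => /orP[/eqP<-|Tp]; first by rewrite !mul0r.
    have [_ oC oT] := om j.
    have t1 := oT (p j z) (Some v) (Some q); have t2 := oT (Some v) (p j z) (Some q).
    rewrite (oC (Some v) (p j z)) in t2; have := pv Tp; move: t1 t2; rewrite /= => t1 t2 t3.
    have [t4 t5] := triangle_small t1 t2 t3.
    by split; apply: ler_wpM2l => //; exact: ltW.
  by rewrite /mix; exact: convex_close m1 m2 m3 m4.
have hgt : `|height j z| <= d2.
  rewrite /height ger0_norm; last by rewrite mulr_ge0//; lra.
  apply: (@le_trans _ _ (sg z)); last by exact: half_le zd2 d2p.
  by rewrite ler_piMr// gerBl.
have adm : admissible (@dD j) (e0 j) (mix z (p j z)) (height j z).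
  split; last first.
    by exists v; split; [exact: le_trans hgt d2e0|move=> q; exact: le_trans (mixv q) d2e0].
  move=> /eqP; rewrite mulf_eq0 => /orP[/eqP z0|/eqP TE].
    have Az := sg_eq0 z0; have az := near_A_eq Az na; subst a.
    exists v; apply/funext => q; rewrite /mix Theta_A// subr0 mul1r mul0r addr0.
    have := q0_near s8 na Wj vv q; rewrite z0 mulr0 normr_le0 => /eqP h.
    by apply/subr0_eq.
  have TE1 : Theta j z = 1 by lra.
  have := pv; rewrite TE1 => /(_ ltr01); rewrite /mix TE1.
  case: (p j z) => [u|] /= hu; last by lra.
  by exists u; apply/funext => q; rewrite subrr mul0r add0r mul1r.
split=> //; rewrite yE -(rid v); apply: d1P => //.
- by split=> [_|]; exists v => //; rewrite normr0; split; [exact: ltW|move=> q; rewrite subrr normr0; exact: ltW].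
- by move=> q; exact: le_trans (mixv q) d2d1.
- by rewrite subr0; exact: le_trans hgt d2d1.
Qed.

Lemma values_at_A j a v : A a -> is_value dD (f a) v -> y j a = Some v.
Proof.
move=> Aa vv; have [d0 _ _] := om j; apply/d0; apply/eqP; rewrite eq_le od_ge0 andbT.
apply/ler_addgt0Pr => e ep; rewrite add0r.
have [c cp cP] := values_near (rank L j).+1 ep.
have [||h _] := cP j (ltnSn _) a a v _ (near_A Aa) _ vv; last exact: ltW.
- by rewrite sg_A.
- by rewrite /domain sg_A// mulr0 /W ext_id//; case: vv.
Qed.

Section GoodScale.
Variable c1 : R.
Hypotheses (c1p : 0 < c1) (c18 : c1 <= 1 / 8).
Hypothesis c1P : forall j z, sg z < c1 -> domain z j ->
  (exists w, y j z = Some w) /\ admissible (@dD j) (e0 j) (mix z (p j z)) (height j z).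

Let c1_half z : sg z < c1 -> sg z <= 1 / 8 /\ sg z <= 1 / 2.
Proof. by move=> h; have := lt_le_trans h c18; move: (sg z) => x ?; split; lra. Qed.

(** Two objects that precede [j] are joined by a morphism of the chain of a nearby point of
the image. Both have weight at least [B j * sg z], which exceeds the threshold for the later of
them, so that by induction its value is the transported value of the earlier one. *)
Lemma values_compat n j : (rank L j < n)%N ->
  (forall z o o', sg z < c1 -> domain z j ->
     @predecessor_value j y z o -> @predecessor_value j y z o' -> o = o') /\
  (forall z i (g : hom i j), sg z < c1 -> ~ is_identity g -> active g z ->
     domain z i -> domain z j -> (B j + 1) * sg z <= W i z -> (B j + 1) * sg z <= W j z ->
     y j z = omap (dmap D g) (y i z)).
Proof.
elim: n j => [//|n IH] j jn.
have agree z o o' : sg z < c1 -> domain z j ->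
    @predecessor_value j y z o -> @predecessor_value j y z o' -> o = o'.
  move=> zc Wj; have [z8 z2] := c1_half zc; have [a na] := near_exists z2.
  have half i i' (g : hom i j) (g' : hom i' j) (k : hom i i') :
      ~ is_identity g' -> 0 < pedge dD g (f a) -> 0 < pedge dD g' (f a) -> 0 < pedge dD k (f a) ->
      B j * sg z < W i z -> B j * sg z < W i' z ->
      omap (dmap D g) (y i z) = omap (dmap D g') (y i' z).
    move=> g'N g0 g'0 k0 Bi Bi'; have [kI|kN] := pselect (is_identity k).
      by case: kI g' k0 g'N g'0 Bi' => g' k0 g'N g'0 _; rewrite (pedge_uniq g0 g'0).
    have i'j : precedes i' j by exists g'.
    have B1 := B_lt i'j; have s0 := sg_ge0 z.
    have Bs : (B i' + 1) * sg z <= B j * sg z by rewrite ler_wpM2r.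
    have B3s i0 : 3 * sg z <= B i0 * sg z by rewrite ler_wpM2r.
    have Di : domain z i by apply: le_lt_trans Bi.
    have Di' : domain z i' by apply: le_lt_trans Bi'.
    have ka : active k z by apply: (pedge_active z8 na k0); have := B3s j; lra.
    have [_ cmp] := IH i' (leq_trans (rank_lt mL i'j) (ltnSE jn)).
    have b1 : (B i' + 1) * sg z <= W i z by exact: le_trans Bs (ltW Bi).
    have b2 : (B i' + 1) * sg z <= W i' z by exact: le_trans Bs (ltW Bi').
    rewrite (cmp z i k zc kN ka Di Di' b1 b2).
    rewrite (pedge_comp k0 g'0 g0); case: (y i z) => //= u; by rewrite dmap_comp.
  move=> [i [g [gN ga Bi ->]]] [i' [g' [g'N g'a Bi' ->]]].
  have g0 := active_pos z8 na ga; have g'0 := active_pos z8 na g'a.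
  have s0 := sg_ge0 z.
  have B3s : 3 * sg z <= B j * sg z by rewrite ler_wpM2r.
  have wi : 0 < pweight dD i (f a) by apply: (domain_pos z8 na); apply: le_lt_trans Bi.
  have wi' : 0 < pweight dD i' (f a) by apply: (domain_pos z8 na); apply: le_lt_trans Bi'.
  have [[k k0]|[k k0]] := pedge_total wi wi'; first exact: (half _ _ g g' k).
  by symmetry; exact: (half _ _ g' g k).
split=> // z i g zc gN ga Di Dj Bi Bj; have [z8 z2] := c1_half zc.
have [z0|z0] := eqVneq (sg z) 0.
  have Az := sg_eq0 z0; have g0 := active_pos z8 (near_A Az) ga.
  have [v vv] := is_value_exists (domain_pos z8 (near_A Az) Di).
  by rewrite (values_at_A Az vv) /= (values_at_A Az (pedge_value dDm g0 vv)).
have sp : 0 < sg z by rewrite lt_neqAle eq_sym z0 sg_ge0.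
have TE : Theta j z = 1.
  have /andP[_ T1] := Theta01 j z; apply/eqP; rewrite eq_le T1 /=.
  apply: le_trans (Theta_ge gN ga); rewrite /th clamp_eq1//.
  have : B j + 1 <= Num.min (W i z) (W j z) / sg z by rewrite ler_pdivlMr// le_min Bi.
  by lra.
have gP : @predecessor_value j y z (omap (dmap D g) (y i z)).
  by exists i, g; split=> //; apply: lt_le_trans Bi; rewrite ltr_pM2r//; lra.
have pE : p j z = omap (dmap D g) (y i z).
  apply: (agree z) => //; apply: xgetPex; exact: (ex_intro _ _ gP).
have [[w wE] _] := c1P zc Di.
have [_ rid _] := rP j; rewrite yE pE wE /=.
have -> : mix z (Some (dmap D g w)) = dD (dmap D g w).
  by apply/funext => q; rewrite /mix TE subrr mul0r add0r mul1r.
by rewrite /height TE subrr mulr0 rid.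
Qed.

Let agree j z o o' : sg z < c1 -> domain z j ->
  @predecessor_value j y z o -> @predecessor_value j y z o' -> o = o'.
Proof. by have [h _] := values_compat (ltnSn (rank L j)); exact: h. Qed.

Let div_lip (x x' u u' a b s0 : R) : 0 < s0 -> s0 <= u -> s0 <= u' -> `|x'| <= 1 ->
  `|x - x'| <= a -> `|u - u'| <= b -> `|x / u - x' / u'| <= a / s0 + b / (s0 * s0).
Proof.
move=> s0p su su' x1 xa ub; have up : 0 < u by lra. have u'p : 0 < u' by lra.
have -> : x / u - x' / u' = (x - x') / u + x' * ((u' - u) / (u * u')).
  by field; rewrite !gt_eqF.
apply: le_trans (ler_normD _ _) _; apply: lerD; rewrite !normrM !normfV.
  rewrite (gtr0_norm up); apply: ler_pM => //; first by rewrite invr_ge0 ltW.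
  by rewrite lef_pV2.
rewrite -[leRHS]mul1r; apply: ler_pM => //.
  by rewrite mulr_ge0// invr_ge0 normr_ge0.
rewrite distrC; apply: ler_pM => //; first by rewrite invr_ge0 normr_ge0.
rewrite normrM !gtr0_norm// lef_pV2 ?posrE ?mulr_gt0//.
by apply: ler_pM => //; exact: ltW.
Qed.

Let min_lip (x y0 x' y0' e : R) : `|x - x'| <= e -> `|y0 - y0'| <= e ->
  `|Num.min x y0 - Num.min x' y0'| <= e.
Proof.
move=> /absle h1 /absle h2; apply/absle.
by case: (leP x y0); case: (leP x' y0') => *; lra.
Qed.

Let th_ucont s0 e : 0 < s0 -> 0 < e -> exists2 de : R, 0 < de & forall z z' i j,
  s0 <= sg z -> s0 <= sg z' -> d z z' < de -> `|th i j z - th i j z'| <= e.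
Proof.
move=> s0p ep; have e1 : 0 < e * (s0 * s0) / 2 by rewrite divr_gt0// !mulr_gt0.
have [de dep deP] := sg_ucont e1.
exists (Num.min de (e * s0 / 2)); first by rewrite lt_min dep !divr_gt0 ?mulr_gt0.
move=> z z' i j h1 h2; rewrite lt_min => /andP[zz zz'].
apply: le_trans (clamp_lip _ _) _.
rewrite opprB addrA subrK.
have m1 : `|Num.min (W i z') (W j z')| <= 1.
  have /andP[a0 a1] := ext01 (inl (inl i)) z'; have /andP[b0 b1] := ext01 (inl (inl j)) z'.
  by rewrite ger0_norm ?ge_min ?a1// le_min a0.
have m2 : `|Num.min (W i z) (W j z) - Num.min (W i z') (W j z')| <= d z z'.
  by apply: min_lip; exact: ext_lip.
apply: le_trans (div_lip s0p h1 h2 m1 m2 (ltW (deP _ _ zz))) _.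
have -> : e * (s0 * s0) / 2 / (s0 * s0) = e / 2 by field; rewrite gt_eqF.
have : d z z' / s0 <= e / 2 by rewrite ler_pdivrMr//; lra.
by lra.
Qed.

Let active_transfer s0 : 0 < s0 -> exists2 de : R, 0 < de & forall z z' i j (g : hom i j),
  s0 <= sg z -> sg z < c1 -> d z z' < de -> active g z -> 0 < th i j z -> active g z'.
Proof.
move=> s0p; have s02 : 0 < s0 / 2 by lra.
have [de dep deP] := sg_ucont s02.
exists (Num.min de (s0 / 2)); first by rewrite lt_min dep.
move=> z z' i j g sz zc; rewrite lt_min => /andP[/deP/abslt[k1 k2] zz] ga /th_gt0[sp Bi Bj].
have [z8 z2] := c1_half zc; have [a na] := near_exists z2.
have g0 := active_pos z8 na ga; have e := pedge_min g0.
have /absle[h1 h2] := near_ext (inl (inr (mor g))) na.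
have /absle[h3 h4] := near_ext (inl (inl i)) na; have /absle[h5 h6] := near_ext (inl (inl j)) na.
have /absle[h7 h8] := ext_lip (inl (inr (mor g))) z z'.
have sq := sq_small z8.
have B3s : 3 * sg z <= B j * sg z by rewrite ler_wpM2r.
move: e Bi Bj; rewrite /active /E /W /pedge /pweight.
by case: (leP (hcoord dD (inl (inl i)) (f a)) (hcoord dD (inl (inl j)) (f a))) => *; lra.
Qed.

Let Theta_ucont s0 e : 0 < s0 -> 0 < e -> exists2 de : R, 0 < de & forall z z' j,
  s0 <= sg z -> s0 <= sg z' -> sg z < c1 -> sg z' < c1 -> d z z' < de -> `|Theta j z - Theta j z'| <= e.
Proof.
move=> s0p ep; have [d1 d1p d1P] := th_ucont s0p ep; have [d2 d2p d2P] := active_transfer s0p.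
exists (Num.min d1 d2); first by rewrite lt_min d1p.
move=> z z' j h1 h2 h3 h4; rewrite lt_min => /andP[zz1 zz2].
have [_ dC _] := dm.
apply: (supr_dist (M := 1)); [exact: ltW|exact: Theta_term01|exact: Theta_term01|].
have zero x x' i (g : hom i j) : s0 <= sg x -> sg x < c1 -> d x x' < d2 -> active g x ->
    ~ active g x' -> th i j x = 0.
  move=> k1 k2 k3 ga nga; apply/eqP; rewrite eq_le; have /andP[-> _] : 0 <= th i j x <= 1 by exact: clamp01.
  by rewrite andbT leNgt; apply/negP => /(d2P x x' i j g k1 k2 k3 ga).
move=> [i g] /=; case: asboolP => [[gN ga]|nga]; case: asboolP => [[gN' ga']|nga'].
- exact: d1P.
- have na' : ~ active g z' by move=> ga'; apply: nga'.
  by rewrite (zero z z' i g h1 h3 zz2 ga na') subrr normr0 ltW.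
- have na : ~ active g z by move=> ga; apply: nga.
  rewrite dC in zz2.
  by rewrite (zero z' z i g h2 h4 zz2 ga' na) subrr normr0 ltW.
- by rewrite subrr normr0 ltW.
Qed.

Let odist_lip j (o o' q : option (D j)) : `|odist (@dD j) o q - odist (@dD j) o' q| <= odist (@dD j) o o'.
Proof.
have [_ dC dT] := om j; apply/absle.
by have := dT o o' q; have := dT o' o q; rewrite (dC o' o); lra.
Qed.

Let q0_bound z j (v : D j) : sg z < c1 -> domain z j -> `|q0 z v| <= 2.
Proof.
move=> zc Wj; have [z8 z2] := c1_half zc; have [a na] := near_exists z2.
have [u uv] := is_value_exists (domain_pos z8 na Wj).
have /absle[h1 h2] := q0_near z8 na Wj uv v; have := dD1 u v.
by have := metric_ge0 (dD_metric j) u v => *; apply/absle; lra.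
Qed.

(** By induction on the rank: the distance to [A] being bounded below, all the functions
involved are Lipschitz. The value at a preceding object only matters if [Theta] is not small, and
then the same morphism can be used for both points. *)
Lemma values_ucont_away n s0 e : 0 < s0 -> 0 < e -> exists2 de : R, 0 < de &
  forall j, (rank L j < n)%N -> forall z z', s0 <= sg z -> s0 <= sg z' -> sg z < c1 -> sg z' < c1 ->
  domain z j -> domain z' j -> d z z' < de -> odist (@dD j) (y j z) (y j z') < e.
Proof.
move=> s0p; elim: n e => [|n IH] e ep; first by exists 1.
suff [de dep deP] : exists2 de : R, 0 < de & forall j : {classic I}, [set: {classic I}] j ->
    (rank L j < n.+1)%N -> forall z z', s0 <= sg z -> s0 <= sg z' -> sg z < c1 -> sg z' < c1 ->
    domain z j -> domain z' j -> d z z' < de -> odist (@dD j) (y j z) (y j z') < e.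
  by exists de => // j; exact: (deP j).
apply: finite_uniform_pos.
- by apply/finite_seqP; exists L; apply/seteqP; split=> j //= _; exact: mL.
- move=> j c c' cc h jn z z' *; apply: h => //; exact: lt_le_trans cc.
move=> j _; have [_ _ rc] := rP j; have [d1 d1p d1P] := rc e ep.
pose eta := d1 / 8; have etap : 0 < eta by rewrite divr_gt0.
have [d2 d2p d2P] := pedge_ucont dDm etap.
have d3p : 0 < Num.min d2 1 by rewrite lt_min d2p ltr01.
have [d4 d4p d4P] := IH _ d3p.
have [d5 d5p d5P] := Theta_ucont s0p etap.
have [d6 d6p d6P] := th_ucont s0p etap.
have [d7 d7p d7P] := active_transfer s0p.
have [d8 d8p d8P] := sg_ucont etap.
pose d9 := eta / (1 / s0 + 1 / (s0 * s0)).
have k0 : 0 < 1 / s0 + 1 / (s0 * s0) by rewrite addr_gt0// divr_gt0// mulr_gt0.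
have d9p : 0 < d9 by rewrite divr_gt0.
exists (Num.min (Num.min (Num.min d4 d5) (Num.min d6 d7)) (Num.min d8 d9)).
  by rewrite !lt_min d4p d5p d6p d7p d8p d9p.
move=> jn z z' h1 h2 h3 h4 Dz Dz'; rewrite !lt_min.
move=> /andP[/andP[/andP[zz4 zz5] /andP[zz6 zz7]] /andP[zz8 zz9]].
have [_ adm] := c1P h3 Dz; have [_ adm'] := c1P h4 Dz'.
have TT := d5P z z' j h1 h2 h3 h4 zz5.
have /andP[T0 T1] := Theta01 j z; have /andP[T0' T1'] := Theta01 j z'.
have s0W : s0 <= W j z by exact: scale_le h1 (ltW Dz) s0p.
have s0W' : s0 <= W j z' by exact: scale_le h2 (ltW Dz') s0p.
have qq (v : D j) : `|q0 z v - q0 z' v| <= eta.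
  have V1 : `|V v z'| <= 1 by have /andP[a0 a1] := ext01 (inr (pnt v)) z'; rewrite ger0_norm.
  rewrite /q0.
  apply: le_trans (div_lip s0p s0W s0W' V1 (ext_lip (inr (pnt v)) z z') (ext_lip (inl (inl j)) z z')) _.
  by move: zz9; rewrite /d9 ltr_pdivlMr// mulrDr !mul1r => /ltW.
have pp : Theta j z <= 2 * eta \/ odist (@dD j) (p j z) (p j z') < eta.
  have [|big] := lerP (Theta j z) (2 * eta); first by left.
  right; have big' : eta < Theta j z by apply: le_lt_trans big; rewrite ler_peMl ?(ltW etap)// ler1n.
  have [i [g [gN ga tg]]] := Theta_gt (ltW etap) big'.
  have tg0 : 0 < th i j z by exact: lt_trans etap tg.
  have ga' := d7P z z' i j g h1 h3 zz7 ga tg0.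
  have tg0' : 0 < th i j z' by exact: close_pos (d6P z z' i j h1 h2 zz6) tg.
  have [_ Bi _] := th_gt0 tg0; have [_ Bi' _] := th_gt0 tg0'.
  have gz : @predecessor_value j y z (omap (dmap D g) (y i z)) by exists i, g.
  have gz' : @predecessor_value j y z' (omap (dmap D g) (y i z')) by exists i, g.
  have pz : p j z = omap (dmap D g) (y i z) := agree h3 Dz (xgetPex None (ex_intro _ _ gz)) gz.
  have pz' : p j z' = omap (dmap D g) (y i z') := agree h4 Dz' (xgetPex None (ex_intro _ _ gz')) gz'.
  rewrite pz pz'.
  have ij : precedes i j by exists g.
  have [z8 z2] := c1_half h3; have [a na] := near_exists z2.
  have g0 := active_pos z8 na ga.
  apply: (@omap_ucont R I D dD i j g (Num.min d2 1) eta) => //; first by rewrite ge_min lexx orbT.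
    by move=> x x' xx; apply: (d2P (f a)) => //; apply: lt_le_trans xx _; rewrite ge_min lexx.
  have B3s x : 3 * sg x <= B j * sg x by rewrite ler_wpM2r.
  apply: d4P => //.
  - by apply: leq_trans (rank_lt mL ij) _; rewrite -ltnS.
  - by apply: le_lt_trans Bi.
  - by apply: le_lt_trans Bi'.
rewrite !yE; apply: d1P => //.
- move=> v; rewrite /mix.
  set t := Theta j z; set t' := Theta j z'; set k := odist _ _ _; set k' := odist _ _ _.
  have -> : (1 - t) * q0 z v + t * k - ((1 - t') * q0 z' v + t' * k') =
    (1 - t) * (q0 z v - q0 z' v) - (t - t') * q0 z' v + (t * (k - k') + (t - t') * k') by ring.
  have b1 : `|(1 - t) * (q0 z v - q0 z' v)| <= eta.
    have /andP[c0 c1'] := compl01 T0 T1.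
    by rewrite normrM; apply: le_trans (qq v); rewrite ler_piMl// ger0_norm.
  have b2 : `|(t - t') * q0 z' v| <= eta * 2.
    rewrite normrM; apply: ler_pM => //; exact: q0_bound.
  have k'1 : `|k'| <= 1 by rewrite /k' ger0_norm ?od_le1 ?od_ge0.
  have b3 : `|(t - t') * k'| <= eta.
    by rewrite normrM; apply: le_trans TT; rewrite ler_piMr.
  have b4 : `|t * (k - k')| <= 2 * eta.
    rewrite normrM (ger0_norm T0); case: pp => pp.
      rewrite -[leRHS]mulr1; apply: (ler_pM T0 (normr_ge0 _) pp).
      by apply: dist01; rewrite /k /k' od_ge0 od_le1.
    have kk : `|k - k'| <= eta by apply: le_trans (odist_lip _ _ _) (ltW pp).
    apply: (le_trans (ler_piMl (normr_ge0 _) T1)).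
    by apply: (le_trans kk); rewrite ler_peMl ?(ltW etap)// ler1n.
  have -> : d1 = 8 * eta by rewrite /eta mulrC divfK ?pnatr_eq0.
  exact: norm_sum4 (ltW etap) b1 b2 b4 b3.
- rewrite /height.
  have -> : sg z * (1 - Theta j z) - sg z' * (1 - Theta j z') =
    (sg z - sg z') * (1 - Theta j z) - sg z' * (Theta j z - Theta j z') by ring.
  have b1 : `|(sg z - sg z') * (1 - Theta j z)| <= eta.
    have /andP[c0 c1'] := compl01 T0 T1.
    by rewrite normrM; apply: le_trans (ltW (d8P _ _ zz8)); rewrite ler_piMr// ger0_norm.
  have b2 : `|sg z' * (Theta j z - Theta j z')| <= eta.
    rewrite normrM; apply: le_trans TT; rewrite ler_piMl// ger0_norm//.
    have [h8 _] := c1_half h4; apply: (le_trans h8); exact: eighth_le1.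
  have -> : d1 = 8 * eta by rewrite /eta mulrC divfK ?pnatr_eq0.
  rewrite -[X in `|X|]addr0 -[X in _ + X]addr0.
  apply: norm_sum4 (ltW etap) b1 _ _ _.
  + by apply: le_trans b2 _; rewrite ler_peMr ?(ltW etap)// ler1n.
  + by rewrite normr0; exact: mulr_ge0 (ler0n _ 2) (ltW etap).
  + by rewrite normr0; exact: ltW.
Qed.

(** Away from the closed set this is the previous lemma; near it, the values are
close to values on the closed set, which vary in a controlled way as long as
the weight is bounded below. *)
Lemma values_ucont eta e : 0 < eta -> 0 < e -> exists2 de : R, 0 < de & forall j z z',
  sg z < c1 -> sg z' < c1 -> domain z j -> domain z' j -> eta <= W j z -> eta <= W j z' ->
  d z z' < de -> odist (@dD j) (y j z) (y j z') < e.
Proof.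
move=> etap ep; have e3 : 0 < e / 3 by lra.
have [c2 c2p c2P] := values_near (size L).+1 e3.
(* The distance of the values is that of weighted distances divided by a weight of at least
[eta / 2]. *)
pose kap := eta * (e / 3) / 2.
have kapp : 0 < kap by rewrite divr_gt0// mulr_gt0.
pose c3 := Num.min (Num.min c2 (eta / 4)) (Num.min (kap / 8) 1).
have q1p : 0 < eta / 4 by exact: divr_gt0.
have q2p : 0 < kap / 8 by exact: divr_gt0.
have c3p : 0 < c3 by rewrite !lt_min c2p q1p q2p ltr01.
have [c3a [c3b [c3c c3d]]] : [/\ c3 <= c2, c3 <= eta / 4, c3 <= kap / 8 & c3 <= 1] by rewrite /c3 !ge_min !lexx !orbT.
have c32 : 0 < c3 / 2 by lra.
have [d1 d1p d1P] := sg_ucont c32.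
have [d2 d2p d2P] := values_ucont_away (size L).+1 c32 ep.
exists (Num.min (Num.min d1 d2) (kap / 2)); first by rewrite !lt_min d1p d2p divr_gt0.
move=> j z z' h1 h2 Dz Dz' Wz Wz'; rewrite !lt_min => /andP[/andP[zz1 zz2] zz3].
have /abslt[k1 k2] := d1P z z' zz1.
have rj : (rank L j < (size L).+1)%N by rewrite ltnS; exact: rank_le.
have near_close x x' : sg x < c3 -> sg x' < c3 -> sg x < c1 -> sg x' < c1 -> domain x j -> domain x' j ->
    eta <= W j x' -> d x x' < kap / 2 -> odist (@dD j) (y j x) (y j x') < e.
  move=> x3 x'3 xc x'c Dx Dx' Wx' xx.
  have [x8 x2] := c1_half xc; have [x'8 x'2] := c1_half x'c.
  have [a na] := near_exists x2; have [a' na'] := near_exists x'2.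
  have [v vv] := is_value_exists (domain_pos x8 na Dx).
  have [v' vv'] := is_value_exists (domain_pos x'8 na' Dx').
  have [yv _] := c2P j rj x a v (lt_le_trans x3 c3a) na Dx vv.
  have [yv' _] := c2P j rj x' a' v' (lt_le_trans x'3 c3a) na' Dx' vv'.
  have [_ dC dT] := dm; have [_ oC oT] := om j.
  have daa : d a a' <= 2 * (sg x * sg x) + kap / 2 + 2 * (sg x' * sg x').
    apply: le_trans (dT a x' a') _; apply: lerD.
      by apply: le_trans (dT a x x') _; apply: lerD; [exact: na.2|exact: ltW].
    by rewrite dC; exact: na'.2.
  have h0 : `|hcoord dD (inr (pnt v)) (f a) - hcoord dD (inr (pnt v)) (f a')| <= d a a'.
    apply: le_trans (f_lip na.1 na'.1); exact: hocolim_dist_ub.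
  have e1 : hcoord dD (inr (pnt v)) (f a) = 0.
    by have := vv.2 v; rewrite /pdist (metricxx _ (dD_metric j)) mulr0.
  have e2 : hcoord dD (inr (pnt v)) (f a') = pweight dD j (f a') * dD v' v by exact: vv'.2.
  rewrite e1 e2 sub0r normrN in h0.
  have w' : eta / 2 <= pweight dD j (f a').
    exact: weight_half (near_ext (inl (inl j)) na') (sg_ge0 x') (sq_small x'8) (ltW (lt_le_trans x'3 c3b)) Wx'.
  have vv1 : dD v' v < e / 3.
    apply: (value_close etap (metric_ge0 (dD_metric j) v' v) w' h0 daa
      (sq_small x8) (sq_small x'8) x3 x'3 c3c) => //.
  have t1 := oT (y j x) (Some v) (y j x'); have t2 := oT (Some v) (Some v') (y j x').
  rewrite (oC (Some v') (y j x')) in t2; have [_ dC' _] := dD_metric j.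
  rewrite /= (dC' v v') in t2; exact: three_thirds t1 t2 yv vv1 yv'.
have [small|big] := ltrP (sg z) (c3 / 2).
  have [? ?] := near_scale c3p small k1 k2; exact: near_close.
have [small'|big'] := ltrP (sg z') (c3 / 2); last exact: d2P.
have [? ?] := near_scale' c3p small' k1 k2; exact: near_close.
Qed.

(** With weights decreased by [C * sg], an object of positive weight is above all the
thresholds [B j + 1], so that the values at any two such objects are compatible. *)
Let C : R := 4 + (size L)%:R.

Let C4 : 4 <= C.
Proof. by rewrite /C lerDl. Qed.

Let B_C j : B j + 1 <= C.
Proof.
have : (rank L j)%:R <= (size L)%:R :> R by rewrite ler_nat rank_le.
by rewrite /B /C; lra.
Qed.

Let T j z : R := Num.max 0 (W j z - C * sg z).
Let total z : R := \sum_(j <- L) T j z.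

Let Csg_ge0 z : 0 <= C * sg z.
Proof. by rewrite mulr_ge0//; have := C4; lra. Qed.

Let T_bounds j z : W j z - C * sg z <= T j z <= 1.
Proof. by apply: max0_bounds => //; exact: ext01. Qed.

Let T_ge0 j z : 0 <= T j z.
Proof. by rewrite /T le_max lexx. Qed.

Let T_gt0 j z : 0 < T j z -> [/\ T j z = W j z - C * sg z, C * sg z < W j z, domain z j & T j z <= W j z].
Proof.
move=> /max0_gt0; rewrite -/(T j z) => -[-> h].
have h1 : C * sg z < W j z by rewrite -subr_gt0.
split=> //; last by rewrite gerBl.
by apply: le_lt_trans h1; rewrite ler_wpM2r//; have := C4; lra.
Qed.

(** Below this scale at least half of the total weight is left. *)
Let scale : R := Num.min c1 (1 / (4 * ((size L).+1%:R * (C + 1)))).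

Let scale_pos : 0 < scale.
Proof.
rewrite /scale lt_min c1p divr_gt0// mulr_gt0// mulr_gt0//.
by have := C4; lra.
Qed.

Let total_ge z : sg z < scale -> 1 / 2 <= total z.
Proof.
rewrite /scale lt_min => /andP[zc zK]; have [z8 z2] := c1_half zc; have [a na] := near_exists z2.
have C1 : 0 < C + 1 by have := C4; lra.
have MC : 0 < (size L).+1%:R * (C + 1) by rewrite mulr_gt0.
have h1 : (size L).+1%:R * ((C + 1) * sg z) <= 1 / 2.
  move: zK; rewrite ltr_pdivlMr ?mulr_gt0// => zK; rewrite mulrA; lra.
have : \sum_(j <- L) (pweight dD j (f a) - (C + 1) * sg z) <= total z.
  apply: ler_sum => j _; have /andP[h _] := T_bounds j z; apply: le_trans h.
  have /absle[h2 h3] := near_ext (inl (inl j)) na; have := sq_small z8; have := sg_ge0 z.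
  by move: h2 h3; rewrite -[ext _ z]/(W j z) -/(pweight dD j (f a)); lra.
rewrite sumrB (sum_pweight dD (f a) uL mL) big_const_seq count_predT iter_addr_0 -mulr_natl.
have : (size L)%:R * ((C + 1) * sg z) <= (size L).+1%:R * ((C + 1) * sg z).
  by rewrite ler_wpM2r ?ler_nat// mulr_ge0// ltW.
lra.
Qed.

Let wt j z : R := T j z / total z.

Let wt_ge0 j z : 0 <= wt j z.
Proof. by rewrite divr_ge0//; apply: sumr_ge0 => i _; exact: T_ge0. Qed.

Let wt_T j z : sg z < scale -> wt j z / 2 <= T j z.
Proof.
move=> /total_ge h; have tp : 0 < total z by lra.
rewrite /wt; set w := T j z / total z; have -> : T j z = w * total z by rewrite /w divfK// gt_eqF.
have w0 : 0 <= w by exact: wt_ge0.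
by rewrite ler_wpM2l//; lra.
Qed.

Let wt_gt0 j z : sg z < scale -> 0 < wt j z -> 0 < T j z.
Proof. by move=> zs wp; apply: lt_le_trans (wt_T j zs); rewrite divr_gt0. Qed.

Let wt_le1 j z : sg z < scale -> wt j z <= 1.
Proof.
move=> zs; have tp : 0 < total z by have := total_ge zs; lra.
rewrite /wt ler_pdivrMr// mul1r /total (big_rem (j : {classic I}))//= lerDl.
by apply: sumr_ge0 => i _; exact: T_ge0.
Qed.

(** The point [a] only serves to tell which morphisms occur in [q]. *)
Definition extended_point z a (q : hocolim R D) :=
  [/\ forall j, pweight dD j q = wt j z,
    forall j (v : D j), pdist dD (pnt v) q = wt j z * odist (@dD j) (y j z) (Some v) &
    forall i j (g : hom i j), pedge dD g q = if `[< 0 < pedge dD g (f a) >] then Num.min (wt i z) (wt j z) else 0].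

Let scale_c1 z : sg z < scale -> sg z < c1.
Proof. by rewrite /scale lt_min => /andP[]. Qed.

Let extended_point_exists z : sg z < scale -> exists q a, near_point z a /\ extended_point z a q.
Proof.
move=> zs; have zc := scale_c1 zs; have [z8 z2] := c1_half zc; have [a na] := near_exists z2.
have tp : 0 < total z by have := total_ge zs; lra.
have C3 : 2 * sg z <= C * sg z by rewrite ler_wpM2r//; have := C4; lra.
have [|||||q qP] := @realization R I D dD L (f a) (wt^~ z) (y^~ z) uL mL.
- by move=> j; exact: wt_ge0.
- move=> j /(wt_gt0 zs)/T_gt0[_ _ Dj _]; exact: (domain_pos z8 na).
- by rewrite /wt -mulr_suml divff// gt_eqF.
- by move=> j /(wt_gt0 zs)/T_gt0[_ _ Dj _]; have [] := c1P zc Dj.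
- move=> i j g /(wt_gt0 zs)/T_gt0[_ Ci Di _] /(wt_gt0 zs)/T_gt0[_ Cj Dj _] g0.
  have [gI|gN] := pselect (is_identity g).
    case: gI g0 => _; case: (y i z) => //= u; by rewrite dmap_id.
  have ga : active g z.
    apply: (pedge_active z8 na g0); [exact: le_trans C3 (ltW Ci)|exact: le_trans C3 (ltW Cj)].
  have BC k : C * sg z < W k z -> (B j + 1) * sg z <= W k z.
    by move=> /ltW; apply: le_trans; rewrite ler_wpM2r.
  have [_ cmp] := values_compat (ltnSn (rank L j)).
  by apply: cmp => //; exact: BC.
- by exists q, a.
Qed.

Let K : R := 2 + 4 * (size L)%:R.

Let K2 : 2 <= K.
Proof. by rewrite /K lerDl mulr_ge0. Qed.

Let wt_lip j z z' : sg z < scale -> sg z' < scale ->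
  `|wt j z - wt j z'| <= K * (d z z' + C * `|sg z - sg z'|).
Proof.
move=> zs zs'; set m := d z z' + _.
have Tm i : `|T i z - T i z'| <= m.
  apply: max0_dist; rewrite opprD opprK addrACA.
  apply: le_trans (ler_normD _ _) _; apply: lerD; first exact: ext_lip.
  rewrite -mulrN -mulrDr normrM ger0_norm; last by have := C4; lra.
  by rewrite distrC (addrC (- _)).
have T1 : `|T j z'| <= 1 by rewrite (ger0_norm (T_ge0 j z')); have /andP[] := T_bounds j z'.
have tm : `|total z - total z'| <= (size L)%:R * m.
  rewrite /total -sumrB; apply: le_trans (ler_norm_sum _ _ _) _.
  apply: (@le_trans _ _ (\sum_(i <- L) m)); first by apply: ler_sum => i _; exact: Tm.
  by rewrite big_const_seq count_predT iter_addr_0 mulr_natl.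
apply: le_trans (ratio_lip (total_ge zs) (total_ge zs') T1 (Tm j) tm) _.
exact: affine_factor.
Qed.

Let wt_ucont e : 0 < e -> exists2 de : R, 0 < de & forall j z z',
  sg z < scale -> sg z' < scale -> d z z' < de -> `|wt j z - wt j z'| <= e.
Proof.
move=> ep; have Kp : 0 < K by exact: lt_le_trans (ltr0n _ 2) K2.
have Cp : 0 < C by exact: lt_le_trans (ltr0n _ 4) C4.
have e1 : 0 < e / 2 / K by rewrite !divr_gt0.
have e2 : 0 < e / 2 / K / C by rewrite !divr_gt0.
have [d1 d1p d1P] := sg_ucont e2.
exists (Num.min d1 (e / 2 / K)); first by rewrite lt_min d1p.
move=> j z z' zs zs'; rewrite lt_min => /andP[/d1P zz1 zz2].
apply: le_trans (wt_lip j zs zs') _.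
have h : C * `|sg z - sg z'| <= e / 2 / K by rewrite mulrC -ler_pdivlMr// ltW.
have : K * (d z z' + C * `|sg z - sg z'|) <= K * (e / 2 / K + e / 2 / K).
  by apply: ler_wpM2l; [exact: ltW|apply: lerD => //; exact: ltW].
by move=> /le_trans; apply; rewrite -mulrDl -splitr mulrC divfK// gt_eqF.
Qed.

(** A morphism can only disappear when the weight of one of its ends is small. *)
Let pedge_transfer e : 0 < e -> exists2 de : R, 0 < de & forall z z' a a' i j (g : hom i j),
  sg z < scale -> sg z' < scale -> near_point z a -> near_point z' a' -> d z z' < de ->
  0 < pedge dD g (f a) -> e < wt i z -> e < wt j z -> 0 < pedge dD g (f a').
Proof.
move=> ep; have e8 : 0 < e / 8 by rewrite divr_gt0.
have [d1 d1p d1P] := sg_ucont e8.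
exists (Num.min d1 (e / 8)); first by rewrite lt_min d1p.
move=> z z' a a' i j g zs zs' na na'; rewrite lt_min => /andP[/d1P/abslt[k1 _] zz] g0 wi wj.
have [z8 _] := c1_half (scale_c1 zs); have [z8' _] := c1_half (scale_c1 zs').
have big k : e < wt k z -> e / 2 + 4 * sg z < pweight dD k (f a) + 2 * (sg z * sg z).
  move=> wk; have Tk : e / 2 < T k z.
    by apply: lt_le_trans (wt_T k zs); rewrite ltr_pM2r ?invr_gt0 ?ltr0n.
  have [TE _ _ _] := T_gt0 (lt_trans (fraction_pos ep (ltr0n _ 2)) Tk); rewrite TE in Tk.
  have /absle[_ h] := near_ext (inl (inl k)) na.
  have C4s : 4 * sg z <= C * sg z by rewrite ler_wpM2r.
  by move: Tk h; rewrite -[ext _ z]/(W k z) -/(pweight dD k (f a)); move: C4s; lra.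
have ge : e / 2 + 4 * sg z < pedge dD g (f a) + 2 * (sg z * sg z).
  by rewrite (pedge_min g0) -ltrBlDr lt_min !ltrBlDr !big.
rewrite ltNge; apply/negP => g'0.
have h0 : `|pedge dD g (f a) - pedge dD g (f a')| <= d a a'.
  by apply: le_trans (f_lip na.1 na'.1); exact: hocolim_dist_ub.
have [_ dC dT] := dm.
have daa : d a a' <= 2 * (sg z * sg z) + d z z' + 2 * (sg z' * sg z').
  apply: le_trans (dT a z' a') _; apply: lerD; last by rewrite dC; exact: na'.2.
  by apply: le_trans (dT a z z') _; rewrite lerD2r; exact: na.2.
apply: (edge_weight_contra ep (sg_ge0 z) (sq_small z8) (sq_small z8') ge k1 zz).
apply: le_trans daa; apply: le_trans h0; apply: le_trans (ler_norm _).
by rewrite lerDl oppr_ge0.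
Qed.

Let pdist_ucont e : 0 < e -> exists2 de : R, 0 < de & forall j z z' (v : D j),
  sg z < scale -> sg z' < scale -> d z z' < de ->
  `|wt j z * odist (@dD j) (y j z) (Some v) - wt j z' * odist (@dD j) (y j z') (Some v)| <= e.
Proof.
move=> ep; have e8 : 0 < e / 8 by rewrite divr_gt0.
have e16 : 0 < e / 8 / 2 by rewrite divr_gt0.
have e2 : 0 < e / 2 by rewrite divr_gt0.
have [d1 d1p d1P] := wt_ucont e8; have [d2 d2p d2P] := values_ucont e16 e2.
exists (Num.min d1 d2); first by rewrite lt_min d1p.
move=> j z z' v zs zs'; rewrite lt_min => /andP[zz1 zz2].
apply: product_close => //.
- exact: wt_le1.
- by rewrite od_ge0 od_le1.
- by rewrite od_ge0 od_le1.
- exact: d1P.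
move=> t4 t8; apply: le_trans (odist_lip _ _ _) _; apply: ltW.
have TW x : sg x < scale -> e / 8 <= wt j x -> domain x j /\ e / 8 / 2 <= W j x.
  move=> xs h; have Tx : e / 8 / 2 <= T j x by apply: le_trans (wt_T j xs); rewrite ler_pM2r ?invr_gt0 ?ltr0n.
  have [_ _ Dx TWx] := T_gt0 (lt_le_trans e16 Tx); split=> //; exact: le_trans TWx.
have h8 : e / 8 <= wt j z by apply: le_trans t4; rewrite ler_pM2l// lef_pV2 ?posrE// ler_nat.
have [Dz Wz] := TW z zs h8; have [Dz' Wz'] := TW z' zs' t8.
by apply: d2P => //; exact: scale_c1.
Qed.

Let extended_point_ucont e : 0 < e -> exists2 de : R, 0 < de & forall z z' a a' q q',
  sg z < scale -> sg z' < scale -> near_point z a -> near_point z' a' ->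
  extended_point z a q -> extended_point z' a' q' -> d z z' < de -> hocolim_dist dD q q' <= e.
Proof.
move=> ep; have [d1 d1p d1P] := wt_ucont ep; have [d2 d2p d2P] := pedge_transfer ep.
have [d3 d3p d3P] := pdist_ucont ep; have [_ dC _] := dm.
exists (Num.min d1 (Num.min d2 d3)); first by rewrite !lt_min d1p d2p.
move=> z z' a a' q q' zs zs' na na' [q1 q2 q3] [q1' q2' q3']; rewrite !lt_min => /and3P[zz1 zz2 zz3].
have lost x x' b b' i j (g : hom i j) : sg x < scale -> sg x' < scale -> near_point x b -> near_point x' b' ->
    d x x' < d2 -> 0 < pedge dD g (f b) -> ~ 0 < pedge dD g (f b') -> `|Num.min (wt i x) (wt j x)| <= e.
  move=> xs xs' nb nb' xx g0 ng; rewrite ger0_norm ?le_min ?wt_ge0// leNgt lt_min; apply/negP => /andP[wi wj].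
  by apply: ng; exact: (d2P x x' b b' i j g).
apply: hocolim_dist_le => [|co]; first exact: ltW.
case: co => [[j|[[i j] g]]|[j v]].
- rewrite -[hcoord dD _ q]/(pweight dD j q) -[hcoord dD _ q']/(pweight dD j q') q1 q1'; exact: d1P.
- rewrite -[hcoord dD _ q]/(pedge dD (g : hom i j) q) -[hcoord dD _ q']/(pedge dD (g : hom i j) q') q3 q3'.
  case: asboolP => g0; case: asboolP => g0'.
  + by apply: min_lip; exact: d1P.
  + rewrite subr0; exact: (lost z z' a a' i j g).
  + rewrite sub0r normrN; rewrite dC in zz2; exact: (lost z' z a' a i j g).
  + by rewrite subrr normr0 ltW.
- rewrite -[hcoord dD _ q]/(pdist dD (pnt (v : D j)) q) -[hcoord dD _ q']/(pdist dD (pnt (v : D j)) q') q2 q2'.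
  exact: d3P.
Qed.

Let extended_point_id a a' q : A a -> near_point a a' -> extended_point a a' q -> q = f a.
Proof.
move=> Aa /(near_A_eq Aa) -> {a'} [q1 q2 q3]; have co0 co := hcoord01 dDm dD1 co (f a).
have TE j : T j a = pweight dD j (f a).
  rewrite /T sg_A// mulr0 subr0 /W ext_id// max_r//; by case/andP: (co0 (inl (inl j))).
have wE j : wt j a = pweight dD j (f a).
  by rewrite /wt /total (eq_bigr _ (fun j _ => TE j)) (sum_pweight dD (f a) uL mL) divr1.
apply: (hcoord_inj dDm dD1) => -[[j|[[i j] g]]|[j v]].
- by rewrite -[LHS]/(pweight dD j q) q1.
- rewrite -[LHS]/(pedge dD (g : hom i j) q) -[RHS]/(pedge dD (g : hom i j) (f a)) q3.
  case: asboolP => [g0|/negP]; first by rewrite (pedge_min g0) !wE.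
  rewrite -leNgt => g0; apply/eqP; rewrite eq_le g0 andbT.
  by case/andP: (co0 (inl (inr (mor (g : hom i j))))).
- rewrite -[LHS]/(pdist dD (pnt (v : D j)) q) -[RHS]/(pdist dD (pnt (v : D j)) (f a)) q2 wE.
  have [w0|w0] := ltP 0 (pweight dD j (f a)).
    have [u uv] := is_value_exists w0; rewrite (values_at_A Aa uv); by case: uv => _ ->.
  have /andP[p0 p1] := pdist_le_pweight dDm dD1 v (f a).
  have wz : pweight dD j (f a) = 0 by apply/eqP; rewrite eq_le w0 (le_trans p0 p1).
  by rewrite wz mul0r; rewrite wz in p1; apply/eqP; rewrite eq_le p0 p1.
Qed.

Lemma assembled_extension : exists2 e : R, 0 < e & exists F : Z -> hocolim R D,
  (forall a, A a -> F a = f a) /\ ucont_on d (hocolim_dist dD) (metric_nbhd d A e) F.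
Proof.
have /choice[F FP] : forall z, exists q, sg z < scale -> exists a, near_point z a /\ extended_point z a q.
  move=> z; have [zs|zs] := pselect (sg z < scale); last by exists (f z).
  by have [q qP] := extended_point_exists zs; exists q.
have small z : metric_nbhd d A (scale * scale) z -> sg z < scale.
  move=> [a Aa az]; rewrite ltNge; apply/negP => h.
  have : scale * scale <= sg z * sg z by apply: ler_pM => //; exact: ltW.
  by rewrite sg_sq leNgt (le_lt_trans (set_dist_le dm z Aa) az).
exists (scale * scale); first exact: mulr_gt0.
exists F; split=> [a Aa|e ep].
  have [|a' [na qP]] := FP a; first by rewrite sg_A.
  exact: extended_point_id qP.
have e2 : 0 < e / 2 by rewrite divr_gt0.
have [de dep deP] := extended_point_ucont e2; exists de => // z z' /small zs /small zs' zz.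
have [a [na qP]] := FP z zs; have [a' [na' qP']] := FP z' zs'.
by apply: le_lt_trans (deP _ _ _ _ _ _ zs zs' na na' qP qP' zz) _; rewrite ltr_pdivrMr// ltr_pMr// ltr1n.
Qed.

End GoodScale.

Lemma extension_of_values : exists2 e : R, 0 < e & exists F : Z -> hocolim R D,
  (forall a, A a -> F a = f a) /\ ucont_on d (hocolim_dist dD) (metric_nbhd d A e) F.
Proof.
have [c cp cP] := values_near (size L).+1 ltr01.
have q8 : 0 < 1 / 8 :> R by exact: divr_gt0.
apply: (@assembled_extension (Num.min c (1 / 8))).
- by rewrite lt_min cp.
- by rewrite ge_min lexx orbT.
move=> j z; rewrite lt_min => /andP[zc z8] Dz.
have z2 : sg z <= 1 / 2 by apply: le_trans (ltW z8) _; rewrite ler_pM2l// lef_pV2 ?posrE// ler_nat.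
have [a na] := near_exists z2.
have [v vv] := is_value_exists (domain_pos (ltW z8) na Dz).
have rj : (rank L j < (size L).+1)%N by rewrite ltnS; exact: rank_le.
have [yv adm] := cP j rj z a v zc na Dz vv; split=> //.
by case: (y j z) yv => [w|] /=; [exists w|rewrite ltxx].
Qed.

End ExtendedValues.

Lemma hocolim_extension : exists2 e : R, 0 < e & exists F : Z -> hocolim R D,
  (forall a, A a -> F a = f a) /\ ucont_on d (hocolim_dist dD) (metric_nbhd d A e) F.
Proof. by have [y yE] := extended_values_exist; exact: extension_of_values yE. Qed.

End HocolimExtension.

Lemma hocolim_extensor (R : realType) (I : finite_category) (D : diagram I)
    (dD : forall i : I, D i -> D i -> R) (e0 : I -> R) (r : forall i : I, (D i -> R) -> R -> option (D i)) :
  (forall i, metrizes (@dD i)) -> (forall i x y, @dD i x y <= 1) ->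
  (forall i, near_retraction (@dD i) (e0 i) (@r i)) ->
  uniform_extensor (hocolim_dist dD).
Proof.
move=> dDm dD1 rP Z d A f dm _ cA f_lip; have [L [uL mL]] := finite_objects I.
exact: (hocolim_extension dDm dD1 rP dm cA f_lip uL mL).
Qed.

(** * Homotopy limits and colimits of uniform ANRs *)

Theorem theorem14p7 (R : realType) (I : finite_category) (D : diagram I)
    (hD : forall i : I, uniform_ANR R (D i)) :
  uniform_ANR R (holim R D) /\ uniform_ANR R (hocolim R D).
Proof.
have data i := cid (uniform_ANR_retraction (hD i)).
pose dD i := projT1 (data i).
have dDm i : metrizes (@dD i) by have [] := projT2 (data i).
have dD1 i x y : @dD i x y <= 1 by have [_ h _] := projT2 (data i); exact: h.
have ret i : {e0 : R & {r | near_retraction (@dD i) e0 r}}.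
  by have [_ _ /cid[e0 /cid[r rP]]] := projT2 (data i); exists e0, r.
pose e0 i := projT1 (ret i); pose r i := sval (projT2 (ret i)).
have rP i : near_retraction (@dD i) (e0 i) (@r i) := svalP (projT2 (ret i)).
split.
  apply: (uniform_extensor_ANR (holim_metrizes dDm dD1)); first exact: holim_dist_le1.
  exact: (holim_extensor dDm dD1 rP).
apply: (uniform_extensor_ANR (hocolim_metrizes dDm dD1)); first exact: hocolim_dist_le1.
exact: (hocolim_extensor dDm dD1 rP).
Qed.
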